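(* Let $B_H=\{B_H(t)\}_{t\in\mathbb{R}}$ be an $\mathbb{R}^n$-valued operator fractional Brownian motion such that $\Re(AA^* )$ has full rank, $\Im(AA^* )=0$, and $$H=P\,\mathrm{diag}(h_1,\ldots,h_n)P^{-1},\quad 0<h_1<\cdots<h_n<1,\quad P\in O(n),$$ with columns $p_{\cdot,1},\ldots,p_{\cdot,n}$ of $P$. Fix an octave $j\in\mathbb{N}\cup\{0\}$. Then there is a consistent sequence of wavelet eigenvectors for $P$; that is, for each $q=1,\ldots,n$ there is a sequence $\{u_q(\nu)\}_{\nu\in\mathbb{N}}$ of unit eigenvectors of $W_a(a(\nu)2^j)$ associated with its $q$-th eigenvalue $\lambda_q(W_a(a(\nu)2^j))$ such that $u_q(\nu)\stackrel{P}{\to}p_{\cdot,q}$ as $\nu\to\infty$.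
   Context: Notation: $A^*$ is the conjugate transpose; $c^{M}=\exp(\log(c)\,M)$ for $c>0$ and a square matrix $M$; $O(n)$ is the group of real orthogonal $n\times n$ matrices; $\lambda_1(S)\le\cdots\le\lambda_n(S)$ are the ordered eigenvalues of a Hermitian positive semidefinite $n\times n$ matrix $S$; $\stackrel{P}{\to}$ is convergence in probability. Operator fractional Brownian motion (OFBM). Let $n\ge2$, let $H$ be a real $n\times n$ matrix all of whose eigenvalues have real part in $(0,1)$, put $D=H-\frac12 I$, and let $A\in M(n,\mathbb{C})$. The OFBM $B_H$ with parameters $(H,A)$ is the $\mathbb{R}^n$-valued Gaussian process given, in the sense of finite-dimensional distributions, by $$B_H(t)=\int_{\mathbb{R}}\frac{e^{\mathbf{i}tx}-1}{\mathbf{i}x}\{x_+^{-D}A+x_-^{-D}\overline{A}\}\,\widetilde B(dx),$$ where $x_\pm=\max\{\pm x,0\}$, $x_\pm^{-D}$ is understood to be $0$ when $x_\pm=0$, and $\widetilde B$ is a $\mathbb{C}^n$-valued Gaussian random measure with $\widetilde B(-dx)=\overline{\widetilde B(dx)}$ and $\mathbb{E}\widetilde B(dx)\widetilde B(dx)^*=dx\,I$. It has stationary increments and satisfies $\{B_H(ct)\}_t\stackrel{\mathcal L}{=}\{c^HB_H(t)\}_t$ for $c>0$. Wavelet. $\psi\in L^1(\mathbb{R})$ is a real function with $\int\psi^2=1$, $\int t^p\psi(t)dt=0$ for $p=0,\ldots,N_\psi-1$, where $N_\psi\ge2$; $\mathrm{supp}(\psi)$ is a compact interval; and for some $\alpha>1$,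 $\sup_{x}|\widehat\psi(x)|(1+|x|)^\alpha<\infty$, with $\widehat\psi$ the Fourier transform. The wavelet transform is $D(2^j,k)=2^{-j/2}\int_{\mathbb{R}}2^{-j/2}\psi(2^{-j}t-k)B_H(t)\,dt\in\mathbb{R}^n$, $j\in\mathbb{N}\cup\{0\}$, $k\in\mathbb{Z}$. Scaling factor. For sample size $\nu\in\mathbb{N}$, $a(\nu)$ is a power of $2$ with $a(\nu)\le\nu/2^j$ (for the octaves $j$ in use) and $$\frac{a(\nu)}{\nu}+\frac{\nu}{a(\nu)^{1+2\varpi_0}}\to0,\quad\nu\to\infty.$$ Here, if $\rho_1\le\cdots\le\rho_n$ are the real parts of the eigenvalues of $H$ (with multiplicity) and $\delta=\min_{q_1<q_2}(\rho_{q_2}-\rho_{q_1})$, then $\varpi_0=\min\{\rho_1,\delta\}$ if $\delta>0$ and $\varpi_0=\rho_1$ if $\delta=0$. Sample wavelet variance. $W_a(a(\nu)2^j)=\frac1{K_{a,j}}\sum_{k=1}^{K_{a,j}}D(a(\nu)2^j,k)D(a(\nu)2^j,k)^*$ with $K_{a,j}=\nu/(a(\nu)2^j)$; $\nu$ ranges over values for which $K_{a,j}$ is an integer. *)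

(* Defs.v *)
From HB Require Import structures.
From mathcomp Require Import all_boot all_order all_algebra.
From mathcomp Require Import all_classical all_reals all_analysis.
From mathcomp Require Import complex.

Set Implicit Arguments.
Unset Strict Implicit.
Unset Printing Implicit Defensive.

Import Order.TTheory GRing.Theory Num.Theory numFieldNormedType.Exports.

Local Open Scope classical_set_scope.
Local Open Scope ring_scope.
Local Open Scope complex_scope.
Local Open Scope sesquilinear_scope.

Definition cplxmx (R : realType) (m n : nat) (M : 'M[R]_(m, n)) :
  'M[R[i]]_(m, n) := map_mx (real_complex R) M.

Definition entrywise_conj (R : realType) (m n : nat) (M : 'M[R[i]]_(m, n)) :
  'M[R[i]]_(m, n) := map_mx Num.conj M.

(* Squared Frobenius norm; the squared Euclidean norm on column vectors. *)
Definition sqnormC (R : realType) (m n : nat) (M : 'M[R[i]]_(m, n)) : R :=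
  \sum_i \sum_j (complex.Re (M i j) ^+ 2 + complex.Im (M i j) ^+ 2).

Definition enorm (R : realType) (n : nat) (u : 'cV[R]_n) : R :=
  Num.sqrt (\sum_i u i 0 ^+ 2).

(* The roots of the characteristic polynomial, listed with multiplicity. *)
Definition eigenvalues (R : realType) (n : nat) (M : 'M[R[i]]_n) : seq R[i] :=
  sval (closed_field_poly_normal (char_poly M)).

Definition eig_real_parts (R : realType) (n : nat) (M : 'M[R]_n) : seq R :=
  sort <=%R [seq complex.Re z | z <- eigenvalues (cplxmx M)].

(* Used only for real symmetric [S], whose eigenvalues are real, so that taking
   real parts loses nothing; [q] counts from 0. *)
Definition ordered_eigenvalue (R : realType) (n : nat) (S : 'M[R]_n)
  (q : 'I_n) : R := (eig_real_parts S)`_q.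

Definition mxexp (R : realType) (n : nat) (M : 'M[R]_n) : 'M[R]_n :=
  \matrix_(i, j) limn (series (fun k : nat => (M ^+ k) i j / k`!%:R : R)).

(* [c ^ M] for [c > 0], and 0 for [c <= 0]. *)
Definition mxpower (R : realType) (n : nat) (c : R) (M : 'M[R]_n) : 'M[R]_n :=
  if 0 < c then mxexp (ln c *: M) else 0.

Definition cis (R : realType) (x : R) : R[i] := cos x +i* sin x.

(* The case [s = 0] is separate because [normal_prob m 0] is not a Dirac mass in
   the library. *)
Definition centered_gaussian (d : measure_display) (T : measurableType d)
    (R : realType) (P : probability T R) (X : T -> R) : Prop :=
  measurable_fun setT X /\
  exists s : R,
    if s == 0 then {ae P, forall w, X w = 0}
    else forall E : set R, measurable E -> P (X @^-1` E) = normal_prob 0 s E.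

Definition mx_expectation (d : measure_display) (T : measurableType d)
    (R : realType) (P : probability T R) (m n : nat)
    (M : T -> 'M[R[i]]_(m, n)) : 'M[R[i]]_(m, n) :=
  \matrix_(i, j) ((\int[P]_w complex.Re (M w i j)) +i*
                  (\int[P]_w complex.Im (M w i j))).

Definition finite_borel (R : realType) (E : set R) : Prop :=
  measurable E /\ (lebesgue_measure E < +oo)%E.

(* The C^n-valued Gaussian random measure with
   B(-dx) = conj (B(dx)) and E B(dx) B(dx)^* = dx I. *)
Record gaussian_random_measure (d : measure_display) (T : measurableType d)
    (R : realType) (P : probability T R) (n : nat)
    (Bt : set R -> T -> 'cV[R[i]]_n) : Prop := GaussianRandomMeasure {
  grm_gaussian : forall (m : nat) (E : 'I_m -> set R) (a b : 'I_m -> 'I_n -> R),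
    (forall k, finite_borel (E k)) ->
    centered_gaussian P (fun w => \sum_k \sum_i
      (a k i * complex.Re (Bt (E k) w i 0) + b k i * complex.Im (Bt (E k) w i 0)));
  grm_additive : forall F : nat -> set R,
    (forall k, finite_borel (F k)) -> trivIset setT F ->
    finite_borel (\bigcup_k F k) ->
    (\int[P]_w (sqnormC (Bt (\bigcup_k F k) w
                         - \sum_(k < N) Bt (F k) w))%:E)%E
      @[N --> \oo] --> 0%E;
  grm_hermitian : forall E : set R, finite_borel E ->
    {ae P, forall w, Bt [set - x | x in E] w = entrywise_conj (Bt E w)};
  grm_covariance : forall E F : set R, finite_borel E -> finite_borel F ->
    mx_expectation P (fun w => Bt E w *m (Bt F w) ^t*)
      = ((fine (lebesgue_measure (E `&` F)))%:C)%:M }.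

(* [Y] is (a version of) the Wiener integral of [f] with respect to [Bt]: the
   L^2(P)-limit of the integrals of simple functions
   \sum_k C_k 1_(E_k) converging to [f] in L^2(dx). *)
Definition is_wiener_integral (d : measure_display) (T : measurableType d)
    (R : realType) (P : probability T R) (n : nat)
    (Bt : set R -> T -> 'cV[R[i]]_n) (f : R -> 'M[R[i]]_n)
    (Y : T -> 'cV[R[i]]_n) : Prop :=
  [/\ forall i j, measurable_fun setT (fun x => complex.Re (f x i j)) /\
                  measurable_fun setT (fun x => complex.Im (f x i j)),
      forall i, measurable_fun setT (fun w => complex.Re (Y w i 0)) /\
                measurable_fun setT (fun w => complex.Im (Y w i 0)) &
      exists (m : nat -> nat) (E : nat -> nat -> set R)
             (C : nat -> nat -> 'M[R[i]]_n),
        [/\ forall N k, finite_borel (E N k),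
            (\int[lebesgue_measure]_x
               (sqnormC (f x - \sum_(k < m N)
                                 (\1_(E N k) x : R)%:C *: C N k))%:E)%E
              @[N --> \oo] --> 0%E &
            (\int[P]_w
               (sqnormC (Y w - \sum_(k < m N) C N k *m Bt (E N k) w))%:E)%E
              @[N --> \oo] --> 0%E]].

Definition same_fdd (R : realType) (n : nat)
    (d : measure_display) (T : measurableType d) (P : probability T R)
    (X : R -> T -> 'cV[R]_n)
    (d' : measure_display) (T' : measurableType d') (P' : probability T' R)
    (Y : R -> T' -> 'cV[R]_n) : Prop :=
  forall (m : nat) (t : 'I_m -> R) (E : 'I_m -> 'I_n -> set R),
    (forall k i, measurable (E k i)) ->
    P [set w | forall k i, E k i (X (t k) w i 0)] =
    P' [set w | forall k i, E k i (Y (t k) w i 0)].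

Definition ofbm_kernel (R : realType) (n : nat) (H : 'M[R]_n)
    (A : 'M[R[i]]_n) (t x : R) : 'M[R[i]]_n :=
  let D := H - (2^-1)%:M in
  ((cis (t * x) - 1) / ('i * x%:C)) *:
    (cplxmx (mxpower (Num.max x 0) (- D)) *m A
     + cplxmx (mxpower (Num.max (- x) 0) (- D)) *m entrywise_conj A).

(* [B] is an OFBM with parameters (H, A). The integral representation holds in
   the sense of finite-dimensional distributions, so the random measure lives on
   a probability space of its own. Joint measurability of [(w, t) |-> B t w] is
   what makes the pathwise integrals of the wavelet transform random variables. *)
Definition is_ofbm (d : measure_display) (T : measurableType d)
    (R : realType) (P : probability T R) (n : nat) (H : 'M[R]_n)
    (A : 'M[R[i]]_n) (B : R -> T -> 'cV[R]_n) : Prop :=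
  [/\ forall rho : R, rho \in eig_real_parts H -> 0 < rho < 1,
      forall i : 'I_n,
        measurable_fun setT (fun p : T * measurableTypeR R => B p.2 p.1 i 0) &
      exists (d' : measure_display) (T' : measurableType d')
             (P' : probability T' R) (Bt : set R -> T' -> 'cV[R[i]]_n)
             (Y : R -> T' -> 'cV[R]_n),
        [/\ gaussian_random_measure P' Bt,
            forall t, is_wiener_integral P' Bt (ofbm_kernel H A t)
                        (fun w => cplxmx (Y t w)) &
            same_fdd P B P' Y]].

Definition fourier (R : realType) (f : R -> R) (x : R) : R[i] :=
  (\int[lebesgue_measure]_t (f t * cos (x * t))) -i*
  (\int[lebesgue_measure]_t (f t * sin (x * t))).

(* [N] is the number of vanishing moments. *)
Record is_wavelet (R : realType) (N : nat) (psi : R -> R) : Prop := IsWavelet {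
  wavelet_moments_ge2 : (2 <= N)%N;
  wavelet_L1 : lebesgue_measure.-integrable setT (EFin \o psi);
  wavelet_sqr : (\int[lebesgue_measure]_t (psi t ^+ 2)%:E = 1)%E;
  wavelet_moments : forall p : nat, (p < N)%N ->
    (\int[lebesgue_measure]_t (t ^+ p * psi t)%:E = 0)%E;
  wavelet_support : exists a b : R,
    closure [set t | psi t != 0] = `[a, b]%classic;
  wavelet_fourier : exists2 alpha : R, 1 < alpha &
    has_ubound (range (fun x : R =>
      Normc.normc (fourier psi x) * (1 + `|x|) `^ alpha)) }.

(* The wavelet transform at scale [s] (a power of 2) and location [k]. *)
Definition wavelet_transform (R : realType) (n : nat) (T : Type)
    (psi : R -> R) (B : R -> T -> 'cV[R]_n) (s : nat) (k : int) (w : T) :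
    'cV[R]_n :=
  \col_i ((Num.sqrt s%:R)^-1 * \int[lebesgue_measure]_t
    ((Num.sqrt s%:R)^-1 * psi (s%:R^-1 * t - k%:~R) * B t w i 0)).

(* [a nu] is the scaling factor for sample size [nu], and the scale is
   a(nu) 2^j. *)
Definition sample_wavelet_variance (R : realType) (n : nat) (T : Type)
    (psi : R -> R) (B : R -> T -> 'cV[R]_n) (a : nat -> nat) (j nu : nat)
    (w : T) : 'M[R]_n :=
  let s := (a nu * 2 ^ j)%N in
  let K := (nu %/ s)%N in
  K%:R^-1 *: \sum_(1 <= k < K.+1)
    (wavelet_transform psi B s k%:Z w *m (wavelet_transform psi B s k%:Z w)^T).

(* The range of [nu]: the number nu / (a(nu) 2^j) of available wavelet
   coefficients is a positive integer. *)
Definition sample_sizes (a : nat -> nat) (j : nat) : set nat :=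
  [set nu | (0 < nu)%N /\ (a nu * 2 ^ j %| nu)%N].

Definition varpi0 (R : realType) (n : nat) (H : 'M[R]_n) : R :=
  let rho := eig_real_parts H in
  let delta := inf [set x | exists q1 q2 : nat,
    (q1 < q2 < size rho)%N /\ x = rho`_q2 - rho`_q1] in
  if 0 < delta then Num.min rho`_0 delta else rho`_0.

(* For [0 < nu < 2 ^ j] no power of 2 is at most nu / 2^j, so conditions on
   a(nu) can only be imposed on the admissible sample sizes. *)
Record is_scaling_factor (R : realType) (n : nat) (H : 'M[R]_n) (j : nat)
    (a : nat -> nat) : Prop := IsScalingFactor {
  scaling_pow2 : forall nu, sample_sizes a j nu ->
    exists m : nat, a nu = (2 ^ m)%N;
  scaling_le : forall nu, sample_sizes a j nu ->
    (a nu)%:R <= nu%:R / (2 ^ j)%:R :> R;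
  scaling_rate :
    ((a nu)%:R / nu%:R + nu%:R / (a nu)%:R `^ (1 + 2 * varpi0 H))
      @[nu --> within (sample_sizes a j) \oo] --> (0 : R) }.

(* Convergence in probability of random vectors as nu -> oo within [S]. *)
Definition cvg_in_probability (d : measure_display) (T : measurableType d)
    (R : realType) (P : probability T R) (n : nat) (S : set nat)
    (X : nat -> T -> 'cV[R]_n) (x : 'cV[R]_n) : Prop :=
  forall e : R, 0 < e ->
    P [set w | e < enorm (X nu w - x)] @[nu --> within S \oo] --> 0%E.

(* Main.v *)
(* Write W for the sample wavelet variance at the scale s = a(nu) 2^j, over K = nu / s locations. In
   the eigenbasis of H, dividing the coordinate q by s^h_q gives a matrix V with
   W = P L V L P^T, L = diag(s^h_1, ..., s^h_n). The wavelet coefficients are centered Gaussian, and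
   their rescaled covariances form a stationary sequence gamma(k - l) which does not depend on s and
   is the Fourier transform of a density, the power spectrum of psi times the spectral weight of
   OFBM. This density is bounded by a multiple of 1 / (1 + y^2), because psi has two vanishing
   moments and a decaying Fourier transform. By the Riemann-Lebesgue lemma gamma tends to 0, so the
   variance 2 K^-2 sum gamma(k - l)^2 of the quadratic forms of V tends to 0, and V converges in
   probability to a deterministic matrix b. This matrix is positive definite, since Re(AA^* ) is and
   since the Fourier transform of psi is not identically 0.

   If V is close to b, the Courant-Fischer principle puts the q-th eigenvalue of P L V L P^T between
   two constant multiples of s^(2 h_q), and the eigenvector equation bounds the component r of P^T u,
   for u a unit eigenvector, by a multiple of s^(-|h_q - h_r|). Hence u tends to the column q of P up
   to its sign. The sign is fixed by projecting that column onto the eigenspace; the projector is a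
   polynomial in W whose coefficients are measurable functions of the eigenvalues. *)
Require Import Defs.
From HB Require Import structures.
From mathcomp Require Import all_boot all_order all_algebra.
From mathcomp Require Import all_classical all_reals all_analysis.
From mathcomp Require Import complex.
From mathcomp Require Import perm measurable_realfun ring lra.

Set Implicit Arguments.
Unset Strict Implicit.
Unset Printing Implicit Defensive.

Import Order.TTheory GRing.Theory Num.Theory numFieldNormedType.Exports.

Local Open Scope classical_set_scope.
Local Open Scope ring_scope.
Local Open Scope complex_scope.
Local Open Scope sesquilinear_scope.

(** * Integrable and square-integrable functions *)

(** [B] is known only through its finite-dimensional distributions, with the random measure on
    another probability space, while the wavelet coefficients are integrals of paths. So facts are
    first proved for simple Wiener integrals and then pass through mean-square limits, equality of
    finite-dimensional laws and Riemann sums. Rather than showing that Gaussian laws survive each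
    passage, the proof transports one inequality, [sqsum_conc]: Chebyshev's bound for a sum of
    squares in terms of covariances alone. A mean-square limit multiplies its constant by 4, hence 2
    for Gaussian families, 8 for Wiener integrals and 32 for path integrals. Probability ends there:
    the rescaled covariances do not involve the scale, so the number of locations required is
    uniform in [s], and outside one event of small probability the eigenvectors are estimated
    deterministically. *)

Section L1L2.
Context d (T : measurableType d) (R : realType) (mu : {measure set T -> \bar R}).
Implicit Types f g : T -> R.

Definition L1 f : Prop := mu.-integrable setT (EFin \o f).
Definition ip f g : R := \int[mu]_x (f x * g x).
Definition L2 f : Prop := measurable_fun setT f /\ L1 (fun x => f x ^+ 2).

Lemma L1_meas f : L1 f -> measurable_fun setT f.
Proof. by move=> /measurable_int /measurable_EFinP. Qed.

Lemma L1_le f g : measurable_fun setT f -> L1 g -> (forall x, `|f x| <= g x) -> L1 f.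
Proof.
move=> mf ig fg; apply: (le_integrable measurableT _ _ ig).
  exact/measurable_EFinP.
move=> x _ /=; rewrite lee_fin (le_trans (fg x))// ler_norm //.
Qed.

Lemma L1D f g : L1 f -> L1 g -> L1 (fun x => f x + g x).
Proof. by move=> mf mg; have := integrableD measurableT mf mg; apply: eq_integrable. Qed.

Lemma L1Z c f : L1 f -> L1 (fun x => c * f x).
Proof. by move=> mf; have := integrableZl measurableT c mf; apply: eq_integrable. Qed.

Lemma L1B f g : L1 f -> L1 g -> L1 (fun x => f x - g x).
Proof. by move=> mf mg; have := integrableB measurableT mf mg; apply: eq_integrable. Qed.

Lemma L1_0 : L1 (fun=> 0).
Proof. exact: integrable0. Qed.

Lemma L1_sum (I : Type) (s : seq I) (F : I -> T -> R) :
  (forall i, L1 (F i)) -> L1 (fun x => \sum_(i <- s) F i x).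
Proof.
move=> iF; elim: s => [|i s IH].
  rewrite (_ : (fun x => _) = fun=> 0); first exact: L1_0.
  by apply/funext => x; rewrite big_nil.
rewrite (_ : (fun x => _) = fun x => F i x + \sum_(i <- s) F i x); first exact: L1D.
by apply/funext => x; rewrite big_cons.
Qed.

Lemma L1_norm f : L1 f -> L1 (fun x => `|f x|).
Proof. by move=> /integrable_norm. Qed.

Lemma rintD f g : L1 f -> L1 g ->
  \int[mu]_x (f x + g x) = \int[mu]_x f x + \int[mu]_x g x.
Proof. by move=> *; rewrite RintegralD. Qed.

Lemma rintB f g : L1 f -> L1 g ->
  \int[mu]_x (f x - g x) = \int[mu]_x f x - \int[mu]_x g x.
Proof. by move=> *; rewrite RintegralB. Qed.

Lemma rintZ c f : L1 f -> \int[mu]_x (c * f x) = c * \int[mu]_x f x.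
Proof. by move=> *; rewrite RintegralZl. Qed.

Lemma rint0 : \int[mu]_x (0 : R) = 0.
Proof. by rewrite /Rintegral integral0. Qed.

Lemma rint_sum (I : Type) (s : seq I) (F : I -> T -> R) :
  (forall i, L1 (F i)) ->
  \int[mu]_x (\sum_(i <- s) F i x) = \sum_(i <- s) \int[mu]_x F i x.
Proof.
move=> iF; elim: s => [|i s IH].
  transitivity (\int[mu]_x (0 : R)); last by rewrite rint0 big_nil.
  by apply: eq_Rintegral => x _; rewrite big_nil.
rewrite big_cons -IH -rintD//; last exact: L1_sum.
by apply: eq_Rintegral => x _; rewrite big_cons.
Qed.

Lemma rint_le f g : L1 f -> L1 g -> (forall x, f x <= g x) ->
  \int[mu]_x f x <= \int[mu]_x g x.
Proof. by move=> *; apply: le_Rintegral. Qed.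

Lemma rint_norm f : L1 f -> `|\int[mu]_x f x| <= \int[mu]_x `|f x|.
Proof. by move=> *; apply: le_normr_Rintegral. Qed.

Lemma rint_EFin f : L1 f -> (\int[mu]_x (f x)%:E)%E = (\int[mu]_x f x)%:E.
Proof. by move=> f1; rewrite /Rintegral fineK//; exact: integrable_fin_num f1. Qed.

Lemma L2_mul f g : L2 f -> L2 g -> L1 (fun x => f x * g x).
Proof.
move=> [mf f2] [mg g2]; apply: (@L1_le _ (fun x => f x ^+ 2 + g x ^+ 2)).
- exact: measurable_funM.
- exact: L1D.
- move=> x; rewrite ler_norml; apply/andP; split; nra.
Qed.

Lemma L2D f g : L2 f -> L2 g -> L2 (fun x => f x + g x).
Proof.
move=> f2 g2; split; first by apply: measurable_funD; [case: f2|case: g2].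
suff -> : (fun x => (f x + g x) ^+ 2) =
  (fun x => f x ^+ 2 + g x ^+ 2 + 2 * (f x * g x)).
  apply: L1D; last exact: L1Z (L2_mul f2 g2).
  by apply: L1D; [case: f2|case: g2].
by apply/funext => x; ring.
Qed.

Lemma L2Z c f : L2 f -> L2 (fun x => c * f x).
Proof.
move=> [mf f2]; split; first exact: measurable_funM.
rewrite (_ : (fun x => _) = fun x => c ^+ 2 * f x ^+ 2); first exact: L1Z.
by apply/funext => x; rewrite exprMn.
Qed.

Lemma L2B f g : L2 f -> L2 g -> L2 (fun x => f x - g x).
Proof.
move=> f2 g2; have := L2D f2 (L2Z (-1) g2); congr (L2 _).
by apply/funext => x; rewrite mulN1r.
Qed.

Lemma L2_0 : L2 (fun=> 0).
Proof. by split => //; rewrite (_ : (fun x => _) = fun=> 0); [exact: L1_0|apply/funext => x; rewrite expr0n]. Qed.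

Lemma L2_sum (I : Type) (s : seq I) (F : I -> T -> R) :
  (forall i, L2 (F i)) -> L2 (fun x => \sum_(i <- s) F i x).
Proof.
move=> iF; elim: s => [|i s IH].
  rewrite (_ : (fun x => _) = fun=> 0); first exact: L2_0.
  by apply/funext => x; rewrite big_nil.
rewrite (_ : (fun x => _) = fun x => F i x + \sum_(i <- s) F i x); first exact: L2D.
by apply/funext => x; rewrite big_cons.
Qed.

Lemma L2_le f g : measurable_fun setT f -> L2 g -> (forall x, `|f x| <= `|g x|) -> L2 f.
Proof.
move=> mf [mg g2] fg; split => //; apply: L1_le g2 _; first exact: measurable_funX.
by move=> x; rewrite normrX -(real_normK (num_real (g x))) lerXn2r ?nnegrE.
Qed.

Lemma ipC f g : ip f g = ip g f.
Proof. by rewrite /ip; under eq_Rintegral do rewrite mulrC. Qed.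

Lemma ipDl f g k : L2 f -> L2 g -> L2 k -> ip (fun x => f x + g x) k = ip f k + ip g k.
Proof.
move=> f2 g2 k2; rewrite /ip; under eq_Rintegral do rewrite mulrDl.
by rewrite rintD//; exact: L2_mul.
Qed.

Lemma ipZl c f g : L2 f -> L2 g -> ip (fun x => c * f x) g = c * ip f g.
Proof.
move=> f2 g2; rewrite /ip; under eq_Rintegral do rewrite -mulrA.
by rewrite rintZ//; exact: L2_mul.
Qed.

Lemma ipDr f g k : L2 f -> L2 g -> L2 k -> ip k (fun x => f x + g x) = ip k f + ip k g.
Proof. by move=> *; rewrite ipC ipDl// ipC (ipC g). Qed.

Lemma ipZr c f g : L2 f -> L2 g -> ip g (fun x => c * f x) = c * ip g f.
Proof. by move=> *; rewrite ipC ipZl// ipC. Qed.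

Lemma ip_suml (I : Type) (s : seq I) (F : I -> T -> R) g :
  (forall i, L2 (F i)) -> L2 g ->
  ip (fun x => \sum_(i <- s) F i x) g = \sum_(i <- s) ip (F i) g.
Proof.
move=> F2 g2; rewrite /ip -rint_sum; last by move=> i; exact: L2_mul.
by apply: eq_Rintegral => x _; rewrite mulr_suml.
Qed.

Lemma ip_sumr (I : Type) (s : seq I) (F : I -> T -> R) g :
  (forall i, L2 (F i)) -> L2 g ->
  ip g (fun x => \sum_(i <- s) F i x) = \sum_(i <- s) ip g (F i).
Proof.
by move=> F2 g2; rewrite ipC ip_suml//; apply: eq_bigr => i _; rewrite ipC.
Qed.

Lemma ip_ge0 f : 0 <= ip f f.
Proof. by apply: Rintegral_ge0 => x _; rewrite -expr2 sqr_ge0. Qed.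

Lemma ip_sub f g : L2 f -> L2 g ->
  ip (fun x => f x - g x) (fun x => f x - g x) = ip f f - 2 * ip f g + ip g g.
Proof.
move=> f2 g2; have g2' := L2Z (-1) g2.
have -> : (fun x => f x - g x) = (fun x => f x + -1 * g x).
  by apply/funext => x; rewrite mulN1r.
rewrite ipDl ?ipDr ?ipZl ?ipZr//; last exact: L2D.
by rewrite (ipC g f); ring.
Qed.

Lemma ipDD f g k l : L2 f -> L2 g -> L2 k -> L2 l ->
  ip (fun x => f x + g x) (fun x => k x + l x) = ip f k + ip f l + (ip g k + ip g l).
Proof. by move=> f2 g2 k2 l2; rewrite ipDl ?(ipDr k2 l2)//; exact: L2D. Qed.

Lemma cauchy_schwarz f g : L2 f -> L2 g -> ip f g ^+ 2 <= ip f f * ip g g.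
Proof.
move=> f2 g2; have H t : 0 <= ip f f - 2 * t * ip f g + t ^+ 2 * ip g g.
  have := ip_ge0 (fun x => f x - t * g x).
  have g2' := L2Z t g2.
  by rewrite ip_sub// !ipZr// ipZl//; congr (_ <= _); ring.
have := ip_ge0 g; rewrite le_eqVlt => /orP[/eqP g0|g0].
  rewrite -g0 mulr0; have [->|fg0] := eqVneq (ip f g) 0; first by rewrite expr0n.
  (* With [ip g g = 0] the quadratic is affine in [t]; at this [t] it would equal -1. *)
  have := H ((ip f f + 1) / (2 * ip f g)).
  rewrite -g0 mulr0 addr0.
  have -> : 2 * ((ip f f + 1) / (2 * ip f g)) * ip f g = ip f f + 1 by field.
  lra.
have := H (ip f g / ip g g).
have -> : ip f f - 2 * (ip f g / ip g g) * ip f g + (ip f g / ip g g) ^+ 2 * ip g g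
   = (ip f f * ip g g - ip f g ^+ 2) / ip g g by field; rewrite gt_eqF.
by rewrite pmulr_lge0 ?invr_gt0// subr_ge0.
Qed.

Lemma cauchy_schwarz_sqrt f g : L2 f -> L2 g ->
  `|ip f g| <= Num.sqrt (ip f f) * Num.sqrt (ip g g).
Proof.
move=> f2 g2; rewrite -sqrtrM ?ip_ge0// -sqrtr_sqr ler_sqrt ?cauchy_schwarz//.
by rewrite mulr_ge0 ?ip_ge0.
Qed.

(** Mean-square convergence. [ip] is 0 when its integral diverges, so this is meaningful only for
    differences in [L2]; hence the [L2] hypotheses of the lemmas that use it. *)
Definition cvg2 (F : nat -> T -> R) f : Prop :=
  ip (fun x => F N x - f x) (fun x => F N x - f x) @[N --> \oo] --> (0 : R).

(** This carries covariances to mean-square limits. The difference of inner products expands into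
    one product of differences and two cross terms, each bounded by Cauchy-Schwarz. *)
Lemma cvg2_ip (F G : nat -> T -> R) f g :
  (forall N, L2 (F N)) -> (forall N, L2 (G N)) -> L2 f -> L2 g ->
  cvg2 F f -> cvg2 G g -> ip (F N) (G N) @[N --> \oo] --> ip f g.
Proof.
move=> F2 G2 f2 g2 Ff Gg.
pose sq (h : T -> R) := Num.sqrt (ip h h).
have sF : sq (fun x => F N x - f x) @[N --> \oo] --> (0 : R).
  by rewrite -[X in _ --> X](@sqrtr0 R); apply: (continuous_cvg _ (@sqrt_continuous R 0) Ff).
have sG : sq (fun x => G N x - g x) @[N --> \oo] --> (0 : R).
  by rewrite -[X in _ --> X](@sqrtr0 R); apply: (continuous_cvg _ (@sqrt_continuous R 0) Gg).
apply/subr_cvg0/norm_cvg0P.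
pose B N := sq (fun x => F N x - f x) * sq (fun x => G N x - g x) +
            sq (fun x => F N x - f x) * sq g + sq f * sq (fun x => G N x - g x).
have B0 : B N @[N --> \oo] --> (0 : R).
  rewrite (_ : (0 : R) = 0 * 0 + 0 * sq g + sq f * 0); last by ring.
  by apply: cvgD; [apply: cvgD|]; apply: cvgM => //; exact: cvg_cst.
apply: (squeeze_cvgr _ (cvg_cst 0) B0); near=> N; rewrite normr_ge0 /=.
have -> : ip (F N) (G N) - ip f g =
    ip (fun x => F N x - f x) (fun x => G N x - g x) +
    ip (fun x => F N x - f x) g + ip f (fun x => G N x - g x).
  have E1 : F N = (fun x => (F N x - f x) + f x) by apply/funext => x; ring.
  have E2 : G N = (fun x => (G N x - g x) + g x) by apply/funext => x; ring.
  have ? := L2B (F2 N) f2; have ? := L2B (G2 N) g2.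
  by rewrite {1}E1 {1}E2 ipDD//; ring.
apply: le_trans (ler_normD _ _) _; apply: lerD.
  apply: le_trans (ler_normD _ _) _; apply: lerD.
    by apply: cauchy_schwarz_sqrt; exact: L2B.
  by apply: cauchy_schwarz_sqrt => //; exact: L2B.
by apply: cauchy_schwarz_sqrt => //; exact: L2B.
Unshelve. all: by end_near. Qed.

Lemma cvg2_cst f : cvg2 (fun=> f) f.
Proof.
rewrite /cvg2 /ip; under eq_fun do under eq_Rintegral do rewrite subrr mulr0.
by rewrite rint0; exact: cvg_cst.
Qed.

Lemma cvg2Z (F : nat -> T -> R) f c : (forall N, L2 (F N)) -> L2 f ->
  cvg2 F f -> cvg2 (fun N x => c * F N x) (fun x => c * f x).
Proof.
move=> F2 f2 Ff; rewrite /cvg2.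
have E N : ip (fun x => c * F N x - c * f x) (fun x => c * F N x - c * f x) =
    c ^+ 2 * ip (fun x => F N x - f x) (fun x => F N x - f x).
  have ? := L2B (F2 N) f2.
  rewrite (_ : (fun x => c * F N x - c * f x) = (fun x => c * (F N x - f x))).
    by rewrite ipZl ?ipZr//; [ring | exact: L2Z].
  by apply/funext => x; rewrite mulrBr.
under eq_fun do rewrite E.
have : c ^+ 2 * ip (fun x => F N x - f x) (fun x => F N x - f x) @[N --> \oo] --> c ^+ 2 * 0.
  exact: cvgM (cvg_cst _) Ff.
by rewrite mulr0.
Qed.

Lemma cvg2D (F G : nat -> T -> R) f g :
  (forall N, L2 (F N)) -> (forall N, L2 (G N)) -> L2 f -> L2 g ->
  cvg2 F f -> cvg2 G g -> cvg2 (fun N x => F N x + G N x) (fun x => f x + g x).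
Proof.
move=> F2 G2 f2 g2 Ff Gg; rewrite /cvg2.
have FG2 : 2 * (ip (fun x => F N x - f x) (fun x => F N x - f x) +
    ip (fun x => G N x - g x) (fun x => G N x - g x)) @[N --> \oo] --> (2 * (0 + 0) : R).
  by apply: cvgM (cvg_cst _) _; exact: cvgD Ff Gg.
rewrite addr0 mulr0 in FG2.
apply: (squeeze_cvgr _ (cvg_cst 0) FG2); near=> N; rewrite ip_ge0 /=.
have ? := L2B (F2 N) f2; have ? := L2B (G2 N) g2.
have -> : (fun x => F N x + G N x - (f x + g x)) =
    (fun x => (F N x - f x) + (G N x - g x)) by apply/funext => x; ring.
set a := (fun x => F N x - f x); set b := (fun x => G N x - g x).
(* [(a - b)^2 >= 0] gives [(a + b)^2 <= 2 a^2 + 2 b^2]. *)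
have := ip_ge0 (fun x => a x - b x); rewrite ip_sub// => h.
have -> : ip (fun x => a x + b x) (fun x => a x + b x) = ip a a + 2 * ip a b + ip b b.
  by rewrite ipDD// (ipC b a); ring.
lra.
Unshelve. all: by end_near. Qed.

Lemma cvg2_sum (I : Type) (s : seq I) (F : I -> nat -> T -> R) (f : I -> T -> R) :
  (forall i N, L2 (F i N)) -> (forall i, L2 (f i)) ->
  (forall i, cvg2 (F i) (f i)) ->
  cvg2 (fun N x => \sum_(i <- s) F i N x) (fun x => \sum_(i <- s) f i x).
Proof.
move=> F2 f2 Ff; elim: s => [|i s IH].
  rewrite (_ : (fun N x => _) = fun _ _ => 0); last first.
    by apply/funext => N; apply/funext => x; rewrite big_nil.
  rewrite (_ : (fun x => _) = fun=> 0); first exact: cvg2_cst.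
  by apply/funext => x; rewrite big_nil.
rewrite (_ : (fun N x => _) = fun N x => F i N x + \sum_(i <- s) F i N x); last first.
  by apply/funext => N; apply/funext => x; rewrite big_cons.
rewrite (_ : (fun x => _) = fun x => f i x + \sum_(i <- s) f i x); last first.
  by apply/funext => x; rewrite big_cons.
by apply: cvg2D => // [N|]; exact: L2_sum.
Qed.

End L1L2.

(** * Gaussian moments *)

(** Convergence is only almost everywhere, because the limits below fail at isolated points: the
    singularity of a power at 0, or the endpoint of a half-line. *)
Lemma dct d (T : measurableType d) (R : realType) (mu : {measure set T -> \bar R})
    (F : nat -> T -> R) (f g : T -> R) :
  (forall n, measurable_fun setT (F n)) -> measurable_fun setT f ->
  {ae mu, forall x, F n x @[n --> \oo] --> f x} ->
  L1 mu g -> (forall n x, `|F n x| <= g x) ->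
  L1 mu f /\ \int[mu]_x F n x @[n --> \oo] --> \int[mu]_x f x.
Proof.
move=> mF mf Ff g1 Fg.
have F1 n : L1 mu (F n) by apply: L1_le g1 _.
have [] := @dominated_convergence _ _ _ mu setT measurableT
  (fun n => EFin \o F n) (EFin \o f) (EFin \o g).
- by move=> n; exact/measurable_EFinP.
- exact/measurable_EFinP.
- by apply: filterS Ff => x Fx _; apply: cvg_EFin => //; exact: nearW.
- exact: g1.
- by apply: nearW => x n _; rewrite /= lee_fin.
move=> f1 _ cv; split => //; apply: fine_cvg.
rewrite fineK; last exact: integrable_fin_num f1.
exact: cv.
Qed.

Lemma measurable_patch d (T : measurableType d) (R : realType) (f : T -> R) (D : set T) :
  measurable D -> measurable_fun setT f -> measurable_fun setT (f \_ D).
Proof. by move=> mD mf; apply: (measurable_restrictT _ mD).1; exact: measurable_funTS. Qed.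

Section gaussian_moments.
Variable R : realType.
Notation leb := (@lebesgue_measure R).

Lemma measurable_cont (f : R -> R) : continuous f -> measurable_fun setT f.
Proof. exact: continuous_measurable_fun. Qed.

(** The fundamental theorem of calculus on the intervals [[-n, n]], whose integrals tend to the full
    one by domination. It serves as integration by parts against the Gaussian weight. *)
Lemma int_deriv0 (h h' : R -> R) :
  (forall x, is_derive x (1 : R) h (h' x)) -> continuous h' -> L1 leb h' ->
  h n%:R - h (- n%:R) @[n --> \oo] --> 0 -> \int[leb]_x h' x = 0.
Proof.
move=> dh ch h1 h0.
pose D n := `[- n%:R, n%:R]%classic : set R.
have mh := measurable_cont ch.
have mD n : measurable (D n) by exact: measurable_itv.
have [_ cv] : L1 leb h' /\ \int[leb]_x (h' \_ (D n)) x @[n --> \oo] --> \int[leb]_x h' x.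
  apply: (@dct _ _ _ leb _ _ (fun x => `|h' x|)) => //.
  - by move=> n; exact: (measurable_patch (mD n) mh).
  - apply/nearW => x; apply: cvg_near_cst; near=> n.
    rewrite patchE mem_set// /D /= in_itv /=.
    have : `|x| <= n%:R by near: n; exact: nbhs_infty_ger.
    by rewrite ler_norml.
  - exact: L1_norm.
  - by move=> n x; rewrite patchE; case: ifP => // _; rewrite normr0.
apply: cvg_unique cv _ => //; apply: cvg_trans h0; apply: near_eq_cvg.
near=> n.
have n0 : (- n%:R < n%:R :> R).
  have : (0 < n)%N by near: n; exact: nbhs_infty_gt.
  by rewrite -(ltr_nat R) => ?; lra.
rewrite -Rintegral_mkcond /Rintegral (@continuous_FTC2 _ _ h) //.
- exact: continuous_subspaceT.
- have dh' x : derivable h x 1 by have [] := dh x.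
  have ch' x : h y @[y --> x] --> h x.
    exact/differentiable_continuous/derivable1_diffP/dh'.
  split => //; first exact: cvg_at_right_filter.
  exact: cvg_at_left_filter.
- by move=> x _; rewrite derive1E; apply: derive_val; exact: dh.
Unshelve. all: by end_near. Qed.

Section exp_sqr.
Variable c : R.
Hypothesis c0 : 0 < c.
Let g (b x : R) : R := expR (- (b * x ^+ 2)).

Let cont_g b : continuous (g b).
Proof.
move=> x; apply: continuous_comp; last exact: continuous_expR.
by apply: cvgN; apply: cvgM; [exact: cvg_cst|exact: exprn_continuous].
Qed.

Let L1_g b : 0 < b -> L1 leb (g b).
Proof.
move=> b0; pose s := Num.sqrt (2 * b)^-1.
have s0 : s != 0 by rewrite gt_eqF// sqrtr_gt0 invr_gt0 mulr_gt0.
have := L1Z (normal_peak s)^-1 (@integrable_normal_pdf R 0 s).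
congr (L1 _ _); apply/funext => x.
rewrite normal_pdfE// mulrA mulVf ?gt_eqF ?normal_peak_gt0// mul1r /normal_fun /g.
congr expR; rewrite subr0 mulNr; congr (- _).
rewrite sqr_sqrtr ?invr_ge0 ?mulr_ge0 ?(ltW b0)// -mulr_natr; field.
by rewrite gt_eqF.
Qed.

Let pow4_le x : x ^+ 4 * g c x <= 8 / c ^+ 2 * g (c / 2) x.
Proof.
have -> : g c x = g (c / 2) x * g (c / 2) x by rewrite /g -expRD; congr expR; field.
rewrite mulrA ler_pM2r ?expR_gt0//.
have y0 : 0 <= c / 2 * x ^+ 2 by rewrite mulr_ge0 ?sqr_ge0// divr_ge0// ltW.
(* With [y = c x^2 / 2], the bound [y^2 / 2 <= exp y] gives [x^4 <= 8 / c^2 * exp y]; half of the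
   Gaussian exponent is spent on it. *)
have h := expR_ge1Dxn 1 y0.
rewrite /g expRN ler_pdivrMr ?expR_gt0//; apply: le_trans (_ : 8 / c ^+ 2 * ((c / 2 * x ^+ 2) ^+ 2 / 2) <= _).
  by rewrite le_eqVlt; apply/orP; left; apply/eqP; field; rewrite gt_eqF.
rewrite ler_pM2l ?divr_gt0 ?exprn_gt0//.
by apply: le_trans h; rewrite lerDr.
Qed.

Let L1_pow4 : L1 leb (fun x => x ^+ 4 * g c x).
Proof.
apply: (@L1_le _ _ _ leb _ (fun x => 8 / c ^+ 2 * g (c / 2) x)).
- by apply: measurable_funM; [exact: measurable_funX|exact: measurable_cont].
- by apply: L1Z; apply: L1_g; rewrite divr_gt0.
- move=> x; rewrite ger0_norm ?pow4_le// mulr_ge0 ?expR_ge0//.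
  by rewrite (_ : 4%N = (2 * 2)%N)// exprM sqr_ge0.
Qed.

Let L1_pow2 : L1 leb (fun x => x ^+ 2 * g c x).
Proof.
apply: (@L1_le _ _ _ leb _ (fun x => g c x + x ^+ 4 * g c x)).
- by apply: measurable_funM; [exact: measurable_funX|exact: measurable_cont].
- by apply: L1D => //; exact: L1_g.
- move=> x; rewrite ger0_norm; last by rewrite mulr_ge0 ?expR_ge0 ?sqr_ge0.
  rewrite -{2}(mul1r (g c x)) -mulrDl ler_pM2r ?expR_gt0//.
  by nra.
Qed.

Let boundary (k : nat) : (0 < k <= 3)%N -> odd k ->
  n%:R ^+ k * g c n%:R - (- n%:R) ^+ k * g c (- n%:R) @[n --> \oo] --> 0.
Proof.
move=> /andP[k0 k3] ok.
have E n : n%:R ^+ k * g c n%:R - (- n%:R) ^+ k * g c (- n%:R) = 2 * (n%:R ^+ k * g c n%:R).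
  by rewrite exprNn -signr_odd ok expr1 /g sqrrN; ring.
rewrite (_ : (fun n => _) = fun n => 2 * (n%:R ^+ k * g c n%:R)); last first.
  by apply/funext => n; rewrite E.
have h0 : (16 / c ^+ 2 * (n.+1%:R)^-1 : R) @[n --> \oo] --> (16 / c ^+ 2 * 0 : R).
  by apply: cvgM; [exact: cvg_cst|exact: cvg_harmonic].
rewrite -(cvg_shiftS (fun n : nat => 2 * (n%:R ^+ k * g c n%:R))); rewrite mulr0 in h0.
apply: (squeeze_cvgr _ (cvg_cst 0) h0); apply: nearW => n.
rewrite !mulr_ge0 ?exprn_ge0 ?expR_ge0//=.
set m : R := n.+1%:R; have m1 : 1 <= m by rewrite ler1n.
have h4 := pow4_le m.
have g1 : g (c / 2) m <= 1.
  by rewrite /g -expR0 ler_expR oppr_le0 mulr_ge0 ?sqr_ge0// divr_ge0// ltW.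
have mk : m ^+ k <= m ^+ 4 / m.
  rewrite ler_pdivlMr ?(lt_le_trans _ m1)// -exprSr.
  exact: ler_weXn2l.
rewrite (_ : 16 / c ^+ 2 / m = 2 * ((8 / c ^+ 2) / m)); last by ring.
rewrite ler_pM2l// ler_pdivlMr ?(lt_le_trans _ m1)//.
apply: le_trans (_ : m ^+ 4 * g c m <= _).
  rewrite mulrAC ler_pM2r ?expR_gt0//.
  by rewrite -ler_pdivlMr// (lt_le_trans _ m1).
apply: (le_trans h4); rewrite ler_piMr// divr_ge0// exprn_ge0// ltW//.
Qed.

(** The derivative of [x^(k+1) exp(-c x^2)] is [((k+1) x^k - 2 c x^(k+2)) exp(-c x^2)] and
    integrates to 0. The cases [k = 0] and [k = 2] are the two recursions; the total mass stays a
    parameter, to be supplied by the normalization of the density. *)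
Lemma exp_sqr_moments : [/\ L1 leb (fun x => x ^+ 2 * g c x),
  L1 leb (fun x => x ^+ 4 * g c x),
  \int[leb]_x (x ^+ 2 * g c x) = (2 * c)^-1 * \int[leb]_x g c x &
  \int[leb]_x (x ^+ 4 * g c x) = 3 * (2 * c)^-1 * \int[leb]_x (x ^+ 2 * g c x)].
Proof.
have dg (k : nat) (x : R) : is_derive x (1 : R) (fun x => x ^+ k.+1 * g c x)
    (k.+1%:R * (x ^+ k * g c x) - 2 * c * (x ^+ k.+2 * g c x)).
  have d1 : is_derive x (1 : R) (fun x : R => x ^+ k.+1) (k.+1%:R * x ^+ k).
    have := is_deriveX k.+1 (is_derive_id x (1 : R)).
    rewrite (_ : id ^+ k.+1 = fun x : R => x ^+ k.+1) /GRing.scale /= ?mulr1//.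
    by apply/funext => y; rewrite exprfctE.
  have d2 : is_derive x (1 : R) (fun x : R => - (c * x ^+ 2)) (- (2 * c * x)).
    have := is_deriveN (is_deriveZ c (is_deriveX 2 (is_derive_id x (1 : R)))).
    rewrite (_ : - (c *: id ^+ 2) = fun x : R => - (c * x ^+ 2)).
      by move/is_derive_eq; apply; rewrite /GRing.scale /=; ring.
    by apply/funext => y; rewrite /GRing.opp /GRing.scale /= exprfctE.
  have d3 := is_derive1_comp (is_derive_expR _) d2.
  have := is_deriveM d1 d3; move/is_derive_eq; apply; rewrite /GRing.scale /= /g.
  by rewrite !exprS; ring.
have cg (k : nat) : continuous (fun x : R => x ^+ k * g c x).
  by move=> x; apply: cvgM; [exact: exprn_continuous|exact: cont_g].
have i2 : 0 = \int[leb]_x g c x - 2 * c * \int[leb]_x (x ^+ 2 * g c x).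
  rewrite -rintZ// -rintB; [|exact: L1_g|exact: L1Z].
  symmetry; apply: (@int_deriv0 (fun x => x ^+ 1 * g c x)).
  - by move=> x; have := dg 0 x; rewrite expr0 !mul1r.
  - move=> x; apply: cvgB; first exact: cont_g.
    by apply: cvgM; [exact: cvg_cst|exact: cg].
  - by apply: L1B; [exact: L1_g|exact: L1Z].
  - exact: boundary.
have i4 : 0 = 3 * \int[leb]_x (x ^+ 2 * g c x) - 2 * c * \int[leb]_x (x ^+ 4 * g c x).
  rewrite -!rintZ// -rintB; [|exact: L1Z|exact: L1Z].
  symmetry; apply: (@int_deriv0 (fun x => x ^+ 3 * g c x)).
  - by move=> x; apply: cvgB; apply: cvgM; (exact: cvg_cst || exact: cg).
  - by apply: L1B; exact: L1Z.
  - exact: boundary.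
have c2 : 2 * c != 0 by rewrite gt_eqF// mulr_gt0.
split => //; apply: (mulfI c2).
  by rewrite mulrA mulfV// mul1r; lra.
rewrite (_ : 2 * c * (3 / _ * _) = 3 * \int[leb]_x (x ^+ 2 * g c x)); first lra.
by field; rewrite gt_eqF.
Qed.

End exp_sqr.

(** The Radon-Nikodym derivative of the normal law and the normal density have the same integral
    over every measurable set, hence agree almost everywhere. *)
Lemma integral_normal_prob (s : R) (f : R -> R) : measurable_fun setT f ->
  (forall x, 0 <= f x) ->
  (\int[normal_prob 0 s]_x (f x)%:E = \int[leb]_x (f x * normal_pdf 0 s x)%:E)%E.
Proof.
move=> mf f0; have dom := @normal_prob_dominates R 0 s.
rewrite -(Radon_Nikodym_SigmaFinite.change_of_variables dom) //; last exact/measurable_EFinP.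
under [RHS]eq_integral do rewrite EFinM.
have iRN := Radon_Nikodym_SigmaFinite.f_integrable dom.
apply: ae_eq_integral => //.
- apply: emeasurable_funM; first exact/measurable_EFinP.
  exact: measurable_int iRN.
- apply: emeasurable_funM; apply/measurable_EFinP => //.
  exact: measurable_normal_pdf.
- apply: ae_eqe_mul2l; apply: integral_ae_eq => //.
    by apply/measurable_EFinP; exact: measurable_normal_pdf.
  by move=> E _ mE; rewrite -Radon_Nikodym_SigmaFinite.f_integral.
Qed.

Lemma normal_moments (s : R) : s != 0 ->
  (\int[normal_prob 0 s]_x (x ^+ 2)%:E = (s ^+ 2)%:E)%E /\
  (\int[normal_prob 0 s]_x (x ^+ 4)%:E = (3 * s ^+ 4)%:E)%E.
Proof.
(* With this [c], [(2 * c)^-1] is [s ^+ 2], and the recursions give [s^2] and [3 s^4]. *)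
move=> s0; pose c := (2 * s ^+ 2)^-1.
have c0 : 0 < c by rewrite invr_gt0 mulr_gt0// exprn_even_gt0.
have [j2 j4 i2 i4] := exp_sqr_moments c0.
set p := normal_peak s.
have pdfE x : normal_pdf 0 s x = p * expR (- (c * x ^+ 2)).
  rewrite normal_pdfE// /normal_fun subr0; congr (_ * expR _).
  by rewrite /c -mulr_natr; field.
have i0 : p * \int[leb]_x expR (- (c * x ^+ 2)) = 1.
  have -> : p * \int[leb]_x expR (- (c * x ^+ 2)) = \int[leb]_x (normal_pdf 0 s x).
    under [RHS]eq_Rintegral do rewrite pdfE.
    rewrite rintZ//; have := L1Z p^-1 (@integrable_normal_pdf R 0 s); congr (L1 _ _).
    by apply/funext => x; rewrite pdfE mulrA mulVf ?mul1r// gt_eqF// normal_peak_gt0.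
  by rewrite /Rintegral integral_normal_pdf.
have mX (k : nat) : measurable_fun setT (fun x : R => x ^+ k) by exact: measurable_funX.
have E (k : nat) : (forall x : R, 0 <= x ^+ k) -> L1 leb (fun x => x ^+ k * expR (- (c * x ^+ 2))) ->
    (\int[normal_prob 0 s]_x (x ^+ k)%:E)%E =
    (p * \int[leb]_x (x ^+ k * expR (- (c * x ^+ 2))))%:E.
  move=> xk L; rewrite integral_normal_prob// -rintZ// -rint_EFin; last exact: L1Z.
  by apply: eq_integral => x _; rewrite pdfE; congr EFin; ring.
have e4 (x : R) : 0 <= x ^+ 4 by rewrite (_ : 4%N = (2 * 2)%N)// exprM sqr_ge0.
split; rewrite E//.
- rewrite i2 mulrCA i0 mulr1 /c; congr EFin; field; lra.
- by move=> x; exact: sqr_ge0.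
- rewrite i4 i2; congr EFin.
  rewrite (_ : p * _ = 3 * (2 * c)^-1 ^+ 2 * (p * \int[leb]_x expR (- (c * x ^+ 2)))); last by field; lra.
  by rewrite i0 mulr1 /c; field.
Qed.

End gaussian_moments.

(** * Concentration of sums of squares *)

Lemma cvg_bigsum (T : Type) (F : set_system T) (FF : Filter F) (R : realType)
    (I : Type) (s : seq I) (u : I -> T -> R) (l : I -> R) :
  (forall i, u i x @[x --> F] --> l i) ->
  \sum_(i <- s) u i x @[x --> F] --> \sum_(i <- s) l i.
Proof.
move=> ul; elim: s => [|i s IH].
  rewrite big_nil (_ : (fun x => _) = fun=> 0); first exact: cvg_cst.
  by apply/funext => x; rewrite big_nil.
rewrite big_cons (_ : (fun x => _) = fun x => u i x + \sum_(i <- s) u i x).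
  exact: cvgD.
by apply/funext => x; rewrite big_cons.
Qed.

Lemma measurable_gt d (T : measurableType d) (R : realType) (f : T -> R) (e : R) :
  measurable_fun setT f -> measurable [set w | e < f w].
Proof.
move=> mf; have := mf measurableT _ (measurable_itv `]e, +oo[); rewrite setTI.
by congr (measurable _); apply/seteqP; split => w; rewrite /= in_itv /= andbT.
Qed.

(** Only the values of the image measure on measurable sets enter, so one statement serves Gaussian
    laws, equality of finite-dimensional distributions and changes of variable for Lebesgue
    measure. *)
Lemma ge0_integral_law d (T : measurableType d) d' (T' : measurableType d') (R : realType)
    (m : {measure set T -> \bar R}) (m' : {measure set T' -> \bar R}) (X : T -> T') (f : T' -> \bar R) :
  measurable_fun setT X -> (forall E, measurable E -> m (X @^-1` E) = m' E) ->
  measurable_fun setT f -> (forall x, 0 <= f x)%E ->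
  (\int[m]_w f (X w) = \int[m']_x f x)%E.
Proof.
move=> mX law mf f0.
pose Y : {mfun T >-> T'} := HB.pack X (isMeasurableFun.Build _ _ _ _ X mX).
transitivity (\int[pushforward m Y]_x f x)%E; last first.
  by apply: eq_measure_integral => A mA _; exact: law.
by rewrite ge0_integral_pushforward.
Qed.

Section centered_gaussian.
Context d (T : measurableType d) (R : realType) (P : probability T R).

Lemma centered_gaussian_moments (X : T -> R) : centered_gaussian P X ->
  [/\ L2 P X, L1 P (fun w => X w ^+ 4) &
      \int[P]_w (X w ^+ 4) = 3 * ip P X X ^+ 2].
Proof.
move=> [mX [s]]; have [_ X0|s0 lawX] := eqVneq s 0.
  (* Degenerate case: [X] vanishes almost surely, and so do its positive powers. *)
  have z (k : nat) : (0 < k)%N -> L1 P (fun w => X w ^+ k) /\ \int[P]_w (X w ^+ k) = 0.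
    move=> k0.
    have e : (\int[P]_w `|(X w ^+ k)%:E|)%E = 0%E.
      transitivity (\int[P]_w (cst 0%E w : \bar R))%E; last by rewrite integral0.
      apply: ae_eq_integral => //.
        by apply/measurableT_comp => //; apply/measurable_EFinP; exact: measurable_funX.
      by apply: filterS X0 => w -> _; rewrite expr0n gtn_eqF//= normr0.
    have i : L1 P (fun w => X w ^+ k).
      apply/integrableP; split; first by apply/measurable_EFinP; exact: measurable_funX.
      by rewrite e.
    split => //; apply/normr0_eq0/le_anti; rewrite normr_ge0 andbT.
    by apply: le_trans (rint_norm i) _; rewrite /Rintegral e.
  have [i2 z2] := z 2%N isT; have [i4 z4] := z 4%N isT.
  by split => //; rewrite z4 /ip; under eq_Rintegral do rewrite -expr2; rewrite z2 expr0n mulr0.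
have tr (f : R -> R) (v : R) : measurable_fun setT f -> (forall x, 0 <= f x) ->
    (\int[normal_prob 0 s]_x (f x)%:E = v%:E)%E ->
    L1 P (fun w => f (X w)) /\ \int[P]_w f (X w) = v.
  move=> mf f0 fv.
  have e : (\int[P]_w (f (X w))%:E = v%:E)%E.
    rewrite -fv; apply: (@ge0_integral_law _ T _ _ R P (normal_prob 0 s) X (EFin \o f) mX lawX) => //.
    exact/measurable_EFinP.
  have m : measurable_fun setT (fun w => f (X w)) by exact: measurableT_comp.
  split; last by rewrite /Rintegral e.
  apply/integrableP; split; first exact/measurable_EFinP.
  under eq_integral do rewrite /= ger0_norm//.
  by rewrite e ltry.
have [m2 m4] := normal_moments s0.
have e4 (x : R) : 0 <= x ^+ 4 by rewrite (_ : 4%N = (2 * 2)%N)// exprM sqr_ge0.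
have [i2 v2] := tr (fun x => x ^+ 2) _ (measurable_funX _ (@measurable_id _ _ _)) (fun x => sqr_ge0 x) m2.
have [i4 v4] := tr (fun x => x ^+ 4) _ (measurable_funX _ (@measurable_id _ _ _)) e4 m4.
split => //; rewrite v4 /ip; under eq_Rintegral do rewrite -expr2.
by rewrite v2; ring.
Qed.

Lemma markov_sqr (Z : T -> R) (e : R) : 0 < e -> L2 P Z ->
  (P [set w | (e < `|Z w|)%R] <= (ip P Z Z / e ^+ 2)%:E)%E.
Proof.
move=> e0 [mZ Z2]; set A := [set w | _].
have mA : measurable A.
  by apply: measurable_gt; exact: measurableT_comp.
rewrite -[leLHS]fineK; last exact: fin_num_measure.
rewrite lee_fin ler_pdivlMr ?exprn_gt0// mulrC.
have iA : L1 P \1_A by exact: integrable_indic.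
have -> : fine (P A) = \int[P]_w \1_A w.
  by rewrite /Rintegral integral_indic// setIT.
rewrite -rintZ//; apply: rint_le.
- exact: L1Z.
- by move: Z2; congr (L1 _ _); apply/funext => w; rewrite expr2.
- move=> w; rewrite indicE; have [|_] := boolP (w \in A); last first.
    by rewrite mulr0 -expr2 sqr_ge0.
  rewrite inE /A /= mulr1 -expr2 -(real_normK (num_real (Z w))) => /ltW h.
  by rewrite lerXn2r ?nnegrE// ltW.
Qed.

Variable I : finType.

(** Joint Gaussianity encoded through linear combinations, the form in which the random measure
    provides it. *)
Definition gauss_family (X : I -> T -> R) : Prop :=
  forall a : I -> R, centered_gaussian P (fun w => \sum_i a i * X i w).

Lemma gauss_family_L2 X : gauss_family X -> forall i, L2 P (X i).
Proof.
move=> gX i; have [+ _ _] := centered_gaussian_moments (gX (fun k => (k == i)%:R)).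
congr (L2 _ _); apply/funext => w; rewrite (bigD1 i)//= eqxx mul1r big1 ?addr0//.
by move=> k /negbTE ->; rewrite mul0r.
Qed.

Lemma gauss_family_pair X : gauss_family X -> forall i j (a b : R),
  centered_gaussian P (fun w => a * X i w + b * X j w).
Proof.
move=> gX i j a b; have := gX (fun k => a * (k == i)%:R + b * (k == j)%:R).
congr (centered_gaussian _ _); apply/funext => w.
under eq_bigr do rewrite mulrDl -!mulrA.
rewrite big_split/= -!mulr_sumr; congr (_ * _ + _ * _).
- rewrite (bigD1 i)//= eqxx mul1r big1 ?addr0// => k /negbTE ->.
  by rewrite mul0r.
- rewrite (bigD1 j)//= eqxx mul1r big1 ?addr0// => k /negbTE ->.
  by rewrite mul0r.
Qed.

(* Isserlis' formula, obtained from the fourth moments of [X i + X j] and [X i - X j]. *)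
Lemma gauss_family_isserlis X : gauss_family X -> forall i j,
  L1 P (fun w => X i w ^+ 2 * X j w ^+ 2) /\
  \int[P]_w (X i w ^+ 2 * X j w ^+ 2) =
    ip P (X i) (X i) * ip P (X j) (X j) + 2 * ip P (X i) (X j) ^+ 2.
Proof.
move=> gX i j.
have Xi2 := gauss_family_L2 gX i; have Xj2 := gauss_family_L2 gX j.
have M a b : [/\ L2 P (fun w => a * X i w + b * X j w),
    L1 P (fun w => (a * X i w + b * X j w) ^+ 4) &
    \int[P]_w ((a * X i w + b * X j w) ^+ 4) =
    3 * (a ^+ 2 * ip P (X i) (X i) + 2 * a * b * ip P (X i) (X j) + b ^+ 2 * ip P (X j) (X j)) ^+ 2].
  have [h1 h2 h3] := centered_gaussian_moments (gauss_family_pair gX i j a b).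
  split => //; rewrite h3; congr (_ * _ ^+ 2).
  have ? := L2Z a Xi2; have ? := L2Z b Xj2.
  by rewrite ipDD// !(ipZl, ipZr)// (ipC _ (X j) (X i)); ring.
have [_ p1 e1] := M 1 1; have [_ p2 e2] := M 1 (-1).
have [_ p3 e3] := M 1 0; have [_ p4 e4] := M 0 1.
have E w : X i w ^+ 2 * X j w ^+ 2 = 12^-1 * ((1 * X i w + 1 * X j w) ^+ 4 +
  (1 * X i w + -1 * X j w) ^+ 4 - (2 * (1 * X i w + 0 * X j w) ^+ 4 + 2 * (0 * X i w + 1 * X j w) ^+ 4)).
  by field.
have EE : (fun w => X i w ^+ 2 * X j w ^+ 2) = _ := funext E.
have q1 := L1D p1 p2; have q2 := L1D (L1Z 2 p3) (L1Z 2 p4).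
have q3 := L1B q1 q2.
split; first by rewrite EE; exact: L1Z.
under eq_Rintegral do rewrite E.
rewrite rintZ// rintB// rintD// rintD; [|exact: L1Z|exact: L1Z].
by rewrite !rintZ// e1 e2 e3 e4; field.
Qed.

(** For a centered Gaussian family the variance of [\sum_i X i ^+ 2] is
    [2 * \sum_i \sum_j ip P (X i) (X j) ^+ 2], so [C = 2] is Chebyshev's inequality. *)
Definition sqsum_conc (C : R) (X : I -> T -> R) : Prop := forall e : R, 0 < e ->
  (P [set w | (e < `|\sum_i X i w ^+ 2 - \sum_i ip P (X i) (X i)|)%R] <=
   (C * (\sum_i \sum_j ip P (X i) (X j) ^+ 2) / e ^+ 2)%:E)%E.

Lemma gauss_sqsum_conc X : gauss_family X -> sqsum_conc 2 X.
Proof.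
move=> gX e e0.
have X2 := gauss_family_L2 gX.
pose m := \sum_i ip P (X i) (X i).
have iX i : L1 P (fun w => X i w ^+ 2) by case: (X2 i).
have is_ : L1 P (fun w => \sum_i X i w ^+ 2) by exact: L1_sum.
have iss : L1 P (fun w => \sum_i \sum_j X i w ^+ 2 * X j w ^+ 2).
  by do 2 (apply: L1_sum => ?); exact: (gauss_family_isserlis gX _ _).1.
have ic c : L1 P (fun=> c) by exact: finite_measure_integrable_cst.
have E w : (\sum_i X i w ^+ 2 - m) ^+ 2 =
  \sum_i \sum_j X i w ^+ 2 * X j w ^+ 2 - (2 * m * \sum_i X i w ^+ 2 - m ^+ 2).
  have -> : \sum_i \sum_j X i w ^+ 2 * X j w ^+ 2 = (\sum_i X i w ^+ 2) ^+ 2.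
    by rewrite expr2 mulr_suml; apply: eq_bigr => i _; rewrite mulr_sumr.
  by ring.
have i1 := L1B (L1Z (2 * m) is_) (ic (m ^+ 2)).
have Z2 : L2 P (fun w => \sum_i X i w ^+ 2 - m).
  split; first by apply: measurable_funB => //; exact: L1_meas is_.
  by rewrite (funext E); exact: L1B.
apply: (le_trans (markov_sqr e0 Z2)); rewrite lee_fin.
rewrite ler_pM2r ?invr_gt0 ?exprn_gt0//.
rewrite /ip; under eq_Rintegral do rewrite -expr2 E.
have c1 c : \int[P]_w c = c :> R.
  transitivity (fine (c%:E * 1)); last by rewrite mule1.
  by rewrite /Rintegral integral_cst//; congr (fine (_ * _)); exact: probability_setT.
have im i : \int[P]_w (X i w ^+ 2) = ip P (X i) (X i).
  by rewrite /ip; under [RHS]eq_Rintegral do rewrite -expr2.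
rewrite rintB// rintB//; last exact: L1Z.
rewrite rintZ// c1 rint_sum//; last first.
  by move=> i; apply: L1_sum => j; exact: (gauss_family_isserlis gX _ _).1.
rewrite (rint_sum _ iX) (eq_bigr _ (fun i _ => im i)) -/m.
(* Summed over [i] and [j], Isserlis' formula gives [m ^+ 2] plus twice the squared covariances;
   centering cancels [m ^+ 2]. *)
rewrite (eq_bigr (fun i => ip P (X i) (X i) * m + 2 * \sum_j ip P (X i) (X j) ^+ 2)); last first.
  move=> i _; rewrite rint_sum; last by move=> j; exact: (gauss_family_isserlis gX _ _).1.
  rewrite (eq_bigr _ (fun j _ => (gauss_family_isserlis gX i j).2)) big_split /=.
  by rewrite -!mulr_sumr.
rewrite big_split /= -mulr_suml -/m -mulr_sumr.
by rewrite le_eqVlt; apply/orP; left; apply/eqP; ring.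
Qed.

Lemma markov_norm (Z : T -> R) (e : R) : 0 < e -> L1 P Z ->
  (P [set w | (e < `|Z w|)%R] <= (e^-1 * \int[P]_w `|Z w|)%:E)%E.
Proof.
move=> e0 Z1; set A := [set w | _].
have mA : measurable A by apply: measurable_gt; apply: measurableT_comp => //; exact: L1_meas Z1.
rewrite -[leLHS]fineK; last exact: fin_num_measure.
rewrite lee_fin ler_pdivlMl//.
have iA : L1 P \1_A by exact: integrable_indic.
have -> : fine (P A) = \int[P]_w \1_A w by rewrite /Rintegral integral_indic// setIT.
rewrite -rintZ//; apply: rint_le; [exact: L1Z|exact: L1_norm|move=> w].
rewrite indicE; have [|_] := boolP (w \in A); last by rewrite mulr0.
by rewrite inE /A /= mulr1 => /ltW.
Qed.

(** From [f^2 - g^2 = (f - g)^2 + 2 g (f - g)] and Cauchy-Schwarz: mean-square convergence makes the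
    squares converge in [L1]. *)
Lemma sqr_diff_L1 (f g : T -> R) : L2 P f -> L2 P g ->
  L1 P (fun w => f w ^+ 2 - g w ^+ 2) /\
  \int[P]_w `|f w ^+ 2 - g w ^+ 2| <=
    ip P (fun w => f w - g w) (fun w => f w - g w) +
    2 * (Num.sqrt (ip P g g) * Num.sqrt (ip P (fun w => f w - g w) (fun w => f w - g w))).
Proof.
move=> f2 g2; have h2 := L2B f2 g2.
have L2n u : L2 P u -> L2 P (fun w => `|u w|).
  move=> u2; apply: L2_le (u2) _; first by apply: measurableT_comp => //; case: u2.
  by move=> w; rewrite normr_id.
have ipn u : ip P (fun w => `|u w|) (fun w => `|u w|) = ip P u u.
  by apply: eq_Rintegral => w _; rewrite -normrM ger0_norm// -expr2 sqr_ge0.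
have i1 : L1 P (fun w => f w ^+ 2 - g w ^+ 2) by apply: L1B; [case: f2|case: g2].
split => //.
have L := L2_mul (L2n _ g2) (L2n _ h2); have L' := L2_mul h2 h2.
apply: le_trans (_ : \int[P]_w ((f w - g w) * (f w - g w) + 2 * (`|g w| * `|f w - g w|)) <= _).
  apply: rint_le; [exact: L1_norm|by apply: L1D => //; exact: L1Z|move=> w].
  rewrite (_ : f w ^+ 2 - g w ^+ 2 = (f w - g w) ^+ 2 + 2 * (g w * (f w - g w))); last by ring.
  apply: le_trans (ler_normD _ _) _; rewrite normrX real_normK ?num_real// -expr2.
  by rewrite !normrM (ger0_norm (_ : 0 <= 2)).
rewrite rintD//; last exact: L1Z.
rewrite rintZ//; apply: lerD => //; rewrite ler_pM2l//.
apply: le_trans (ler_norm _) _.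
by apply: le_trans (cauchy_schwarz_sqrt (L2n _ g2) (L2n _ h2)) _; rewrite !ipn.
Qed.

(** A deviation of [X] beyond [e] forces a deviation beyond [e / 2] either of the approximation or
    of the difference of the two centered sums. The first has the assumed bound, where [(e / 2)^2]
    produces the factor 4; the second vanishes in the limit by Markov's inequality in [L1]. *)
Lemma sqsum_conc_lim (C : R) (F : nat -> I -> T -> R) (X : I -> T -> R) :
  (forall N i, L2 P (F N i)) -> (forall i, L2 P (X i)) ->
  (forall i, cvg2 P (fun N => F N i) (X i)) ->
  (forall N, sqsum_conc C (F N)) -> sqsum_conc (4 * C) X.
Proof.
move=> F2 X2 FX cF e e0.
pose Q (Y : I -> T -> R) w := \sum_i Y i w ^+ 2.
pose m (Y : I -> T -> R) := \sum_i ip P (Y i) (Y i).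
pose S (Y : I -> T -> R) := \sum_i \sum_j ip P (Y i) (Y j) ^+ 2.
have e2 : 0 < e / 2 by rewrite divr_gt0.
pose D N w := Q (F N) w - Q X w - (m (F N) - m X).
pose a N i := ip P (fun w => F N i w - X i w) (fun w => F N i w - X i w).
pose b N := \sum_i (a N i + 2 * (Num.sqrt (ip P (X i) (X i)) * Num.sqrt (a N i))) + `|m (F N) - m X|.
have LD N : L1 P (D N) /\ \int[P]_w `|D N w| <= b N.
  have c1 c : L1 P (fun=> c) by exact: finite_measure_integrable_cst.
  have cE (c : R) : \int[P]_w c = c :> R.
    transitivity (fine (c%:E * 1)); last by rewrite mule1.
    by rewrite /Rintegral integral_cst//; congr (fine (_ * _)); exact: probability_setT.
  have sd i := sqr_diff_L1 (F2 N i) (X2 i).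
  have DE w : D N w = \sum_i (F N i w ^+ 2 - X i w ^+ 2) - (m (F N) - m X).
    by rewrite /D /Q sumrB.
  have s1 : L1 P (fun w => \sum_i (F N i w ^+ 2 - X i w ^+ 2)) by apply: L1_sum => i; case: (sd i).
  have n1 : L1 P (fun w => \sum_i `|F N i w ^+ 2 - X i w ^+ 2|).
    by apply: L1_sum => i; apply: L1_norm; case: (sd i).
  have LDN : L1 P (D N) by rewrite (funext DE); exact: L1B.
  split => //.
  apply: le_trans (_ : \int[P]_w (\sum_i `|F N i w ^+ 2 - X i w ^+ 2| + `|m (F N) - m X|) <= _).
    apply: rint_le; [exact: L1_norm|exact: L1D|move=> w].
    rewrite DE; apply: le_trans (ler_normB _ _) _; rewrite lerD2r.
    exact: ler_norm_sum.
  rewrite rintD// cE lerD2r rint_sum; last by move=> i; apply: L1_norm; case: (sd i).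
  by apply: ler_sum => i _; case: (sd i).
have mlim : m (F N) @[N --> \oo] --> m X.
  by apply: cvg_bigsum => i; exact: cvg2_ip.
have Slim : S (F N) @[N --> \oo] --> S X.
  apply: cvg_bigsum => i; apply: cvg_bigsum => j.
  by under eq_fun do rewrite expr2; rewrite expr2; apply: cvgM; exact: cvg2_ip.
have blim : b N @[N --> \oo] --> (0 : R).
  rewrite (_ : (0 : R) = \sum_(i : I) (0 + 2 * (Num.sqrt (ip P (X i) (X i)) * 0)) + `|m X - m X|); last first.
    by rewrite subrr normr0 addr0 big1// => i _; rewrite mulr0 mulr0 addr0.
  apply: cvgD; last by apply: cvg_norm; apply: cvgB => //; exact: cvg_cst.
  apply: cvg_bigsum => i; apply: cvgD; first exact: FX.
  apply: cvgM; first exact: cvg_cst.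
  apply: cvgM; first exact: cvg_cst.
  by rewrite -[X in _ --> X](@sqrtr0 R); apply: (continuous_cvg _ (@sqrt_continuous R 0)); exact: FX.
have mQ (Y : I -> T -> R) : (forall i, L2 P (Y i)) -> measurable_fun setT (fun w => Q Y w - m Y).
  move=> Y2; apply: measurable_funB => //.
  by apply: measurable_sum => i; apply: measurable_funX; case: (Y2 i).
have mA Y f : (forall i, L2 P (Y i)) -> measurable [set w | f < `|Q Y w - m Y|].
  by move=> Y2; apply: measurable_gt; apply: measurableT_comp => //; exact: mQ.
rewrite -[leLHS]fineK; last by apply: fin_num_measure; exact: mA.
have key N : fine (P [set w | e < `|Q X w - m X|]) <=
    C * S (F N) / (e / 2) ^+ 2 + (e / 2)^-1 * b N.
  have [LDN bN] := LD N.
  have mB : measurable [set w | e / 2 < `|D N w|].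
    by apply: measurable_gt; apply: measurableT_comp => //; exact: L1_meas LDN.
  rewrite -lee_fin fineK; last by apply: fin_num_measure; exact: mA.
  apply: (@le_trans _ _ (P ([set w | e / 2 < `|Q (F N) w - m (F N)|] `|` [set w | e / 2 < `|D N w|]))).
    apply: le_measure; rewrite ?inE.
    - exact: mA.
    - by apply: measurableU => //; exact: mA.
    move=> w /= ew; have [h|h] := ltP (e / 2) `|Q (F N) w - m (F N)|; [by left|right].
    have -> : D N w = (Q (F N) w - m (F N)) - (Q X w - m X) by rewrite /D; ring.
    rewrite distrC; apply: lt_le_trans (lerB_dist _ _); lra.
  apply: le_trans (measureU2 _ _ _) _ => //; first exact: mA.
  rewrite EFinD; apply: leeD; first exact: cF.
  apply: le_trans (markov_norm e2 LDN) _; rewrite lee_fin.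
  by rewrite ler_pM2l ?invr_gt0.
rewrite lee_fin.
have lim : C * S (F N) / (e / 2) ^+ 2 + (e / 2)^-1 * b N @[N --> \oo] -->
    (C * S X / (e / 2) ^+ 2 + (e / 2)^-1 * 0).
  apply: cvgD; last by apply: cvgM => //; exact: cvg_cst.
  by apply: cvgM; [apply: cvgM => //; exact: cvg_cst|exact: cvg_cst].
apply: le_trans (ler_cvg_to (cvg_cst _) lim (nearW _ key)) _.
rewrite mulr0 addr0.
by rewrite le_eqVlt; apply/orP; left; apply/eqP; rewrite /S; field; rewrite gt_eqF.
Qed.

End centered_gaussian.

(** * Transfer of moments and tail bounds between families with the same law *)

Section same_law.
Context (R : realType) (I : finType).
Context d (T : measurableType d) (P : probability T R).
Context d' (T' : measurableType d') (P' : probability T' R).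
Variables (X : I -> T -> R) (Y : I -> T' -> R).
Hypotheses (mX : forall i, measurable_fun setT (X i)) (mY : forall i, measurable_fun setT (Y i)).
Hypothesis XY : forall E : I -> set R, (forall i, measurable (E i)) ->
  P [set w | forall i, E i (X i w)] = P' [set w | forall i, E i (Y i w)].

(** Measurable rectangles: they generate the product sigma-algebra and are closed under
    intersection, so the hypothesis [XY] determines the joint law. *)
Let boxes : set (set (I -> R)) := [set B | exists2 E : I -> set R,
  (forall i, measurable (E i)) & B = [set x | forall i, E i (x i)]].

Let IR := g_sigma_algebraType boxes.

Let mbox d0 (T0 : measurableType d0) (Z : I -> T0 -> R) : (forall i, measurable_fun setT (Z i)) ->
  measurable_fun setT (fun w => (Z ^~ w) : IR).
Proof.
move=> mZ; apply: (@measurability _ _ T0 IR setT _ boxes) => //.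
move=> _ [_ [E mE ->] <-]; rewrite setTI.
rewrite (_ : _ @^-1` _ = \bigcap_(i in [set: I]) (Z i @^-1` E i)); last first.
  by apply/seteqP; split => w /= h i; [move=> _; exact: h|exact: h].
apply: fin_bigcap_measurable => [|i _]; first exact: finite_finset. rewrite -[X in measurable X]setTI; exact: mZ.
Qed.

Let coord_measurable i : measurable_fun setT (fun x : IR => x i).
Proof.
move=> _ E mE; rewrite setTI; apply: sub_sigma_algebra => /=.
exists (fun j => if j == i then E else setT); first by move=> j; case: ifP.
apply/seteqP; split => x /=; first by move=> Ex j; case: eqVneq => // ->.
by move=> /(_ i); rewrite eqxx.
Qed.

Let law (S : set IR) : measurable S -> P ((fun w => X ^~ w) @^-1` S) = P' ((fun w => Y ^~ w) @^-1` S).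
Proof.
pose FX : {mfun T >-> IR} := HB.pack (fun w => (X ^~ w) : IR) (isMeasurableFun.Build _ _ _ _ _ (mbox mX)).
pose FY : {mfun T' >-> IR} := HB.pack (fun w => (Y ^~ w) : IR) (isMeasurableFun.Build _ _ _ _ _ (mbox mY)).
move=> mS.
apply: (@measure_unique _ R IR boxes (fun=> setT) _ _ _ _ (pushforward P FX) (pushforward P' FY)) => //.
- move=> _ _ [E mE ->] [E' mE' ->]; exists (fun i => E i `&` E' i).
    by move=> i; exact: measurableI.
  by apply/seteqP; split => x /=; [move=> [h h'] i|move=> h; split => i; case: (h i)].
- move=> _; exists (fun=> setT) => //; by apply/seteqP; split.
- by apply/seteqP; split => // x _; exists 0%N.
- by move=> _ [E mE ->]; exact: XY.
- by move=> _; rewrite /= /pushforward preimage_setT probability_setT ltry.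
Qed.

Let law_ge0 (f : (I -> R) -> R) : measurable_fun setT (f : IR -> R) -> (forall x, 0 <= f x) ->
  (\int[P]_w (f (X ^~ w))%:E = \int[P']_w (f (Y ^~ w))%:E)%E.
Proof.
move=> mf f0.
pose FY : {mfun T' >-> IR} := HB.pack (fun w => (Y ^~ w) : IR) (isMeasurableFun.Build _ _ _ _ _ (mbox mY)).
have mfE : measurable_fun setT (EFin \o (f : IR -> R)) by exact/measurable_EFinP.
transitivity (\int[pushforward P' FY]_x (EFin \o f) x)%E.
  exact: (@ge0_integral_law _ T _ IR R P (pushforward P' FY) _ (EFin \o f) (mbox mX) law mfE).
symmetry; exact: (@ge0_integral_law _ T' _ IR R P' (pushforward P' FY) _ (EFin \o f) (mbox mY) _ mfE).
Qed.

Let mlin (a : I -> R) : measurable_fun setT (fun x : IR => \sum_i a i * x i).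
Proof. by apply: measurable_sum => i; apply: measurable_funM => //; exact: coord_measurable. Qed.

Lemma same_law_L2 (a : I -> R) :
  L2 P' (fun w => \sum_i a i * Y i w) ->
  L2 P (fun w => \sum_i a i * X i w) /\
  ip P (fun w => \sum_i a i * X i w) (fun w => \sum_i a i * X i w) =
  ip P' (fun w => \sum_i a i * Y i w) (fun w => \sum_i a i * Y i w).
Proof.
move=> [_ Y2].
have mf : measurable_fun setT (fun x : IR => (\sum_i a i * x i) ^+ 2).
  by apply: measurable_funX; exact: mlin.
have E := law_ge0 mf (fun x => sqr_ge0 _).
split; last first.
  rewrite /ip /Rintegral; congr fine; under eq_integral do rewrite -expr2.
  by rewrite E; under [RHS]eq_integral do rewrite -expr2.
have mL : measurable_fun setT (fun w => \sum_i a i * X i w).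
  by apply: measurable_sum => i; exact: measurable_funM.
split => //; apply/integrableP; split.
  by apply/measurable_EFinP; exact: measurable_funX.
move/integrableP : Y2 => [_]; congr (_ < _)%E.
under eq_integral do rewrite /= ger0_norm ?sqr_ge0//.
by under [RHS]eq_integral do rewrite /= ger0_norm ?sqr_ge0//.
Qed.

(** By polarization, since [same_law_L2] compares only the norms of linear combinations. *)
Lemma same_law_ip (a b : I -> R) :
  (forall c : I -> R, L2 P' (fun w => \sum_i c i * Y i w)) ->
  ip P (fun w => \sum_i a i * X i w) (fun w => \sum_i b i * X i w) =
  ip P' (fun w => \sum_i a i * Y i w) (fun w => \sum_i b i * Y i w).
Proof.
move=> Y2; have X2 c := same_law_L2 (Y2 c).
have E d0 (T0 : measurableType d0) (P0 : probability T0 R) (Z : I -> T0 -> R) :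
    (forall c : I -> R, L2 P0 (fun w => \sum_i c i * Z i w)) ->
    ip P0 (fun w => \sum_i a i * Z i w) (fun w => \sum_i b i * Z i w) =
    (ip P0 (fun w => \sum_i (a i + b i) * Z i w) (fun w => \sum_i (a i + b i) * Z i w) -
     ip P0 (fun w => \sum_i a i * Z i w) (fun w => \sum_i a i * Z i w) -
     ip P0 (fun w => \sum_i b i * Z i w) (fun w => \sum_i b i * Z i w)) / 2.
  move=> Z2; rewrite (_ : (fun w => \sum_i (a i + b i) * Z i w) =
    fun w => \sum_i a i * Z i w + \sum_i b i * Z i w); last first.
    by apply/funext => w; rewrite -big_split; apply: eq_bigr => i _; rewrite mulrDl.
  by rewrite ipDD// (ipC _ (fun w => \sum_i b i * Z i w) (fun w => \sum_i a i * Z i w)); field.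
rewrite E; last by move=> c; case: (X2 c).
by rewrite [RHS]E// !(X2 _).2.
Qed.

Lemma same_law_sqsum_conc (J : finType) (C : R) (a : J -> I -> R) :
  (forall c : I -> R, L2 P' (fun w => \sum_i c i * Y i w)) ->
  sqsum_conc P' C (fun j w => \sum_i a j i * Y i w) ->
  sqsum_conc P C (fun j w => \sum_i a j i * X i w).
Proof.
move=> Y2 cY e e0; have := cY e e0.
under [X in ((C * X) / _)%:E]eq_bigr do under eq_bigr do rewrite -same_law_ip//.
under eq_set do under [X in _ - X]eq_bigr do rewrite -same_law_ip//.
congr (_ <= _)%E; symmetry.
pose m := \sum_j ip P (fun w => \sum_i a j i * X i w) (fun w => \sum_i a j i * X i w).
rewrite -/m.
apply: (law (S := [set x : IR | e < `|\sum_j (\sum_i a j i * x i) ^+ 2 - m|])).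
apply: measurable_gt; apply: measurableT_comp => //.
apply: measurable_funB => //; apply: measurable_sum => j.
by apply: measurable_funX; exact: mlin.
Qed.

End same_law.

(** * Wiener integrals and OFBM *)

Section wiener.
Context d (T : measurableType d) (R : realType) (P : probability T R) (n : nat).
Variable Bt : set R -> T -> 'cV[R[i]]_n.
Hypothesis grm : gaussian_random_measure P Bt.
Notation leb := (@lebesgue_measure R).
Notation Re := complex.Re.
Notation Im := complex.Im.

Lemma cvg2_of_sqnorm d0 (X : measurableType d0) (mu : {measure set X -> \bar R})
    (p q : nat) (F : nat -> X -> 'M[R[i]]_(p, q)) (f : X -> 'M[R[i]]_(p, q)) :
  (forall N i j, L2 mu (fun x => Re (F N x i j)) /\ L2 mu (fun x => Im (F N x i j))) ->
  (forall i j, measurable_fun setT (fun x => Re (f x i j)) /\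
               measurable_fun setT (fun x => Im (f x i j))) ->
  (\int[mu]_x (sqnormC (f x - F N x))%:E)%E @[N --> \oo] --> 0%E ->
  forall i j, [/\ L2 mu (fun x => Re (f x i j)), L2 mu (fun x => Im (f x i j)),
    cvg2 mu (fun N x => Re (F N x i j)) (fun x => Re (f x i j)) &
    cvg2 mu (fun N x => Im (F N x i j)) (fun x => Im (f x i j))].
Proof.
move=> F2 mf Ff i j.
have dE N x i' j' : (f x - F N x) i' j' = (Re (f x i' j') - Re (F N x i' j')) +i*
   (Im (f x i' j') - Im (F N x i' j')).
  by rewrite !mxE; case: (f x i' j') => a b; case: (F N x i' j') => u v.
have mR N i' j' : measurable_fun setT (fun x => Re (f x i' j') - Re (F N x i' j')).
  by apply: measurable_funB; [case: (mf i' j')|case: (F2 N i' j') => -[]].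
have mI N i' j' : measurable_fun setT (fun x => Im (f x i' j') - Im (F N x i' j')).
  by apply: measurable_funB; [case: (mf i' j')|case: (F2 N i' j') => _ []].
have mS N : measurable_fun setT (fun x => sqnormC (f x - F N x)).
  rewrite /sqnormC; apply: measurable_sum => i'; apply: measurable_sum => j'.
  under eq_fun do rewrite dE /=.
  by apply: measurable_funD; apply: measurable_funX.
have aux (g : nat -> X -> R) (h : X -> R) : (forall N, L2 mu (g N)) -> measurable_fun setT h ->
    (forall N x, (g N x - h x) ^+ 2 <= sqnormC (f x - F N x)) -> L2 mu h /\ cvg2 mu g h.
  move=> g2 mh le.
  have mgh N : measurable_fun setT (fun x => g N x - h x) by apply: measurable_funB => //; case: (g2 N).
  have leI N : (\int[mu]_x ((g N x - h x) ^+ 2)%:E <= \int[mu]_x (sqnormC (f x - F N x))%:E)%E.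
    apply: ge0_le_integral => //.
    - by move=> x _; rewrite lee_fin sqr_ge0.
    - by apply/measurable_EFinP; exact: measurable_funX.
    - exact/measurable_EFinP.
    - by move=> x _; rewrite lee_fin.
  (* A limit 0 in the extended reals makes the integrals eventually finite; adding [g N] back then
     puts [h] in [L2]. *)
  have fin : \forall N \near \oo, L2 mu (fun x => g N x - h x).
    have /fine_cvgP[+ _] := Ff.
    apply: filterS => N fin1; split => //; apply/integrableP; split.
      by apply/measurable_EFinP; exact: measurable_funX.
    under eq_integral do rewrite /= ger0_norm ?sqr_ge0//.
    by apply: (le_lt_trans (leI N)); rewrite ltey_eq fin1.
  have h2 : L2 mu h.
    have [N _ /(_ N (leqnn N)) LN] := fin.
    have := L2B (g2 N) LN; congr (L2 _ _); apply/funext => x; ring.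
  split => //; rewrite /cvg2.
  have e : (\int[mu]_x ((g N x - h x) ^+ 2)%:E)%E @[N --> \oo] --> 0%E.
    apply: squeeze_cvge Ff; last exact: cvg_cst.
    by apply: nearW => N; rewrite leI integral_ge0// => x _; rewrite lee_fin sqr_ge0.
  rewrite (_ : (fun N => _) = fine \o (fun N => (\int[mu]_x ((g N x - h x) ^+ 2)%:E)%E)).
    by apply: fine_cvg.
  apply/funext => N /=; rewrite /ip /Rintegral; congr fine.
have le N x : Re ((f x - F N x) i j) ^+ 2 + Im ((f x - F N x) i j) ^+ 2 <= sqnormC (f x - F N x).
  rewrite /sqnormC (bigD1 i)//= (bigD1 j)//= -addrA lerDl addr_ge0 //.
    by apply: sumr_ge0 => ? _; rewrite addr_ge0// sqr_ge0.
  by do 2 (apply: sumr_ge0 => ? _); rewrite addr_ge0// sqr_ge0.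
have [|||r2 rc] := aux (fun N x => Re (F N x i j)) (fun x => Re (f x i j)).
- by move=> N; case: (F2 N i j).
- by case: (mf i j).
- move=> N x; apply: le_trans (le N x); rewrite dE /= -sqrrN opprB lerDl; exact: sqr_ge0.
have [|||i2 ic] := aux (fun N x => Im (F N x i j)) (fun x => Im (f x i j)).
- by move=> N; case: (F2 N i j).
- by case: (mf i j).
- move=> N x; apply: le_trans (le N x); rewrite dE /=.
  rewrite [leLHS](_ : _ = (Im (f x i j) - Im (F N x i j)) ^+ 2); last by ring.
  by rewrite lerDr sqr_ge0.
by [].
Qed.

(** Stated for any finite index type, since the sets of several simple integrals are indexed by
    dependent pairs. *)
Lemma grm_gaussian_fin (K : finType) (E : K -> set R) (a b : K -> 'I_n -> R) :
  (forall k, finite_borel (E k)) ->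
  centered_gaussian P (fun w => \sum_k \sum_i
      (a k i * Re (Bt (E k) w i 0) + b k i * Im (Bt (E k) w i 0))).
Proof.
move=> fE.
pose v := @enum_val K predT.
have := grm_gaussian grm (fun k => a (v k)) (fun k => b (v k)) (fun k => fE (v k)).
congr (centered_gaussian _ _); apply/funext => w.
have bv : bijective v by apply: inj_card_bij; [exact: enum_val_inj|rewrite card_ord].
by rewrite [RHS](reindex v)//; exact: onW_bij.
Qed.

Lemma grm_L2 E l : finite_borel E ->
  L2 P (fun w => Re (Bt E w l 0)) /\ L2 P (fun w => Im (Bt E w l 0)).
Proof.
move=> fE; split.
  have [+ _ _] := centered_gaussian_moments (@grm_gaussian_fin unit (fun=> E)
    (fun _ i => (i == l)%:R) (fun _ _ => 0) (fun=> fE)).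
  congr (L2 _ _); apply/funext => w; rewrite big_const card_unit /= addr0.
  rewrite (bigD1 l)//= eqxx mul1r mul0r addr0 big1 ?addr0// => i /negbTE ->.
  by rewrite !mul0r addr0.
have [+ _ _] := centered_gaussian_moments (@grm_gaussian_fin unit (fun=> E)
  (fun _ _ => 0) (fun _ i => (i == l)%:R) (fun=> fE)).
congr (L2 _ _); apply/funext => w; rewrite big_const card_unit /= addr0.
rewrite (bigD1 l)//= eqxx mul1r mul0r add0r big1 ?addr0// => i /negbTE ->.
by rewrite !mul0r addr0.
Qed.

(** Real and imaginary parts of the covariance axiom. It fixes this sum and this symmetry, not the
    four real covariances separately, which is why the isometries below add the contributions of the
    real and imaginary parts of the integrals. *)
Lemma grm_cov E F l l' : finite_borel E -> finite_borel F ->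
  ip P (fun w => Re (Bt E w l 0)) (fun w => Re (Bt F w l' 0)) +
  ip P (fun w => Im (Bt E w l 0)) (fun w => Im (Bt F w l' 0)) =
    (l == l')%:R * fine (leb (E `&` F)) /\
  ip P (fun w => Im (Bt E w l 0)) (fun w => Re (Bt F w l' 0)) =
  ip P (fun w => Re (Bt E w l 0)) (fun w => Im (Bt F w l' 0)).
Proof.
move=> fE fF.
have [r2 i2] := grm_L2 l fE; have [r2' i2'] := grm_L2 l' fF.
have /matrixP/(_ l l') := grm_covariance grm fE fF; rewrite !mxE.
have E1 w : (Bt E w *m (Bt F w) ^t*) l l' =
  (Re (Bt E w l 0) * Re (Bt F w l' 0) + Im (Bt E w l 0) * Im (Bt F w l' 0)) +i*
  (Im (Bt E w l 0) * Re (Bt F w l' 0) - Re (Bt E w l 0) * Im (Bt F w l' 0)).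
  rewrite !mxE big_ord1 !mxE /Num.conj /=.
  case: (Bt E w l 0) => a b; case: (Bt F w l' 0) => u v.
  by apply/eqP; rewrite eq_complex /=; apply/andP; split; apply/eqP; ring.
under eq_Rintegral do rewrite E1 /=; under [X in _ +i* X]eq_Rintegral do rewrite E1 /=.
rewrite rintD ?rintB; [|exact: L2_mul..].
have [->|_] := eqVneq l l'; rewrite ?mulr1n ?mulr0n => -[h1 h2]; split.
- by rewrite mul1r.
- by apply/eqP; rewrite -subr_eq0; apply/eqP.
- by rewrite mul0r.
- by apply/eqP; rewrite -subr_eq0; apply/eqP.
Qed.

Section simple.
Variables (m : nat) (E : 'I_m -> set R) (C : 'I_m -> 'M[R[i]]_n).
Hypothesis fE : forall k, finite_borel (E k).

Definition simple_integral (w : T) : 'cV[R[i]]_n := \sum_k C k *m Bt (E k) w.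
Definition simple_kernel (x : R) : 'M[R[i]]_n := \sum_k (\1_(E k) x : R)%:C *: C k.

Lemma Re_sum (I : Type) (s : seq I) (F : I -> R[i]) :
  Re (\sum_(i <- s) F i) = \sum_(i <- s) Re (F i).
Proof. by elim/big_rec2 : _ => //= i y1 y2 _ <-; case: (F i) => ? ?; case: y2. Qed.

Lemma Im_sum (I : Type) (s : seq I) (F : I -> R[i]) :
  Im (\sum_(i <- s) F i) = \sum_(i <- s) Im (F i).
Proof. by elim/big_rec2 : _ => //= i y1 y2 _ <-; case: (F i) => ? ?; case: y2. Qed.

Lemma Re_mul (x y : R[i]) : Re (x * y) = Re x * Re y - Im x * Im y.
Proof. by case: x => a b; case: y. Qed.

Lemma Im_mul (x y : R[i]) : Im (x * y) = Re x * Im y + Im x * Re y.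
Proof. by case: x => a b; case: y. Qed.

Lemma simple_integral_Re w i : Re (simple_integral w i 0) =
  \sum_k \sum_l (Re (C k i l) * Re (Bt (E k) w l 0) + - Im (C k i l) * Im (Bt (E k) w l 0)).
Proof.
rewrite /simple_integral summxE Re_sum; apply: eq_bigr => k _.
by rewrite mxE Re_sum; apply: eq_bigr => l _; rewrite Re_mul mulNr.
Qed.

Lemma simple_integral_Im w i : Im (simple_integral w i 0) =
  \sum_k \sum_l (Im (C k i l) * Re (Bt (E k) w l 0) + Re (C k i l) * Im (Bt (E k) w l 0)).
Proof.
rewrite /simple_integral summxE Im_sum; apply: eq_bigr => k _.
by rewrite mxE Im_sum; apply: eq_bigr => l _; rewrite Im_mul addrC.
Qed.

Lemma simple_integral_L2 i :
  L2 P (fun w => Re (simple_integral w i 0)) /\ L2 P (fun w => Im (simple_integral w i 0)).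
Proof.
have L k l c c' : L2 P (fun w => c * Re (Bt (E k) w l 0) + c' * Im (Bt (E k) w l 0)).
  by have [h1 h2] := grm_L2 l (fE k); apply: L2D; exact: L2Z.
split; under eq_fun do rewrite ?simple_integral_Re ?simple_integral_Im.
  by do 2 (apply: L2_sum => ?); exact: L.
by do 2 (apply: L2_sum => ?); exact: L.
Qed.

Lemma simple_kernel_Re x i j : Re (simple_kernel x i j) = \sum_k Re (C k i j) * \1_(E k) x.
Proof.
rewrite /simple_kernel summxE Re_sum; apply: eq_bigr => k _.
by rewrite !mxE Re_mul /= mul0r subr0 mulrC.
Qed.

Lemma simple_kernel_Im x i j : Im (simple_kernel x i j) = \sum_k Im (C k i j) * \1_(E k) x.
Proof.
rewrite /simple_kernel summxE Im_sum; apply: eq_bigr => k _.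
by rewrite !mxE Im_mul /= mul0r addr0 mulrC.
Qed.

End simple.

Lemma L2_indic E : finite_borel E -> L2 leb \1_E.
Proof.
move=> [mE fE]; split; first exact: measurable_indic.
have -> : (fun x => \1_E x ^+ 2) = \1_E :> (R -> R).
  by apply/funext => x /=; rewrite indicE; case: (x \in E); rewrite ?expr1n ?expr0n.
apply/integrableP; split; first by apply/measurable_EFinP; exact: measurable_indic.
under eq_integral do rewrite /= ger0_norm//.
by rewrite integral_indic// setIT.
Qed.

Lemma ip_indic E F : finite_borel E -> finite_borel F -> ip leb \1_E \1_F = fine (leb (E `&` F)).
Proof.
move=> [mE _] [mF _]; rewrite /ip.
transitivity (\int[leb]_x (\1_(E `&` F) x : R)).
  by apply: eq_Rintegral => x _; rewrite indicI.
by rewrite /Rintegral integral_indic ?setIT//; exact: measurableI.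
Qed.

Lemma simple_kernel_L2 m (E : 'I_m -> set R) (C : 'I_m -> 'M[R[i]]_n) i j :
  (forall k, finite_borel (E k)) ->
  L2 leb (fun x => Re (simple_kernel E C x i j)) /\ L2 leb (fun x => Im (simple_kernel E C x i j)).
Proof.
move=> fE; split; under eq_fun do rewrite ?simple_kernel_Re ?simple_kernel_Im.
  by apply: L2_sum => k; apply: L2Z; exact: L2_indic.
by apply: L2_sum => k; apply: L2Z; exact: L2_indic.
Qed.

Lemma ip_dsum d0 (X : measurableType d0) (mu : {measure set X -> \bar R})
  (I J : finType) (f : I -> X -> R) (g : J -> X -> R) :
  (forall i, L2 mu (f i)) -> (forall j, L2 mu (g j)) ->
  ip mu (fun x => \sum_i f i x) (fun x => \sum_j g j x) = \sum_i \sum_j ip mu (f i) (g j).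
Proof.
move=> f2 g2; rewrite ip_suml//; last exact: L2_sum.
by apply: eq_bigr => i _; rewrite ip_sumr.
Qed.

Lemma simple_isometry m (E : 'I_m -> set R) (C : 'I_m -> 'M[R[i]]_n)
    m' (E' : 'I_m' -> set R) (C' : 'I_m' -> 'M[R[i]]_n) i j :
  (forall k, finite_borel (E k)) -> (forall k, finite_borel (E' k)) ->
  ip P (fun w => Re (simple_integral E C w i 0)) (fun w => Re (simple_integral E' C' w j 0)) +
  ip P (fun w => Im (simple_integral E C w i 0)) (fun w => Im (simple_integral E' C' w j 0)) =
  \sum_l (ip leb (fun x => Re (simple_kernel E C x i l)) (fun x => Re (simple_kernel E' C' x j l)) +
          ip leb (fun x => Im (simple_kernel E C x i l)) (fun x => Im (simple_kernel E' C' x j l))).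
Proof.
move=> fE fE'.
pose B k l w := Bt (E k) w l 0; pose B' k l w := Bt (E' k) w l 0.
have L k l c c' : L2 P (fun w => c * Re (B k l w) + c' * Im (B k l w)).
  by have [h1 h2] := grm_L2 l (fE k); apply: L2D; exact: L2Z.
have L' k l c c' : L2 P (fun w => c * Re (B' k l w) + c' * Im (B' k l w)).
  by have [h1 h2] := grm_L2 l (fE' k); apply: L2D; exact: L2Z.
transitivity (\sum_k \sum_l \sum_k' \sum_l'
   (Re (C k i l) * Re (C' k' j l') + Im (C k i l) * Im (C' k' j l')) *
   ((l == l')%:R * fine (leb (E k `&` E' k')))).
  rewrite (_ : (fun w => Re (simple_integral E C w i 0)) = fun w =>
    \sum_k \sum_l (Re (C k i l) * Re (B k l w) + - Im (C k i l) * Im (B k l w))); last first.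
    by apply/funext => w; rewrite simple_integral_Re.
  rewrite (_ : (fun w => Re (simple_integral E' C' w j 0)) = fun w =>
    \sum_k \sum_l (Re (C' k j l) * Re (B' k l w) + - Im (C' k j l) * Im (B' k l w))); last first.
    by apply/funext => w; rewrite simple_integral_Re.
  rewrite (_ : (fun w => Im (simple_integral E C w i 0)) = fun w =>
    \sum_k \sum_l (Im (C k i l) * Re (B k l w) + Re (C k i l) * Im (B k l w))); last first.
    by apply/funext => w; rewrite simple_integral_Im.
  rewrite (_ : (fun w => Im (simple_integral E' C' w j 0)) = fun w =>
    \sum_k \sum_l (Im (C' k j l) * Re (B' k l w) + Re (C' k j l) * Im (B' k l w))); last first.
    by apply/funext => w; rewrite simple_integral_Im.
  rewrite !ip_suml; try (move=> ?; exact: L2_sum); try (do 2 (apply: L2_sum => ?); exact: L').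
  rewrite -big_split /=; apply: eq_bigr => k _.
  rewrite !ip_suml; try (move=> ?; exact: L); try (do 2 (apply: L2_sum => ?); exact: L').
  rewrite -big_split /=; apply: eq_bigr => l _.
  rewrite !ip_sumr; try (move=> ?; exact: L2_sum); try exact: L.
  rewrite -big_split /=; apply: eq_bigr => k' _.
  rewrite !ip_sumr; try (move=> ?; exact: L'); try exact: L.
  rewrite -big_split /=; apply: eq_bigr => l' _.
  have [r2 i2] := grm_L2 l (fE k); have [r2' i2'] := grm_L2 l' (fE' k').
  (* The mixed covariances appear with opposite coefficients and cancel by the symmetry [h]. *)
  have [<- h] := grm_cov l l' (fE k) (fE' k').
  rewrite !ipDD; try exact: L2Z.
  rewrite !ipZl; try exact: L2Z; rewrite ?ipZr; try exact: L2Z; rewrite ?ipZr //.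
  by rewrite /B /B' h; ring.
have S k l k' : \sum_l' (Re (C k i l) * Re (C' k' j l') + Im (C k i l) * Im (C' k' j l')) *
     ((l == l')%:R * fine (leb (E k `&` E' k'))) =
   (Re (C k i l) * Re (C' k' j l) + Im (C k i l) * Im (C' k' j l)) * fine (leb (E k `&` E' k')).
  rewrite (bigD1 l)//= eqxx mul1r big1 ?addr0// => l' /negbTE; rewrite eq_sym => ->.
  by rewrite mul0r mulr0.
under eq_bigr do under eq_bigr do under eq_bigr do rewrite S.
rewrite exchange_big /=; apply: eq_bigr => l _.
under [X in ip leb X]eq_fun do rewrite simple_kernel_Re.
under [X in ip leb _ X]eq_fun do rewrite simple_kernel_Re.
under [X in _ + ip leb X _]eq_fun do rewrite simple_kernel_Im.
under [X in _ + ip leb _ X]eq_fun do rewrite simple_kernel_Im.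
have Li k c : L2 leb (fun x => c * \1_(E k) x) by apply: L2Z; exact: L2_indic.
have Li' k c : L2 leb (fun x => c * \1_(E' k) x) by apply: L2Z; exact: L2_indic.
rewrite !ip_dsum// -big_split /=; apply: eq_bigr => k _.
rewrite -big_split /=; apply: eq_bigr => k' _.
have i2 := L2_indic (fE k); have i2' := L2_indic (fE' k').
by rewrite !ipZl// ?ipZr// ip_indic//; ring.
Qed.

Variables (J : finType) (f : J -> R -> 'M[R[i]]_n) (Y : J -> T -> 'cV[R]_n).
Hypothesis wiY : forall t, is_wiener_integral P Bt (f t) (fun w => cplxmx (Y t w)).

(** Simple approximations of all the integrals of the family along one index [N]. As [Y] is real,
    the imaginary parts of the simple integrals tend to 0, so they drop out of the isometry in the
    limit. *)
Lemma wiener_approx : exists (m : nat -> J -> nat) (E : forall N t, 'I_(m N t) -> set R)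
    (C : forall N t, 'I_(m N t) -> 'M[R[i]]_n),
  [/\ forall N t k, finite_borel (E N t k),
   forall t i, L2 P (fun w => Y t w i 0) /\
     cvg2 P (fun N w => Re (simple_integral (E N t) (C N t) w i 0)) (fun w => Y t w i 0) /\
     cvg2 P (fun N w => Im (simple_integral (E N t) (C N t) w i 0)) (fun=> 0) &
   forall t i j, [/\ L2 leb (fun x => Re (f t x i j)), L2 leb (fun x => Im (f t x i j)),
     cvg2 leb (fun N x => Re (simple_kernel (E N t) (C N t) x i j)) (fun x => Re (f t x i j)) &
     cvg2 leb (fun N x => Im (simple_kernel (E N t) (C N t) x i j)) (fun x => Im (f t x i j))]].
Proof.
have ex t : exists mEC : (nat -> nat) * (nat -> nat -> set R) * (nat -> nat -> 'M[R[i]]_n),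
   let: (m, E, C) := mEC in
        [/\ forall N k, finite_borel (E N k),
            (\int[lebesgue_measure]_x
               (sqnormC (f t x - \sum_(k < m N)
                                 (\1_(E N k) x : R)%:C *: C N k))%:E)%E
              @[N --> \oo] --> 0%E &
            (\int[P]_w
               (sqnormC (cplxmx (Y t w) - \sum_(k < m N) C N k *m Bt (E N k) w))%:E)%E
              @[N --> \oo] --> 0%E].
  by have [_ _ [m [E [C h]]]] := wiY t; exists (m, E, C).
pose mEC t := sval (cid (ex t)).
exists (fun N t => (mEC t).1.1 N), (fun N t k => (mEC t).1.2 N k), (fun N t k => (mEC t).2 N k).
have h t := svalP (cid (ex t)).
split.
- by move=> N t k; move: (nat_of_ord k) => {}k; have := h t; rewrite -/(mEC t); case: (mEC t) => -[m E] C [].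
- move=> t i.
  have := h t; rewrite -/(mEC t); case: (mEC t) => -[m E] C /= [fE _ cY].
  have [_ mY _] := wiY t.
  have [||] := @cvg2_of_sqnorm _ _ P n 1 (fun N => simple_integral (fun k : 'I_(m N) => E N k) (fun k => C N k))
     (fun w => cplxmx (Y t w)) _ _ cY i 0.
  + by move=> N i' j'; rewrite (ord1 j'); exact: simple_integral_L2.
  + by move=> i' j'; rewrite (ord1 j'); exact: mY.
  have rE : (fun w => Re (cplxmx (Y t w) i 0)) = (fun w => Y t w i 0).
    by apply/funext => w; rewrite mxE.
  have iE : (fun w => Im (cplxmx (Y t w) i 0)) = (fun w => 0).
    by apply/funext => w; rewrite mxE.
  by rewrite rE iE => Y2 _ c1 c2.
- move=> t i j.
  have := h t; rewrite -/(mEC t); case: (mEC t) => -[m E] C /= [fE cf _].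
  have [mf _ _] := wiY t.
  apply: (@cvg2_of_sqnorm _ _ leb n n (fun N => simple_kernel (fun k : 'I_(m N) => E N k) (fun k => C N k)) (f t) _ mf cf i j).
  by move=> N i' j'; exact: simple_kernel_L2.
Qed.

Lemma wiener_L2 t i : L2 P (fun w => Y t w i 0).
Proof. by have [m [E [C [_ h _]]]] := wiener_approx; case: (h t i). Qed.

Lemma wiener_kernel_L2 t i j : L2 leb (fun x => Re (f t x i j)) /\ L2 leb (fun x => Im (f t x i j)).
Proof. by have [m [E [C [_ _ h]]]] := wiener_approx; case: (h t i j). Qed.

Lemma wiener_isometry t s i j :
  ip P (fun w => Y t w i 0) (fun w => Y s w j 0) =
  \sum_l (ip leb (fun x => Re (f t x i l)) (fun x => Re (f s x j l)) +
          ip leb (fun x => Im (f t x i l)) (fun x => Im (f s x j l))).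
Proof.
have [m [E [C [fE hY hf]]]] := wiener_approx.
pose I N t := simple_integral (E N t) (C N t).
pose k N t := simple_kernel (E N t) (C N t).
have lim1 : ip P (fun w => Re (I N t w i 0)) (fun w => Re (I N s w j 0)) +
   ip P (fun w => Im (I N t w i 0)) (fun w => Im (I N s w j 0)) @[N --> \oo] -->
   ip P (fun w => Y t w i 0) (fun w => Y s w j 0) + ip P (fun=> 0) (fun=> 0).
  have [t2 [tr ti]] := hY t i; have [s2 [sr si]] := hY s j.
  have It N := simple_integral_L2 (C N t) (fE N t) i.
  have Is N := simple_integral_L2 (C N s) (fE N s) j.
  apply: cvgD; apply: cvg2_ip => //; try exact: L2_0.
  - by move=> N; case: (It N).
  - by move=> N; case: (Is N).
  - by move=> N; case: (It N).
  - by move=> N; case: (Is N).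
have lim2 : \sum_l (ip leb (fun x => Re (k N t x i l)) (fun x => Re (k N s x j l)) +
          ip leb (fun x => Im (k N t x i l)) (fun x => Im (k N s x j l))) @[N --> \oo] -->
   \sum_l (ip leb (fun x => Re (f t x i l)) (fun x => Re (f s x j l)) +
          ip leb (fun x => Im (f t x i l)) (fun x => Im (f s x j l))).
  apply: cvg_bigsum => l.
  have [a1 a2 a3 a4] := hf t i l; have [b1 b2 b3 b4] := hf s j l.
  have kt N := simple_kernel_L2 (C N t) i l (fE N t).
  have ks N := simple_kernel_L2 (C N s) j l (fE N s).
  apply: cvgD; apply: cvg2_ip => //.
  - by move=> N; case: (kt N).
  - by move=> N; case: (ks N).
  - by move=> N; case: (kt N).
  - by move=> N; case: (ks N).
have e N : ip P (fun w => Re (I N t w i 0)) (fun w => Re (I N s w j 0)) +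
   ip P (fun w => Im (I N t w i 0)) (fun w => Im (I N s w j 0)) =
  \sum_l (ip leb (fun x => Re (k N t x i l)) (fun x => Re (k N s x j l)) +
          ip leb (fun x => Im (k N t x i l)) (fun x => Im (k N s x j l))).
  exact: simple_isometry.
rewrite (funext e) in lim1.
have := cvg_unique _ lim1 lim2 => <- //.
rewrite [X in _ + X](_ : _ = 0) ?addr0//.
by rewrite /ip; under eq_Rintegral do rewrite mulr0; exact: rint0.
Qed.

Lemma wiener_sqsum_conc (K : finType) (a : K -> J -> 'I_n -> R) :
  sqsum_conc P 8 (fun k w => \sum_t \sum_i a k t i * Y t w i 0).
Proof.
have [m [E [C [fE hY _]]]] := wiener_approx.
pose I N t := simple_integral (E N t) (C N t).
have It N t i := simple_integral_L2 (C N t) (fE N t) i.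
rewrite (_ : 8 = 4 * 2); last by ring.
apply: (@sqsum_conc_lim _ _ _ _ _ _ (fun N k w => \sum_t \sum_i a k t i * Re (I N t w i 0))).
- move=> N k; do 2 (apply: L2_sum => ?); apply: L2Z; exact: (It _ _ _).1.
- by move=> k; do 2 (apply: L2_sum => ?); apply: L2Z; exact: (hY _ _).1.
- move=> k; apply: cvg2_sum.
  + by move=> t N; apply: L2_sum => i; apply: L2Z; exact: (It _ _ _).1.
  + by move=> t; apply: L2_sum => i; apply: L2Z; exact: (hY _ _).1.
  move=> t; apply: cvg2_sum.
  + by move=> i N; apply: L2Z; exact: (It _ _ _).1.
  + by move=> i; apply: L2Z; exact: (hY _ _).1.
  move=> i; apply: cvg2Z; first by move=> N; exact: (It _ _ _).1.
    exact: (hY _ _).1.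
  exact: (hY _ _).2.1.
move=> N; apply: gauss_sqsum_conc => c.
(* One Gaussian combination over the sets of all the integrals: the coefficients of the simple
   integrals are collected on the pairs of a time and a set. *)
pose S := {t : J & 'I_(m N t)}.
have := @grm_gaussian_fin S (fun p => E N (tag p) (tagged p))
  (fun p l => \sum_k c k * \sum_i a k (tag p) i * Re (C N (tag p) (tagged p) i l))
  (fun p l => \sum_k c k * \sum_i a k (tag p) i * - Im (C N (tag p) (tagged p) i l))
  (fun p => fE N _ _).
congr (centered_gaussian _ _); apply/funext => w.
rewrite -(sig_big_dep xpredT (fun _ _ => true) (fun t (k : 'I_(m N t)) =>
  \sum_l ((\sum_k0 c k0 * \sum_i a k0 t i * Re (C N t k i l)) * Re (Bt (E N t k) w l 0) +
    (\sum_k0 c k0 * \sum_i a k0 t i * - Im (C N t k i l)) * Im (Bt (E N t k) w l 0)))) /=.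
under [RHS]eq_bigr => k _ do rewrite mulr_sumr.
rewrite [RHS]exchange_big /=; apply: eq_bigr => t _.
under [RHS]eq_bigr => k _ do (rewrite mulr_sumr; under eq_bigr => i _ do
  (rewrite /I simple_integral_Re mulr_sumr mulr_sumr; under eq_bigr do rewrite mulr_sumr mulr_sumr)).
symmetry.
under eq_bigr => k _ do (rewrite exchange_big /=; under eq_bigr => k' _ do rewrite exchange_big /=).
rewrite exchange_big /=; apply: eq_bigr => k' _.
rewrite exchange_big /=; apply: eq_bigr => l _.
rewrite !mulr_suml -big_split /=; apply: eq_bigr => k _.
rewrite -!mulrA -mulrDr !mulr_suml -big_split mulr_sumr /=; apply: eq_bigr => i _.
by ring.
Qed.

End wiener.

Section ofbm.
Context d (T : measurableType d) (R : realType) (P : probability T R) (n : nat).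
Variables (H : 'M[R]_n) (A : 'M[R[i]]_n) (B : R -> T -> 'cV[R]_n).
Hypothesis ofbmB : is_ofbm P H A B.
Notation leb := (@lebesgue_measure R).
Notation Re := complex.Re.
Notation Im := complex.Im.

Lemma ofbm_measurable t i : measurable_fun setT (fun w => B t w i 0).
Proof.
have [_ mB _] := ofbmB.
exact: (measurableT_comp (mB i) (pair2_measurable t)).
Qed.

(** The source of all that follows about the law of [B]: these statements involve finitely many
    times, so they pass from the Wiener integrals [Y] to [B] through [same_fdd]. *)
Lemma ofbm_fdd m (t : 'I_m -> R) :
  (forall a : 'I_m -> 'I_n -> R, L2 P (fun w => \sum_k \sum_i a k i * B (t k) w i 0)) /\
  (forall k l i j, ip P (fun w => B (t k) w i 0) (fun w => B (t l) w j 0) =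
    \sum_r (ip leb (fun x => Re (ofbm_kernel H A (t k) x i r)) (fun x => Re (ofbm_kernel H A (t l) x j r)) +
            ip leb (fun x => Im (ofbm_kernel H A (t k) x i r)) (fun x => Im (ofbm_kernel H A (t l) x j r)))) /\
  (forall (K : finType) (a : K -> 'I_m -> 'I_n -> R),
     sqsum_conc P 8 (fun k w => \sum_t' \sum_i a k t' i * B (t t') w i 0)).
Proof.
have [_ _ [d' [T' [P' [Bt [Y [grm wi fdd]]]]]]] := ofbmB.
have wit (k : 'I_m) := wi (t k).
have Y2 k i := wiener_L2 grm wit k i.
pose I := ('I_m * 'I_n)%type.
pose XB (p : I) w := B (t p.1) w p.2 0.
pose XY (p : I) w := Y (t p.1) w p.2 0.
have mX p : measurable_fun setT (XB p) by exact: ofbm_measurable.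
have mY p : measurable_fun setT (XY p) by case: (Y2 p.1 p.2).
have law (E : I -> set R) : (forall i, measurable (E i)) ->
  P [set w | forall i, E i (XB i w)] = P' [set w | forall i, E i (XY i w)].
  move=> mE; have := fdd m t (fun k i => E (k, i)) (fun k i => mE (k, i)).
  congr (P _ = P' _); apply/seteqP; split => w /= h.
  - by move=> [k i]; exact: h.
  - by move=> k i; exact: (h (k, i)).
  - by move=> [k i]; exact: h.
  - by move=> k i; exact: (h (k, i)).
have dbl (a : 'I_m -> 'I_n -> R) (Z : 'I_m -> 'I_n -> R) :
    \sum_k \sum_i a k i * Z k i = \sum_(p : I) a p.1 p.2 * Z p.1 p.2.
  by rewrite pair_big.
have XY2 c : L2 P' (fun w => \sum_i c i * XY i w).
  by apply: L2_sum => p; apply: L2Z; exact: Y2.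
split.
  move=> a; have [+ _] := same_law_L2 mX mY law (XY2 (fun p => a p.1 p.2)).
  by congr (L2 _ _); apply/funext => w; rewrite (dbl a (fun k i => B (t k) w i 0)).
split.
  move=> k l i j; rewrite -(wiener_isometry grm wit).
  have one (Z : I -> R) p : Z p = \sum_q (q == p)%:R * Z q.
    by rewrite (bigD1 p)//= eqxx mul1r big1 ?addr0// => q /negbTE ->; rewrite mul0r.
  have := same_law_ip mX mY law (fun q => (q == (k, i))%:R) (fun q => (q == (l, j))%:R) XY2.
  rewrite (_ : (fun w => \sum_i0 _ * XB i0 w) = XB (k, i)); last first.
    by apply/funext => w; rewrite -(one (XB ^~ w)).
  rewrite (_ : (fun w => \sum_i0 _ * XB i0 w) = XB (l, j)); last first.
    by apply/funext => w; rewrite -(one (XB ^~ w)).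
  rewrite (_ : (fun w => \sum_i0 _ * XY i0 w) = XY (k, i)); last first.
    by apply/funext => w; rewrite -(one (XY ^~ w)).
  rewrite (_ : (fun w => \sum_i0 _ * XY i0 w) = XY (l, j)); last first.
    by apply/funext => w; rewrite -(one (XY ^~ w)).
  by [].
move=> K a.
have := wiener_sqsum_conc grm wit a.
rewrite (_ : (fun k w => \sum_t' \sum_i a k t' i * Y (t t') w i 0) =
   fun k w => \sum_p a k p.1 p.2 * XY p w); last first.
  by apply/funext => k; apply/funext => w; rewrite (dbl (a k) (fun k i => Y (t k) w i 0)).
move/(same_law_sqsum_conc mX mY law XY2).
congr (sqsum_conc _ _ _); apply/funext => k; apply/funext => w.
by rewrite (dbl (a k) (fun k i => B (t k) w i 0)).
Qed.

Lemma ofbm_L2 t i : L2 P (fun w => B t w i 0).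
Proof.
have [h _] := ofbm_fdd (fun=> t : R) (m := 1).
have := h (fun _ j => (j == i)%:R); congr (L2 _ _); apply/funext => w.
by rewrite big_ord1 (bigD1 i)//= eqxx mul1r big1 ?addr0// => j /negbTE ->; rewrite mul0r.
Qed.

Lemma ofbm_cov t s i j : ip P (fun w => B t w i 0) (fun w => B s w j 0) =
    \sum_r (ip leb (fun x => Re (ofbm_kernel H A t x i r)) (fun x => Re (ofbm_kernel H A s x j r)) +
            ip leb (fun x => Im (ofbm_kernel H A t x i r)) (fun x => Im (ofbm_kernel H A s x j r))).
Proof.
have [_ [h _]] := ofbm_fdd (m := 2) (fun k => if k == ord0 then t else s).
exact: (h ord0 ord_max).
Qed.

Lemma ofbm_kernel_L2 t i r : L2 leb (fun x => Re (ofbm_kernel H A t x i r)) /\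
  L2 leb (fun x => Im (ofbm_kernel H A t x i r)).
Proof.
have [_ _ [d' [T' [P' [Bt [Y [grm wi _]]]]]]] := ofbmB.
exact: (wiener_kernel_L2 grm (fun _ : unit => wi t) tt).
Qed.

End ofbm.

(** * Covariance of OFBM in the eigenbasis *)

Section mxexp_diag.
Variables (R : realType) (n : nat).
Implicit Types (M P : 'M[R]_n).

Lemma expmx_diag P (v : 'I_n -> R) k : P *m P^T = 1%:M ->
  (P *m diag_mx (\row_q v q) *m P^T) ^+ k = P *m diag_mx (\row_q v q ^+ k) *m P^T.
Proof.
move=> PP; have PP' : P^T *m P = 1%:M by exact: mulmx1C.
elim: k => [|k IH].
  rewrite expr0 (_ : diag_mx _ = 1%:M) ?mulmx1 ?PP//.
  by apply/matrixP => i j; rewrite !mxE expr0.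
rewrite exprS IH -[_ * _]/(mulmx _ _) !mulmxA -(mulmxA _ P^T) PP' mulmx1.
rewrite -(mulmxA P) mulmx_diag; congr (P *m diag_mx _ *m _).
by apply/rowP => i; rewrite !mxE exprS.
Qed.

Lemma mulmx_diagE P (v : 'I_n -> R) i j :
  (P *m diag_mx (\row_q v q) *m P^T) i j = \sum_q P i q * v q * P j q.
Proof.
rewrite mxE; apply: eq_bigr => q _; rewrite !mxE (bigD1 q)//= !mxE eqxx mulr1n big1 ?addr0//.
by move=> q' /negbTE nq; rewrite !mxE nq mulr0n mulr0.
Qed.

(** Entries of powers of a diagonalized matrix are fixed linear combinations of the powers of the
    [v q], so each entrywise series is a combination of scalar exponential series. *)
Lemma mxexp_diag P (v : 'I_n -> R) : P *m P^T = 1%:M ->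
  mxexp (P *m diag_mx (\row_q v q) *m P^T) = P *m diag_mx (\row_q expR (v q)) *m P^T.
Proof.
move=> PP; apply/matrixP => i j; rewrite mulmx_diagE mxE; apply: cvg_lim => //.
rewrite (_ : series _ = fun N => \sum_q P i q * series (exp_coeff (v q)) N * P j q).
  apply: cvg_bigsum => q; apply: cvgM; last exact: cvg_cst.
  by apply: cvgM; [exact: cvg_cst|exact: is_cvg_series_exp_coeff].
apply/funext => N; rewrite /series /=.
under eq_bigr do rewrite expmx_diag// mulmx_diagE mulr_suml.
rewrite exchange_big /=; apply: eq_bigr => q _.
rewrite mulr_sumr mulr_suml; apply: eq_bigr => k _.
by rewrite /exp_coeff /=; ring.
Qed.

Lemma mxpower_diag P (v : 'I_n -> R) c : P *m P^T = 1%:M -> 0 < c ->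
  mxpower c (P *m diag_mx (\row_q v q) *m P^T) = P *m diag_mx (\row_q c `^ v q) *m P^T.
Proof.
move=> PP c0; rewrite /mxpower c0.
rewrite scalemxAl scalemxAr (_ : ln c *: diag_mx _ = diag_mx (\row_q (ln c * v q))); last first.
  by apply/matrixP => i j; rewrite !mxE mulrnAr.
rewrite mxexp_diag//; congr (_ *m diag_mx _ *m _).
by apply/rowP => i; rewrite !mxE /powR gt_eqF// mulrC.
Qed.

End mxexp_diag.

Section kernel.
Variables (R : realType) (n : nat) (H P : 'M[R]_n) (A : 'M[R[i]]_n) (h : 'I_n -> R).
Hypothesis PP : P *m P^T = 1%:M.
Hypothesis HP : H = P *m diag_mx (\row_q h q) *m invmx P.
Hypothesis ImA : map_mx (@complex.Im R) (A *m A ^t*) = 0.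
Notation Re := complex.Re.
Notation Im := complex.Im.

(** The amplitude of the spectral density in the eigenbasis of [H], where the powers of [|x|] act
    diagonally. *)
Definition ofbm_cov_matrix : 'M[R]_n := P^T *m map_mx (@complex.Re R) (A *m A ^t*) *m P.

Let invP : invmx P = P^T.
Proof.
have [uP _] := mulmx1_unit PP.
by rewrite -[RHS](mulKmx uP) PP mulmx1.
Qed.

Lemma exponentE : - (H - (2^-1)%:M) = P *m diag_mx (\row_q (2^-1 - h q)) *m P^T.
Proof.
rewrite HP invP opprB (_ : diag_mx (\row_q (2^-1 - h q)) = (2^-1)%:M - diag_mx (\row_q h q)).
  by rewrite mulmxBr mulmxBl; congr (_ - _); rewrite mul_mx_scalar -scalemxAl PP scalemx1.
by apply/matrixP => i j; rewrite !mxE mulrnBl.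
Qed.

Let PPT : P^T *m P = 1%:M. Proof. exact: mulmx1C. Qed.

(** The real part of [exp(itx) - 1] times the conjugate of [exp(isx) - 1], over [x^2]: the
    contribution of the times [t] and [s] to the covariance. *)
Definition osc (t s x : R) : R :=
  ((cos (t * x) - 1) * (cos (s * x) - 1) + sin (t * x) * sin (s * x)) / x ^+ 2.

Let kerq (t x : R) q r : R[i] := \sum_i (P i q)%:C * ofbm_kernel H A t x i r.

Let AA (x : R) : 'M[R[i]]_n := if 0 < x then A else entrywise_conj A.

Let kerqE t x q r : x != 0 ->
  kerq t x q r = ((cis (t * x) - 1) / ('i * x%:C)) * (`|x| `^ (2^-1 - h q))%:C *
     (cplxmx P^T *m AA x) q r.
Proof.
move=> x0.
have E (y : R) : 0 < y -> cplxmx (mxpower y (- (H - (2^-1)%:M))) =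
    cplxmx P *m cplxmx (diag_mx (\row_q y `^ (2^-1 - h q))) *m cplxmx P^T.
  by move=> y0; rewrite exponentE mxpower_diag// /cplxmx !map_mxM.
have Z : mxpower (0 : R) (- (H - (2^-1)%:M)) = 0 by rewrite /mxpower ltxx.
have Z' : cplxmx (0 : 'M[R]_n) = 0 by exact: map_mx0.
have kE : ofbm_kernel H A t x = ((cis (t * x) - 1) / ('i * x%:C)) *:
    (cplxmx P *m cplxmx (diag_mx (\row_q `|x| `^ (2^-1 - h q))) *m cplxmx P^T *m AA x).
  rewrite /ofbm_kernel /AA; congr (_ *: _).
  move: x0; rewrite neq_lt => /orP[xn|xp].
    rewrite max_r ?ltW// Z Z' mul0mx add0r max_l ?oppr_ge0 ?ltW//.
    by rewrite ltNge (ltW xn) /= ltr0_norm// E// oppr_gt0.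
  rewrite xp max_l ?ltW// E// max_r ?oppr_le0 ?ltW// Z Z' mul0mx addr0.
  by rewrite gtr0_norm.
have : (cplxmx P^T *m ofbm_kernel H A t x) q r = kerq t x q r.
  by rewrite mxE; apply: eq_bigr => i _; rewrite !mxE.
move=> <-; rewrite kE -scalemxAr !mulmxA.
have -> : cplxmx P^T *m cplxmx P = 1%:M by rewrite /cplxmx -map_mxM PPT map_mx1.
rewrite mul1mx mxE -mulrA; congr (_ * _).
rewrite -mulmxA mxE (bigD1 q)//= big1 ?addr0.
  by rewrite !mxE eqxx mulr1n.
by move=> q' nq; rewrite !mxE eq_sym (negbTE nq) mulr0n mul0r.
Qed.

(** On the two half-lines the kernel carries [A] and its conjugate. As the imaginary part of
    [A *m A ^t*] vanishes, both have the same real Gram matrix, so the spectral density is real and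
    even. *)
Let AAE x : (cplxmx P^T *m AA x) *m (cplxmx P^T *m AA x) ^t* = cplxmx ofbm_cov_matrix.
Proof.
have SE : A *m A ^t* = cplxmx (map_mx (@complex.Re R) (A *m A ^t*)).
  move: (A *m A ^t*) ImA => M ImM; apply/matrixP => i j.
  have /matrixP/(_ i j) := ImM; rewrite !mxE.
  by case: (M i j) => a b /= ->.
have SC : entrywise_conj A *m (entrywise_conj A) ^t* = A *m A ^t*.
  rewrite SE; transitivity (map_mx Num.conj (A *m A ^t*)).
    by rewrite map_mxM; congr (_ *m _); apply/matrixP => i j; rewrite !mxE.
  rewrite SE; apply/matrixP => i j; rewrite !mxE /= /Num.conj /=.
  by apply/eqP; rewrite eq_complex /= oppr0 !eqxx.
have AAS : AA x *m (AA x) ^t* = cplxmx (map_mx (@complex.Re R) (A *m A ^t*)).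
  by rewrite -SE /AA; case: ifP.
rewrite trmx_mul map_mxM mulmxA -(mulmxA _ (AA x)) AAS /ofbm_cov_matrix /cplxmx !map_mxM.
congr (_ *m _); apply/matrixP => i j; rewrite !mxE /Num.conj /=.
by apply/eqP; rewrite eq_complex /= oppr0 !eqxx.
Qed.

Lemma Re_conj_mul (x y : R[i]) : Re x * Re y + Im x * Im y = Re (x * Num.conj y).
Proof. by case: x => a b; case: y => c e; rewrite /Num.conj /=; ring. Qed.

Lemma kernel_cov t s x q q' :
  \sum_r (Re (kerq t x q r) * Re (kerq s x q' r) + Im (kerq t x q r) * Im (kerq s x q' r)) =
  ofbm_cov_matrix q q' * (osc t s x * `|x| `^ (1 - h q - h q')).
Proof.
have [->|x0] := eqVneq x 0.
  (* At [x = 0] both sides are 0: [mxpower] is 0 there, and so is the inverse of 0 in [osc]. *)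
  rewrite /osc expr0n invr0 mulr0 mul0r mulr0 big1// => r _.
  rewrite /kerq; have Z i t' : ofbm_kernel H A t' 0 i r = 0.
    rewrite /ofbm_kernel /= oppr0 maxxx /mxpower ltxx /cplxmx map_mx0 !mul0mx addr0.
    by rewrite scaler0 mxE.
  by rewrite !big1 ?mul0r ?addr0// => i _; rewrite Z mulr0.
have cm (a b u v : R[i]) : (a * u) * Num.conj (b * v) = (a * Num.conj b) * (u * Num.conj v).
  by rewrite rmorphM mulrACA.
under eq_bigr do rewrite Re_conj_mul !kerqE// cm.
rewrite -Re_sum -mulr_sumr.
have -> : \sum_r (cplxmx P^T *m AA x) q r * Num.conj ((cplxmx P^T *m AA x) q' r) =
   ((ofbm_cov_matrix q q')%:C).
  have /matrixP/(_ q q') := AAE x; rewrite [X in _ = X -> _]mxE => <-.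
  by rewrite [RHS]mxE; apply: eq_bigr => r _; congr (_ * _); rewrite !mxE.
have -> : `|x| `^ (1 - h q - h q') = `|x| `^ (2^-1 - h q) * `|x| `^ (2^-1 - h q').
  rewrite -powRD; last by rewrite normr_eq0 x0 implybT.
  by congr (_ `^ _); field.
set a := _ `^ (2^-1 - h q); set b := _ `^ (2^-1 - h q'); set c := ofbm_cov_matrix q q'.
have gE (y : R) : (cis (y * x) - 1) / ('i * x%:C) =
    (sin (y * x) / x) +i* (- ((cos (y * x) - 1) / x)).
  have xC : 'i * x%:C != 0 :> R[i] by rewrite mulf_neq0 ?complexiE ?neq0Ci// eq_complex /= eqxx andbT.
  apply: (mulIf xC); rewrite divfK// /cis.
  by apply/eqP; rewrite eq_complex /=; apply/andP; split; apply/eqP; field.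
by rewrite !gE /osc /Num.conj /=; field.
Qed.

(** The quadratic form at [c] of the spectral density of OFBM in the eigenbasis, without the
    [1 / x^2] kept in [osc]; the exponent is [(1/2 - h q) + (1/2 - h q')]. *)
Definition spectral_weight (c : 'I_n -> R) (x : R) : R :=
  \sum_q \sum_q' c q * c q' * (ofbm_cov_matrix q q' * `|x| `^ (1 - h q - h q')).

Context d (T : measurableType d) (Pr : probability T R) (B : R -> T -> 'cV[R]_n).
Hypothesis ofbmB : is_ofbm Pr H A B.
Notation leb := (@lebesgue_measure R).

(* The component of the process along the direction with coordinates [c] in the
   eigenbasis of [H]. *)
Definition ofbm_proj (c : 'I_n -> R) (t : R) (w : T) : R :=
  \sum_i (\sum_q P i q * c q) * B t w i 0.

Let kerq_Re t x q r : Re (kerq t x q r) = \sum_i P i q * Re (ofbm_kernel H A t x i r).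
Proof. by rewrite /kerq Re_sum; apply: eq_bigr => i _; rewrite Re_mul /= mul0r subr0. Qed.

Let kerq_Im t x q r : Im (kerq t x q r) = \sum_i P i q * Im (ofbm_kernel H A t x i r).
Proof. by rewrite /kerq Im_sum; apply: eq_bigr => i _; rewrite Im_mul /= mul0r addr0. Qed.

Let kerq_L2 t q r : L2 leb (fun x => Re (kerq t x q r)) /\ L2 leb (fun x => Im (kerq t x q r)).
Proof.
have k2 i := ofbm_kernel_L2 ofbmB t i r.
split; [under eq_fun do rewrite kerq_Re|under eq_fun do rewrite kerq_Im].
  by apply: L2_sum => i; apply: L2Z; case: (k2 i).
by apply: L2_sum => i; apply: L2Z; case: (k2 i).
Qed.

Lemma ofbm_proj_L2 c t : L2 Pr (ofbm_proj c t).
Proof. by apply: L2_sum => i; apply: L2Z; exact: ofbm_L2 ofbmB t i. Qed.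

Lemma ofbm_proj_cov c t s :
  ip Pr (ofbm_proj c t) (ofbm_proj c s) = \int[leb]_x (osc t s x * spectral_weight c x).
Proof.
have Z2 u i := ofbm_L2 ofbmB u i.
rewrite ip_dsum; try by move=> i; apply: L2Z.
have Lk q q' : L1 leb (fun x => \sum_r (Re (kerq t x q r) * Re (kerq s x q' r) + Im (kerq t x q r) * Im (kerq s x q' r))).
  by apply: L1_sum => r; apply: L1D; apply: L2_mul; (exact: (kerq_L2 _ _ _).1 || exact: (kerq_L2 _ _ _).2).
transitivity (\sum_q \sum_q' c q * c q' * \int[leb]_x (\sum_r (Re (kerq t x q r) * Re (kerq s x q' r) + Im (kerq t x q r) * Im (kerq s x q' r)))).
  (* The integral for the directions [q] and [q'] is the covariance of two coordinates of the
     process in the eigenbasis, expanded by [ofbm_cov] in those of [B]. *)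
  have E q q' : \int[leb]_x (\sum_r (Re (kerq t x q r) * Re (kerq s x q' r) + Im (kerq t x q r) * Im (kerq s x q' r))) =
     \sum_i \sum_j P i q * P j q' * ip Pr (fun w => B t w i 0) (fun w => B s w j 0).
    transitivity (\sum_r (ip leb (fun x => Re (kerq t x q r)) (fun x => Re (kerq s x q' r)) +
         ip leb (fun x => Im (kerq t x q r)) (fun x => Im (kerq s x q' r)))).
      rewrite rint_sum; last first.
        by move=> r; apply: L1D; apply: L2_mul; (exact: (kerq_L2 _ _ _).1 || exact: (kerq_L2 _ _ _).2).
      apply: eq_bigr => r _; rewrite rintD//; apply: L2_mul; (exact: (kerq_L2 _ _ _).1 || exact: (kerq_L2 _ _ _).2).
    have k2 u i r := ofbm_kernel_L2 ofbmB u i r.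
    under eq_bigr => r _ do rewrite (funext (fun x => kerq_Re t x q r)) (funext (fun x => kerq_Re s x q' r))
      (funext (fun x => kerq_Im t x q r)) (funext (fun x => kerq_Im s x q' r)).
    under eq_bigr => r _ do
      rewrite (ip_dsum (fun i => L2Z (P i q) (k2 t i r).1) (fun j => L2Z (P j q') (k2 s j r).1))
        (ip_dsum (fun i => L2Z (P i q) (k2 t i r).2) (fun j => L2Z (P j q') (k2 s j r).2)) -big_split /=.
    rewrite exchange_big /=; apply: eq_bigr => i _.
    under eq_bigr => r _ do rewrite -big_split /=.
    rewrite exchange_big /=; apply: eq_bigr => j _.
    rewrite (ofbm_cov ofbmB) mulr_sumr; apply: eq_bigr => r _.
    have [a1 a2] := k2 t i r; have [b1 b2] := k2 s j r.
    by rewrite !ipZl ?ipZr; try exact: L2Z; [ring|..].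
  under [RHS]eq_bigr => q _ do under eq_bigr => q' _ do
    (rewrite E mulr_sumr; under eq_bigr => i _ do rewrite mulr_sumr).
  under [RHS]eq_bigr => q _ do rewrite exchange_big /=.
  rewrite [RHS]exchange_big /=; apply: eq_bigr => i _.
  under [RHS]eq_bigr => q _ do (under eq_bigr => q' _ do idtac; rewrite exchange_big /=).
  rewrite [RHS]exchange_big /=; apply: eq_bigr => j _.
  rewrite ipZl ?ipZr//; last exact: L2Z.
  rewrite mulrA mulr_suml mulr_suml; apply: eq_bigr => q _.
  by rewrite mulr_sumr mulr_suml; apply: eq_bigr => q' _; ring.
have kE q q' x := kernel_cov t s x q q'.
pose F q q' x := c q * c q' * \sum_r (Re (kerq t x q r) * Re (kerq s x q' r) + Im (kerq t x q r) * Im (kerq s x q' r)).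
have LF q q' : L1 leb (F q q') by exact: L1Z.
rewrite (eq_bigr (fun q => \int[leb]_x (\sum_q' F q q' x))); last first.
  by move=> q _; rewrite rint_sum//; apply: eq_bigr => q' _; rewrite rintZ.
rewrite -rint_sum; last by move=> q; exact: L1_sum.
apply: eq_Rintegral => x _; rewrite /spectral_weight mulr_sumr; apply: eq_bigr => q _.
by rewrite mulr_sumr; apply: eq_bigr => q' _; rewrite /F kE; ring.
Qed.
End kernel.

(** * Trigonometric bounds and integrable weights *)

Section trig_bounds.
Variable R : realType.
Implicit Types x y u : R.

Lemma norm_sin_le1 x : `|sin x| <= 1.
Proof. by rewrite ler_norml sin_geN1 sin_le1. Qed.

Lemma norm_cos_le1 x : `|cos x| <= 1.
Proof. by rewrite ler_norml cos_geN1 cos_le1. Qed.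

Lemma lipschitz_of_deriv (f f' : R -> R) (k : R) :
  (forall x, is_derive x (1 : R) f (f' x)) -> (forall x, `|f' x| <= k) ->
  forall x y, `|f x - f y| <= k * `|x - y|.
Proof.
move=> df fk.
have H x y : x < y -> `|f y - f x| <= k * `|y - x|.
  move=> xy.
  have [|c _ ->] := @MVT R f f' x y xy (fun z _ => df z).
    by apply: derivable_within_continuous => z _; exact: (@ex_derive _ _ _ _ _ _ _ (df z)).
  by rewrite normrM ler_wpM2r.
move=> x y; have [xy|xy|->] := ltgtP x y.
- by rewrite distrC (distrC x); exact: H.
- exact: H.
- by rewrite !subrr normr0 mulr0.
Qed.

Lemma lipschitz_sin x y : `|sin x - sin y| <= `|x - y|.
Proof.
rewrite -[leRHS]mul1r; apply: (lipschitz_of_deriv (fun x => is_derive_sin x)).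
exact: norm_cos_le1.
Qed.

Lemma lipschitz_cos x y : `|cos x - cos y| <= `|x - y|.
Proof.
rewrite -[leRHS]mul1r; apply: (lipschitz_of_deriv (fun x => is_derive_cos x)).
by move=> z; rewrite normrN; exact: norm_sin_le1.
Qed.

Lemma norm_sin_le x : `|sin x| <= `|x|.
Proof. by have := lipschitz_sin x 0; rewrite sin0 !subr0. Qed.

Lemma norm_cos_sub1_le x : `|cos x - 1| <= `|x|.
Proof. by have := lipschitz_cos x 0; rewrite cos0 !subr0. Qed.

Lemma norm_cos_sub1_le2 x : `|cos x - 1| <= 2.
Proof. by apply: le_trans (ler_normB _ _) _; rewrite normr1; have := norm_cos_le1 x; lra. Qed.

Lemma norm_cos_sub1_sqr x : `|cos x - 1| <= x ^+ 2.
Proof.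
have -> : x = x / 2 + x / 2 by field.
rewrite cosD -!expr2; set y := x / 2.
have -> : cos y ^+ 2 - sin y ^+ 2 - 1 = - (2 * sin y ^+ 2).
  by have := cos2Dsin2 y; lra.
rewrite normrN ger0_norm; last by rewrite mulr_ge0// sqr_ge0.
have : sin y ^+ 2 <= y ^+ 2.
  rewrite -(real_normK (num_real (sin y))) -(real_normK (num_real y)).
  by rewrite lerXn2r ?nnegrE// norm_sin_le.
have := sqr_ge0 y; nra.
Qed.

(** By the mean value theorem [sin x - x = (cos c - 1) x] with [c] between 0 and [x]. The quadratic
    bound is not sharp but matches the one for the cosine. *)
Lemma norm_sin_sub_sqr x : `|sin x - x| <= x ^+ 2.
Proof.
have [->|x0] := eqVneq x 0; first by rewrite sin0 subrr normr0 expr0n.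
have df z : is_derive z (1 : R) (fun x => sin x - x) (cos z - 1).
  by apply: is_deriveB.
have H y z : y < z -> exists2 c, y < c < z & sin z - z - (sin y - y) = (cos c - 1) * (z - y).
  move=> yz; have [|c cyz e] := @MVT R (fun x => sin x - x) (fun x => cos x - 1) y z yz (fun u _ => df u).
    by apply: derivable_within_continuous => u _; exact: (@ex_derive _ _ _ _ _ _ _ (df u)).
  by exists c => //; move: cyz; rewrite in_itv.
have bnd c : `|c| <= `|x| -> `|(cos c - 1) * x| <= x ^+ 2.
  move=> cx; rewrite normrM -(real_normK (num_real x)) expr2 ler_wpM2r//.
  exact: le_trans (norm_cos_sub1_le c) cx.
move: x0; rewrite neq_lt => /orP[xn|xp].
  have [c /andP[c1 c2] e] := H _ _ xn; move: e; rewrite sin0 subrr sub0r add0r => e.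
  rewrite -normrN e mulrN normrN; apply: bnd.
  by rewrite !ltr0_norm// lerN2 ltW.
have [c /andP[c1 c2] e] := H _ _ xp; move: e; rewrite sin0 subrr !subr0 => ->.
by apply: bnd; rewrite !gtr0_norm// ltW.
Qed.

Lemma osc_bound (t s x : R) : `|osc t s x| <= (2 * `|t * s| + 5) / (1 + x ^+ 2).
Proof.
have [->|x0] := eqVneq x 0.
  by rewrite /osc expr0n invr0 mulr0 normr0 divr_ge0// ?addr_ge0// mulr_ge0.
have x2 : 0 < x ^+ 2 by rewrite exprn_even_gt0.
have x2' : 0 <= (x ^+ 2)^-1 by rewrite invr_ge0 ltW.
rewrite /osc normrM (ger0_norm x2').
set N := `|_|.
(* The numerator is at most [2 * 2 + 1] by boundedness and at most [2 |t s| x^2] by the Lipschitz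
   bounds; the two combine into the factor [1 + x^2]. *)
have N1 : N <= 5.
  apply: le_trans (ler_normD _ _) _; rewrite !normrM.
  have := norm_cos_sub1_le2 (t * x); have := norm_cos_sub1_le2 (s * x).
  have := norm_sin_le1 (t * x); have := norm_sin_le1 (s * x).
  have := normr_ge0 (cos (t * x) - 1); have := normr_ge0 (cos (s * x) - 1).
  have := normr_ge0 (sin (t * x)); have := normr_ge0 (sin (s * x)).
  nra.
have N2 : N <= 2 * `|t * s| * x ^+ 2.
  have e : 2 * `|t * s| * x ^+ 2 = `|t * x| * `|s * x| + `|t * x| * `|s * x|.
    by rewrite -(real_normK (num_real x)) !normrM; ring.
  rewrite e; apply: le_trans (ler_normD _ _) _.
  by rewrite (normrM (cos _ - 1)) (normrM (sin _)) lerD// ler_pM// ?norm_cos_sub1_le ?norm_sin_le.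
rewrite ler_pdivrMr// mulrAC ler_pdivlMr; last by rewrite ltr_pwDr// ltW.
have : N * x ^+ 2 <= 5 * x ^+ 2 by rewrite ler_wpM2r// ltW.
nra.
Qed.

End trig_bounds.

(** * Affine changes of variable for Lebesgue measure *)

Section affine.
Variable R : realType.
Notation leb := (@lebesgue_measure R).

Lemma ge0_integral_affine (a b : R) (f : R -> \bar R) : 0 < a ->
  measurable_fun setT f -> (forall x, 0 <= f x)%E ->
  (\int[leb]_x f x = a%:E * \int[leb]_x f (a * x + b)%R)%E.
Proof.
move=> a0 mf f0.
pose phi (x : measurableTypeR R) : measurableTypeR R := a * x + b.
have mphi : measurable_fun setT phi by apply: measurable_funD => //; exact: measurable_funM.
pose F : {mfun measurableTypeR R >-> measurableTypeR R} :=
  HB.pack phi (isMeasurableFun.Build _ _ _ _ phi mphi).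
have a0' : 0 <= a by exact: ltW.
pose m := mscale (NngNum a0') leb.
have law E : measurable E -> m (phi @^-1` E) = leb E.
  (* A measure with the right values on half-open intervals is Lebesgue measure. *)
  move=> mE; symmetry; apply: (@lebesgue_measure_unique R (pushforward m F)) => // _ [[u v] _ <-].
  pose l := (u - b) / a; pose r := (v - b) / a.
  transitivity (a%:E * leb `]l, r]%classic)%E; last first.
    congr (_ * leb _)%E; apply/seteqP; split => x /=;
      rewrite /= !in_itv /= /phi /l /r ltr_pdivrMr// ler_pdivlMr// => /andP[h1 h2];
      apply/andP; split; lra.
  rewrite !lebesgue_measure_itv /= !lte_fin /l /r ltr_pM2r ?invr_gt0// ltrD2r.
  case: ifP => _; last by rewrite mule0.
  by rewrite -!EFinB -EFinM; congr EFin; field; rewrite gt_eqF.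
rewrite -(ge0_integral_law mphi law mf f0) ge0_integral_mscale//.
exact: measurableT_comp.
Qed.

Lemma ge0_integral_opp (f : R -> \bar R) :
  measurable_fun setT f -> (forall x, 0 <= f x)%E ->
  (\int[leb]_x f x = \int[leb]_x f (- x)%R)%E.
Proof.
move=> mf f0.
have mN : measurable_fun setT (-%R : measurableTypeR R -> measurableTypeR R).
  exact: oppr_measurable.
by rewrite -(ge0_integral_law mN (@lebesgue_measureN R) mf f0).
Qed.

Lemma L1_affine (a b : R) (f : R -> R) : 0 < a -> L1 leb f ->
  L1 leb (fun x => f (a * x + b)) /\
  \int[leb]_x f x = a * \int[leb]_x f (a * x + b).
Proof.
move=> a0 f1; have mf := L1_meas f1.
have mphi : measurable_fun setT (fun x : measurableTypeR R => a * x + b : measurableTypeR R).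
  by apply: measurable_funD => //; exact: measurable_funM.
have G (g : R -> R) : L1 leb g -> (forall x, 0 <= g x) ->
    L1 leb (fun x => g (a * x + b)) /\ \int[leb]_x g x = a * \int[leb]_x g (a * x + b).
  move=> g1 g0; have mg := L1_meas g1.
  have e := @ge0_integral_affine a b (EFin \o g) a0.
  have {}e := e (measurable_int _ g1) (fun x => g0 x).
  have i1 : L1 leb (fun x => g (a * x + b)).
    apply/integrableP; split; first by apply/measurable_EFinP; exact: (measurableT_comp mg mphi).
    under eq_integral do rewrite /= ger0_norm//.
    move: e; rewrite /= (rint_EFin g1) => e.
    have i0 : (0 <= \int[leb]_x (g (a * x + b))%:E)%E by apply: integral_ge0 => x _; rewrite lee_fin.
    rewrite ltey; apply/eqP => h; move: e; rewrite h mulry gtr0_sg// mul1e.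
    by [].
  split => //; have := e; rewrite /= (rint_EFin g1) (rint_EFin i1) -EFinM.
  by move=> [].
have n1 := L1_norm f1.
have p1 : L1 leb (fun x => `|f x| + f x) by exact: L1D.
have [n1' ne] := G _ n1 (fun x => normr_ge0 _).
have p0 x : 0 <= `|f x| + f x by have := ler_norm (- f x); rewrite normrN; lra.
have [p1' pe] := G _ p1 p0.
(* A difference of nonnegative integrable functions, to each of which [G] applies. *)
have fE : f = fun x => (`|f x| + f x) - `|f x| by apply/funext => x; ring.
split.
  have := L1B p1' n1'; congr (L1 _ _); apply/funext => x; ring.
rewrite [in LHS]fE rintB// pe ne -mulrBr -rintB//; congr (_ * _).
by apply: eq_Rintegral => x _; ring.
Qed.

End affine.

(** * Integrability of power weights *)

Section weight.
Variable R : realType.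
Notation leb := (@lebesgue_measure R).

Lemma powR_gt0D (x r s : R) : 0 < x -> x `^ (r + s) = x `^ r * x `^ s.
Proof. by move=> x0; rewrite powRD// (gt_eqF x0) implybT. Qed.

Lemma powR_le1Dsqr (x e : R) : 0 < x -> 0 <= e <= 2 -> x `^ e <= 1 + x ^+ 2.
Proof.
move=> x0 /andP[e0 e2]; have [x1|x1] := leP x 1.
  apply: (@le_trans _ _ 1); last by rewrite lerDl sqr_ge0.
  by rewrite -(powRr0 x); apply: ger_powR => //; rewrite x0.
apply: (@le_trans _ _ (x `^ 2)); first by apply: ler_powR => //; exact: ltW.
by rewrite powR_mulrn ?lerDr// ltW.
Qed.

Lemma measurable_powR_norm (p : R) : measurable_fun setT (fun x : R => `|x| `^ p).
Proof. by apply: (measurableT_comp (measurable_powR p)); exact: normr_measurable. Qed.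

Lemma continuous_inv1Dsqr : continuous (fun y : R => (1 + y ^+ 2)^-1).
Proof.
move=> y; apply: cvgV; first by rewrite gt_eqF// ltr_pwDl// sqr_ge0.
by apply: cvgD; [exact: cvg_cst|exact: exprn_continuous].
Qed.

(** The integrand is the derivative of the arctangent of the [b]-th power of [x], so its integrals
    over the exhausting intervals are at most [pi], and monotone convergence concludes. *)
Let L1_half (b : R) : 0 < b ->
  L1 leb ((fun x : R => (1 + (x `^ b) ^+ 2)^-1 * (b * x `^ (b - 1))) \_ `]0, +oo[).
Proof.
move=> b0; pose g (x : R) := (1 + (x `^ b) ^+ 2)^-1 * (b * x `^ (b - 1)).
have mg : measurable_fun setT g.
  apply: measurable_funM; last by apply: measurable_funM => //; exact: measurable_powR.
  apply: (measurableT_comp (f := fun y : R => (1 + y ^+ 2)^-1)); last exact: measurable_powR.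
  exact: measurable_cont continuous_inv1Dsqr.
have g0 x : 0 <= g x.
  by rewrite mulr_ge0 ?invr_ge0 ?addr_ge0 ?sqr_ge0// mulr_ge0 ?powR_ge0// ltW.
pose F (n : nat) := `[n.+2%:R^-1, n.+2%:R]%classic : set R.
have mF n : measurable (F n) by exact: measurable_itv.
have FE : \bigcup_n F n = `]0, +oo[%classic.
  apply/seteqP; split => x /=.
    by move=> [n _]; rewrite /F /= !in_itv /= andbT => /andP[+ _]; apply: lt_le_trans.
  rewrite in_itv /= andbT => x0.
  pose N := Num.truncn (x + x^-1).
  have xN : x + x^-1 < N.+2%:R.
    by apply: lt_trans (truncnS_gt _) _; rewrite ltr_nat.
  have xi : 0 < x^-1 by rewrite invr_gt0.
  exists N => //; rewrite /F /= in_itv /=; apply/andP; split; last by lra.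
  by rewrite -[leRHS]invrK lef_pV2 ?posrE ?invr_gt0 ?ltr0n//; lra.
have bound n : (\int[leb]_(x in F n) (g x)%:E <= pi%:E)%E.
  have n1 : (n.+2%:R^-1 : R) < n.+2%:R.
    by apply: (@lt_trans _ _ 1); rewrite ?invf_lt1 ?ltr1n// ltr0n.
  have p0 : 0 < (n.+2%:R^-1 : R) by rewrite invr_gt0 ltr0n.
  have dF (x : R) : 0 < x -> is_derive x (1 : R) (fun x => atan (x `^ b)) (g x).
    move=> x0; exact: (is_derive1_comp (is_derive1_atan _) (is_derive1_powR b x0)).
  have cF (x : R) : 0 < x -> {for x, continuous (fun x => atan (x `^ b))}.
    move=> x0; apply/differentiable_continuous/derivable1_diffP.
    exact: (@ex_derive _ _ _ _ _ _ _ (dF x x0)).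
  have cp (x e : R) : 0 < x -> {for x, continuous (fun x : R => x `^ e)}.
    move=> x0; apply/differentiable_continuous/derivable1_diffP.
    exact: (@ex_derive _ _ _ _ _ _ _ (is_derive1_powR e x0)).
  rewrite /F (@continuous_FTC2 _ g (fun x => atan (x `^ b)))//.
  - rewrite -EFinB lee_fin.
    have := atan_gtNpi2 (n.+2%:R^-1 `^ b : R); have := atan_ltpi2 (n.+2%:R `^ b : R); lra.
  - apply: continuous_in_subspaceT => x; rewrite inE /= in_itv /= => /andP[h1 _].
    have x0 := lt_le_trans p0 h1.
    apply: cvgM; last by apply: cvgM; [exact: cvg_cst|exact: cp].
    apply: (@continuous_comp _ _ _ (fun x : R => x `^ b) (fun y : R => (1 + y ^+ 2)^-1)).
      exact: cp.
    exact: continuous_inv1Dsqr.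
  - split.
    + move=> x; rewrite in_itv /= => /andP[h1 _].
      exact: (@ex_derive _ _ _ _ _ _ _ (dF x (lt_trans p0 h1))).
    + by apply: cvg_at_right_filter; exact: cF.
    + by apply: cvg_at_left_filter; apply: cF; exact: lt_trans n1.
  - move=> x; rewrite in_itv /= => /andP[h1 _]; rewrite derive1E.
    exact: (@derive_val _ _ _ _ _ _ _ (dF x (lt_trans p0 h1))).
have lim := @ge0_nondecreasing_set_cvg_integral _ (measurableTypeR R) R F (EFin \o g) leb.
have {}lim : (\int[leb]_(x in F i) (g x)%:E)%E @[i --> \oo] --> (\int[leb]_(x in \bigcup_i F i) (g x)%:E)%E.
  apply: lim => //.
  - move=> m n mn; apply/subsetPset => x; rewrite /F /= !in_itv /= => /andP[h1 h2].
    have mn' : (m.+2%:R : R) <= n.+2%:R by rewrite ler_nat.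
    rewrite (le_trans h2 mn') andbT; apply: le_trans h1.
    by rewrite lef_pV2 ?posrE ?ltr0n.
  - by move=> i; apply/measurable_EFinP; exact: measurable_funTS.
  - by move=> i x _; rewrite /= lee_fin.
apply/integrableP; split; first by apply/measurable_EFinP; exact: measurable_patch.
apply: (@le_lt_trans _ _ (\int[leb]_(x in `]0%R, +oo[) (g x)%:E)%E).
  rewrite le_eqVlt; apply/orP; left; apply/eqP.
  rewrite [RHS]integral_mkcond; apply: eq_integral => x _ /=; rewrite !patchE.
  by case: ifP => _; rewrite ?normr0//= ger0_norm// g0.
rewrite -FE; apply: (@le_lt_trans _ _ pi%:E); last exact: ltry.
apply: (cvge_to_le lim); exact: nearW.
Qed.

(** On each half-line the weight is dominated by the integrand of [L1_half]. With [b = 1 - |p|] the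
    exponents [p + 1 - b] and [p + 1 + b] lie in [[0, 2]], so both powers are at most [1 + x^2];
    hence the 2 in the constant [2 / b]. *)
Lemma L1_weight (p : R) : -1 < p < 1 -> L1 leb (fun x : R => (1 + x ^+ 2)^-1 * `|x| `^ p).
Proof.
move=> /andP[p1 p2]; pose b := 1 - `|p|.
have pn : `|p| < 1 by rewrite ltr_norml p1.
have b0 : 0 < b by rewrite subr_gt0.
have hb := L1_half b0; set g := (X in X \_ _) in hb.
have [hb' _] : L1 leb (fun x => (g \_ `]0, +oo[) (- x)) /\ True.
  split => //; apply/integrableP; split.
    apply/measurable_EFinP; apply: measurableT_comp; first exact: L1_meas hb.
    exact: oppr_measurable.
  move/integrableP : (hb) => [mh]; set G := g \_ _ => fin.
  have e : (\int[leb]_x `|(G x)%:E| = \int[leb]_x `|(G (- x))%:E|)%E.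
    apply: (ge0_integral_opp (f := fun x => `|(G x)%:E|%E)) => //.
    exact: measurableT_comp mh.
  by rewrite e in fin.
(* The half-lines miss the point 0, where the weight is 1 if [p = 0]. *)
have i0 : L1 leb (\1_[set 0] : R -> R).
  apply/integrableP; split; first by apply/measurable_EFinP; exact: measurable_indic.
  under eq_integral do rewrite /= ger0_norm//.
  rewrite integral_indic// setIT.
  by apply: (@le_lt_trans _ _ 0%E) => //; rewrite le_eqVlt; apply/orP; left; apply/eqP; exact: lebesgue_measure_set1.
apply: (L1_le _ (L1D i0 (L1Z (2 / b) (L1D hb hb')))).
  by apply: measurable_funM; [exact: measurable_cont continuous_inv1Dsqr|exact: measurable_powR_norm].
have g0 x : 0 <= (g \_ `]0, +oo[) x.
  rewrite patchE; case: ifP => // _.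
  by rewrite mulr_ge0 ?invr_ge0 ?addr_ge0 ?sqr_ge0// mulr_ge0 ?powR_ge0// ltW.
have pos (x : R) : 0 < x -> (1 + x ^+ 2)^-1 * x `^ p <= 2 / b * g x.
  move=> x0; rewrite /g.
  have d1 : 0 < 1 + x ^+ 2 by rewrite ltr_pwDl// sqr_ge0.
  have d2 : 0 < 1 + x `^ b ^+ 2 by rewrite ltr_pwDl// sqr_ge0.
  rewrite (_ : 2 / b * _ = (1 + x `^ b ^+ 2)^-1 * (2 * x `^ (b - 1))); last by field; rewrite !gt_eqF.
  rewrite [leLHS]mulrC [leRHS]mulrC ler_pdivrMr// mulrAC ler_pdivlMr//.
  have -> : x `^ p = x `^ (p + 1 - b) * x `^ (b - 1).
    by rewrite -powR_gt0D//; congr (_ `^ _); ring.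
  rewrite (mulrAC _ (x `^ (b - 1))) (mulrAC 2) ler_pM2r ?powR_gt0// mulrDr mulr1.
  have -> : x `^ (p + 1 - b) * x `^ b ^+ 2 = x `^ (p + 1 + b).
    by rewrite expr2 -!powR_gt0D//; congr (_ `^ _); ring.
  have := ler_norm p; have := ler_norm (- p); rewrite normrN => q1 q2.
  have e1 : x `^ (p + 1 - b) <= 1 + x ^+ 2 by apply: powR_le1Dsqr => //; rewrite /b; lra.
  have e2 : x `^ (p + 1 + b) <= 1 + x ^+ 2 by apply: powR_le1Dsqr => //; rewrite /b; lra.
  lra.
have c0 : 0 <= 2 / b by rewrite divr_ge0// ltW.
move=> x; rewrite ger0_norm; last by rewrite mulr_ge0 ?powR_ge0 ?invr_ge0 ?addr_ge0 ?sqr_ge0.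
have [xn|xp|->] := ltgtP x 0.
- rewrite ltr0_norm// -sqrrN; apply: (le_trans (pos _ _)); first by rewrite oppr_gt0.
  have -> : g (- x) = (g \_ `]0, +oo[) (- x).
    by rewrite patchE mem_set// /= in_itv /= oppr_gt0 xn.
  have := g0 x; rewrite indicE memNset ?add0r; last by move=> /= e; rewrite e ltxx in xn.
  by move=> ?; rewrite ler_wpM2l// lerDr.
- rewrite gtr0_norm//; apply: (le_trans (pos _ xp)).
  have -> : g x = (g \_ `]0, +oo[) x by rewrite [RHS]patchE mem_set// /= in_itv /= xp.
  have := g0 (- x); rewrite indicE memNset ?add0r; last by move=> /= e; rewrite e ltxx in xp.
  by move=> ?; rewrite ler_wpM2l// lerDl.
- rewrite indicE mem_set// expr0n addr0 invr1 mul1r normr0.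
  apply: ler_wpDr; first by apply: mulr_ge0 => //; exact: addr_ge0.
  by have [->|pn0] := eqVneq p 0; [rewrite powRr0|rewrite powR0// ler01].
Qed.

End weight.

(** * Pathwise integrals *)

Lemma measurable_fun_fine d (T : measurableType d) (R : realType) (f : T -> \bar R) :
  measurable_fun setT f -> measurable_fun setT (fun w => fine (f w)).
Proof. exact: (measurableT_comp (fine_measurable measurableT)). Qed.

Section pathwise_integral.
Context d (T : measurableType d) (R : realType) (P : probability T R).
Notation leb := (@lebesgue_measure R).
Notation TR := (T * measurableTypeR R)%type.

Lemma L2_ae (X X' : T -> R) : measurable_fun setT X -> L2 P X' ->
  {ae P, forall w, X w = X' w} -> L2 P X /\ ip P X X = ip P X' X'.
Proof.
move=> mX [mX' X'2] ae.
have m (Y : T -> R) : measurable_fun setT Y -> measurable_fun setT (fun w => (Y w ^+ 2)%:E).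
  by move=> mY; apply/measurable_EFinP; exact: measurable_funX.
have e : (\int[P]_w (X w ^+ 2)%:E = \int[P]_w (X' w ^+ 2)%:E)%E.
  apply: ae_eq_integral => //; [exact: m|exact: m|].
  by apply: filterS ae => w ->.
split; last by rewrite /ip /Rintegral; congr fine; exact: e.
split => //; apply/integrableP; split; first exact: m.
have /integrableP[_] := X'2.
under eq_integral do rewrite /= ger0_norm ?sqr_ge0//.
by under [X in _ -> (X < _)%E]eq_integral do rewrite /= ger0_norm ?sqr_ge0//; rewrite e.
Qed.

Lemma measurable_Rintegral_param (f : TR -> R) : measurable_fun setT f ->
  measurable_fun setT (fun w => \int[leb]_t f (w, t)).
Proof.
move=> mf; rewrite /Rintegral.
have mfE : measurable_fun setT (EFin \o f) by exact/measurable_EFinP.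
apply: measurable_fun_fine.
rewrite (_ : (fun w => _) = (fun w => \int[leb]_t ((EFin \o f)^\+ (w, t)) - \int[leb]_t ((EFin \o f)^\- (w, t)))%E).
  apply: emeasurable_funB.
    exact: (measurable_fun_fubini_tonelli_F (m2 := leb) ((EFin \o f)^\+%E)
      (measurable_funepos mfE) (funepos_ge0 _)).
  exact: (measurable_fun_fubini_tonelli_F (m2 := leb) ((EFin \o f)^\-%E)
    (measurable_funeneg mfE) (funeneg_ge0 _)).
apply/funext => w; rewrite integralE; congr (_ - _)%E.
  by apply: eq_integral => t _; rewrite !funeposE.
by apply: eq_integral => t _; rewrite !funenegE.
Qed.

Variable u : R -> R.
Hypothesis u1 : L1 leb u.

(** By Tonelli the mean of the integral of [|u| Y^2] is at most [C] times that of [|u|], so this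
    integral is finite for almost every [w]. There Cauchy-Schwarz with the factors [sqrt |u|] and
    [sqrt |u| |Y|] bounds the square of the path integral; no continuity of paths is involved. *)
Lemma pathwise_L2 (Y : R -> T -> R) (C : R) :
  measurable_fun setT (fun p : TR => Y p.2 p.1) -> 0 <= C ->
  (forall t, u t != 0 -> L2 P (Y t) /\ ip P (Y t) (Y t) <= C) ->
  [/\ L2 P (fun w => \int[leb]_t (u t * Y t w)),
    {ae P, forall w, L1 leb (fun t => u t * Y t w)} &
    ip P (fun w => \int[leb]_t (u t * Y t w)) (fun w => \int[leb]_t (u t * Y t w)) <=
      C * (\int[leb]_t `|u t|) ^+ 2].
Proof.
move=> mY C0 Y2; have mu := L1_meas u1; pose U := \int[leb]_t `|u t|.
have mu' : measurable_fun setT (fun p : TR => u p.2).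
  by apply: (measurableT_comp mu); exact: measurable_snd.
have U0 : 0 <= U by apply: Rintegral_ge0.
pose F (p : TR) := `|u p.2| * Y p.2 p.1 ^+ 2.
have F0 p : 0 <= F p by rewrite mulr_ge0 ?sqr_ge0.
have mF : measurable_fun setT F.
  by apply: measurable_funM; [exact: measurableT_comp|exact: measurable_funX].
have mFE : measurable_fun setT (EFin \o F) by exact/measurable_EFinP.
have mX : measurable_fun setT (fun w => \int[leb]_t (u t * Y t w)).
  apply: (@measurable_Rintegral_param (fun p => u p.2 * Y p.2 p.1)).
  exact: measurable_funM.
pose G w := (\int[leb]_t (F (w, t))%:E)%E.
have mG : measurable_fun setT G.
  by apply: (measurable_fun_fubini_tonelli_F (m2 := leb) (EFin \o F)).
have G0 w : (0 <= G w)%E by apply: integral_ge0 => t _; rewrite lee_fin.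
have iG : (\int[P]_w G w <= (C * U)%:E)%E.
  rewrite /G (fubini_tonelli (m1 := P) (m2 := leb) (EFin \o F))//.
  apply: (@le_trans _ _ (\int[leb]_t (C * `|u t|)%:E)%E); last first.
    rewrite rint_EFin ?rintZ//; first exact: L1_norm.
    by apply: L1Z; exact: L1_norm.
  apply: ge0_le_integral => //.
  - by move=> t _; apply: integral_ge0 => w _; rewrite lee_fin.
  - exact: (measurable_fun_fubini_tonelli_G (m1 := P) (EFin \o F)).
  - by apply/measurable_EFinP; apply: measurable_funM => //; exact: measurableT_comp.
  - move=> t _; have [ut|ut] := eqVneq (u t) 0.
      rewrite ut normr0 mulr0 (_ : (\int[P]_x _)%E = 0%E)// /F /= ut normr0.
      by under eq_integral do rewrite mul0r; rewrite integral0.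
    have [[mYt Yt2] YC] := Y2 t ut.
    rewrite /F /= rint_EFin; last exact: L1Z.
    rewrite rintZ// lee_fin mulrC ler_wpM2r//.
have iGfin : P.-integrable setT G.
  apply/integrableP; split => //; under eq_integral do rewrite gee0_abs//.
  by apply: (le_lt_trans iG); exact: ltry.
have aeG : {ae P, forall w, G w \is a fin_num}.
  by have := integrable_ae measurableT iGfin; apply: filterS => w; exact.
have good w : G w \is a fin_num -> L1 leb (fun t => u t * Y t w) /\
    (\int[leb]_t (u t * Y t w)) ^+ 2 <= U * fine (G w).
  move=> Gw; have mYw : measurable_fun setT (fun t => Y t w).
    exact: (measurableT_comp mY (pair1_measurable w)).
  have F1 : L1 leb (fun t => F (w, t)).
    apply/integrableP; split.
      exact: (measurableT_comp mFE (pair1_measurable w)).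
    apply: (@le_lt_trans _ _ (G w)); last by rewrite -ge0_fin_numE.
    rewrite le_eqVlt; apply/orP; left; apply/eqP.
    by apply: eq_integral => t _; rewrite /= ger0_norm.
  pose f t := Num.sqrt `|u t|; pose g t := Num.sqrt `|u t| * `|Y t w|.
  have mf : measurable_fun setT f.
    apply: (measurableT_comp (measurable_cont (@sqrt_continuous R))).
    exact: measurableT_comp.
  have ff t : f t ^+ 2 = `|u t| by rewrite sqr_sqrtr.
  have gg t : g t ^+ 2 = F (w, t).
    by rewrite /g exprMn ff /F /= real_normK ?num_real.
  have fg t : f t * g t = `|u t * Y t w| by rewrite /g mulrA -expr2 ff normrM.
  have f2 : L2 leb f.
    by split => //; rewrite (funext ff); exact: L1_norm.
  have g2 : L2 leb g.
    split; last by rewrite (funext gg).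
    by apply: measurable_funM => //; exact: measurableT_comp.
  have fg1 := L2_mul f2 g2; rewrite (funext fg) in fg1.
  have uY1 : L1 leb (fun t => u t * Y t w) by apply: (L1_le _ fg1) => //; exact: measurable_funM.
  split => //.
  have := cauchy_schwarz f2 g2; rewrite /ip.
  under eq_Rintegral do rewrite fg.
  under [X in _ <= X * _ -> _]eq_Rintegral do rewrite -expr2 ff.
  under [X in _ <= _ * X -> _]eq_Rintegral do rewrite -expr2 gg.
  apply: le_trans; rewrite -(real_normK (num_real (\int[leb]_t (u t * Y t w)))) lerXn2r ?nnegrE//.
    exact: Rintegral_ge0.
  exact: rint_norm.
pose Gr w := fine (G w).
have eG : (\int[P]_w (Gr w)%:E = \int[P]_w G w)%E.
  apply: ae_eq_integral => //.
    by apply/measurable_EFinP; exact: measurable_fun_fine.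
  by apply: filterS aeG => w Gw _; rewrite fineK.
have mGr : measurable_fun setT Gr by exact: measurable_fun_fine.
have Gr0 w : 0 <= Gr w by exact: fine_ge0.
have Gr1 : L1 P Gr.
  apply/integrableP; split; first exact/measurable_EFinP.
  under eq_integral do rewrite /= ger0_norm//.
  by rewrite eG; apply: (le_lt_trans iG); exact: ltry.
have GrC : \int[P]_w Gr w <= C * U.
  by rewrite -lee_fin -rint_EFin// eG.
pose X w := \int[leb]_t (u t * Y t w).
pose D := G @^-1` [set x | x \is a fin_num].
have mD : measurable D.
  rewrite -[D]setTI; apply: mG => //.
  rewrite (_ : [set x | _] = ~` [set -oo%E; +oo%E]); last first.
    by apply/seteqP; split => x /=; case: x => //=; [move=> r _ []|move=> []; right|move=> []; left].
  by apply: measurableC; apply: measurableU; exact: emeasurable_set1.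
(* Where [G] is infinite the path integral may be a default value that [Gr] does not dominate; the
   truncation obeys the bound everywhere and differs from [X] on a null set only. *)
pose X' := X \_ D.
have X'X w : D w -> X' w = X w by move=> Dw; rewrite /X' patchE mem_set.
have mX' : measurable_fun setT X' by exact: measurable_patch.
have X'le w : X' w ^+ 2 <= U * Gr w.
  rewrite /X' patchE; case: ifPn => [|_]; last by rewrite expr0n mulr_ge0.
  by rewrite inE => Dw; case: (good w Dw).
have X'2 : L2 P X'.
  split => //; apply: (L1_le _ (L1Z U Gr1)); first exact: measurable_funX.
  by move=> w; rewrite ger0_norm ?sqr_ge0.
have aeX : {ae P, forall w, X w = X' w} by apply: filterS aeG => w Gw; rewrite X'X.
have [X2 XE] := L2_ae mX X'2 aeX.
split => //; first by apply: filterS aeG => w Gw; case: (good w Gw).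
rewrite XE /ip; under eq_Rintegral do rewrite -expr2.
apply: (@le_trans _ _ (\int[P]_w (U * Gr w))).
  by apply: rint_le => //; [case: X'2|exact: L1Z].
by rewrite rintZ// [leRHS](_ : _ = U * (C * U)) ?ler_wpM2l//; rewrite /U; ring.
Qed.

End pathwise_integral.

(** * Riemann sums of path integrals *)

Section riemann.
Context d (T : measurableType d) (R : realType) (P : probability T R).
Notation leb := (@lebesgue_measure R).
Variables (M N : nat).

(** Mesh [1 / (N + 1)] on [[-M, M]]; the cells are half-open, so one extra cell, starting at [M],
    covers the right endpoint. *)
Definition grid_size : nat := (2 * M * N.+1).+1.
Definition grid_pt (i : 'I_grid_size) : R := - M%:R + i%:R / N.+1%:R.
Definition grid_cell (i : 'I_grid_size) : set R :=
  `[grid_pt i, grid_pt i + N.+1%:R^-1[%classic.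

Lemma grid_pick (t : R) : `|t| <= M%:R -> exists i : 'I_grid_size,
  [/\ forall g : 'I_grid_size -> R, \sum_j \1_(grid_cell j) t * g j = g i,
      `|t - grid_pt i| <= N.+1%:R^-1 & `|grid_pt i| <= M%:R].
Proof.
move=> tM; have /andP[t1 t2] : - M%:R <= t <= M%:R by rewrite -ler_norml.
have N0 : 0 < (N.+1%:R : R) by rewrite ltr0n.
pose y := (t + M%:R) * N.+1%:R.
have y0 : 0 <= y by rewrite mulr_ge0//; lra.
have /andP[k1 k2] := truncn_itv y0.
set k := Num.truncn y in k1 k2.
have ky (j : nat) : (t \in `[- M%:R + j%:R / N.+1%:R, - M%:R + j%:R / N.+1%:R + N.+1%:R^-1[) = (j == k).
  have -> : (t \in `[- M%:R + j%:R / N.+1%:R, - M%:R + j%:R / N.+1%:R + N.+1%:R^-1[) = (j%:R <= y < j.+1%:R).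
    rewrite in_itv /=; congr andb.
      by rewrite -(ler_pM2r N0) -/y mulrDl divfK ?gt_eqF// /y mulrDl; apply/idP/idP => ?; lra.
    rewrite -(ltr_pM2r N0) !mulrDl divfK ?gt_eqF// mulVf ?gt_eqF// /y mulrDl -natr1.
    by apply/idP/idP => ?; lra.
  apply/idP/eqP => [/andP[j1 j2]|->]; last by rewrite k1.
  apply/eqP; rewrite eqn_leq -ltnS -[(k <= j)%N]ltnS -!(ltr_nat R).
  by rewrite (le_lt_trans j1 k2) (le_lt_trans k1 j2).
have kL : (k < grid_size)%N.
  rewrite /grid_size ltnS -(ler_nat R); apply: (le_trans k1).
  by rewrite /y !natrM ler_pM2r//; lra.
have cE (j : 'I_grid_size) : (t \in grid_cell j) = (val j == k) by rewrite /grid_cell mem_setE ky.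
exists (Ordinal kL); split.
- move=> g; rewrite (bigD1 (Ordinal kL))//= indicE cE eqxx mul1r.
  rewrite big1 ?addr0// => j jk; rewrite indicE cE.
  by rewrite (_ : (_ == _) = false) ?mul0r//; apply/negbTE.
- have := ky k; rewrite eqxx in_itv /= => /andP[h1 h2].
  have Ni : 0 < (N.+1%:R^-1 : R) by rewrite invr_gt0.
  move: h1 h2; rewrite -[- M%:R + _]/(grid_pt (Ordinal kL)).
  move: (grid_pt _) => p; move: (N.+1%:R^-1) Ni => q q0 h1 h2.
  by rewrite ler_norml; apply/andP; split; lra.
- have := ky k; rewrite eqxx in_itv /= => /andP[h1 h2].
  have h3 : grid_pt (Ordinal kL) <= t := h1.
  by rewrite ler_norml (le_trans h3 t2) andbT /grid_pt lerDl divr_ge0.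
Qed.

Lemma measurable_grid_cell i : measurable (grid_cell i).
Proof. exact: measurable_itv. Qed.

Variable u : R -> R.
Hypotheses (u1 : L1 leb u) (uM : forall t, u t != 0 -> `|t| <= M%:R).

(** The weights are integrals of [u] over the cells rather than samples of [u], which is merely
    integrable; the Riemann sum is then exactly the integral of [u] against a step function. *)
Definition cell_mass i : R := \int[leb]_t (\1_(grid_cell i) t * u t).

Let L1_cell i : L1 leb (fun t => \1_(grid_cell i) t * u t).
Proof.
apply: (L1_le _ (L1_norm u1)); last first.
  by move=> t; rewrite normrM indicE; case: (_ \in _); rewrite ?normr1 ?mul1r ?normr0 ?mul0r.
apply: measurable_funM; last exact: L1_meas u1.
by apply: measurable_indic; exact: measurable_grid_cell.
Qed.

Lemma riemann_sumE (g : 'I_grid_size -> R) :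
  \sum_i cell_mass i * g i = \int[leb]_t (u t * \sum_i \1_(grid_cell i) t * g i).
Proof.
rewrite (_ : \int[leb]_t _ = \int[leb]_t (\sum_i g i * (\1_(grid_cell i) t * u t))); last first.
  apply: eq_Rintegral => t _; rewrite mulr_sumr; apply: eq_bigr => i _; ring.
rewrite rint_sum; last by move=> i; exact: L1Z.
by apply: eq_bigr => i _; rewrite rintZ// mulrC.
Qed.

Let mstep (g : 'I_grid_size -> R) : measurable_fun setT (fun t : R => \sum_i \1_(grid_cell i) t * g i).
Proof. by apply: measurable_sum => i; apply: measurable_funM => //; apply: measurable_indic; exact: measurable_grid_cell. Qed.

Lemma riemann_sum_bound (g : 'I_grid_size -> R) (C : R) :
  (forall i, `|grid_pt i| <= M%:R -> `|g i| <= C) ->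
  `|\sum_i cell_mass i * g i| <= C * \int[leb]_t `|u t|.
Proof.
move=> gC; rewrite riemann_sumE.
have bnd t : `|u t * \sum_i \1_(grid_cell i) t * g i| <= C * `|u t|.
  rewrite normrM; have [->|ut] := eqVneq (u t) 0; first by rewrite normr0 mulr0 mul0r.
  have [i [-> _ iM]] := grid_pick (uM ut).
  by rewrite mulrC ler_wpM2r// gC.
have i1 : L1 leb (fun t => u t * \sum_i \1_(grid_cell i) t * g i).
  apply: (L1_le _ (L1Z C (L1_norm u1))) => //.
  by apply: measurable_funM; [exact: L1_meas u1|exact: mstep].
apply: (le_trans (rint_norm i1)); rewrite -rintZ; last exact: L1_norm.
by apply: rint_le => //; [exact: L1_norm|apply: L1Z; exact: L1_norm].
Qed.

Lemma riemann_sum_error (g : R -> R) (k : R) :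
  (forall x y, `|g x - g y| <= k * `|x - y|) -> L1 leb (fun t => u t * g t) -> 0 <= k ->
  `|\sum_i cell_mass i * g (grid_pt i) - \int[leb]_t (u t * g t)| <=
    k * (\int[leb]_t `|u t|) * N.+1%:R^-1.
Proof.
move=> gk ug1 k0; rewrite (riemann_sumE (fun i => g (grid_pt i))).
have bnd t : `|u t * \sum_i \1_(grid_cell i) t * g (grid_pt i) - u t * g t| <= k * N.+1%:R^-1 * `|u t|.
  rewrite -mulrBr normrM; have [->|ut] := eqVneq (u t) 0; first by rewrite normr0 mulr0 mul0r.
  have [i [-> ti _]] := grid_pick (uM ut).
  rewrite mulrC ler_wpM2r//; apply: (le_trans (gk _ _)); rewrite distrC.
  exact: ler_wpM2l.
have mug := L1_meas ug1.
have i2 : L1 leb (fun t => u t * \sum_i \1_(grid_cell i) t * g (grid_pt i) - u t * g t).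
  apply: (L1_le _ (L1Z (k * N.+1%:R^-1) (L1_norm u1))) => //.
  by apply: measurable_funB => //; apply: measurable_funM; [exact: L1_meas u1|exact: mstep].
have i1 : L1 leb (fun t => u t * \sum_i \1_(grid_cell i) t * g (grid_pt i)).
  by have := L1D i2 ug1; congr (L1 _ _); apply/funext => t; rewrite subrK.
rewrite -rintB//; apply: (le_trans (rint_norm i2)).
apply: (@le_trans _ _ (\int[leb]_t (k * N.+1%:R^-1 * `|u t|))).
  by apply: rint_le => //; [exact: L1_norm|apply: L1Z; exact: L1_norm].
rewrite rintZ; last exact: L1_norm.
by rewrite mulrAC.
Qed.

(** The error is itself a path integral, of the process whose value at [t] is the increment of [Z]
    between [t] and its grid point; [pathwise_L2] applies to it. *)
Lemma riemann_process (Z : R -> T -> R) (C : R) :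
  measurable_fun setT (fun p : T * measurableTypeR R => Z p.2 p.1) ->
  (forall t, L2 P (Z t)) -> 0 <= C ->
  (forall t s, `|t - s| <= N.+1%:R^-1 -> ip P (fun w => Z t w - Z s w) (fun w => Z t w - Z s w) <= C) ->
  {ae P, forall w, L1 leb (fun t => u t * Z t w)} ->
  L2 P (fun w => \int[leb]_t (u t * Z t w)) ->
  ip P (fun w => \sum_i cell_mass i * Z (grid_pt i) w - \int[leb]_t (u t * Z t w))
       (fun w => \sum_i cell_mass i * Z (grid_pt i) w - \int[leb]_t (u t * Z t w)) <= C * (\int[leb]_t `|u t|) ^+ 2.
Proof.
move=> mZ Z2 C0 ZC ae X2.
pose F w := \sum_i cell_mass i * Z (grid_pt i) w - \int[leb]_t (u t * Z t w).
rewrite -/F.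
pose Y t w := \sum_i \1_(grid_cell i) t * Z (grid_pt i) w - Z t w.
have mY : measurable_fun setT (fun p : T * measurableTypeR R => Y p.2 p.1).
  apply: measurable_funB => //; apply: measurable_sum => i; apply: measurable_funM.
    apply: (measurableT_comp (f := \1_(grid_cell i) : measurableTypeR R -> R)); last exact: measurable_snd.
    by apply: measurable_indic; exact: measurable_grid_cell.
  by apply: (measurableT_comp (f := Z (grid_pt i))); [case: (Z2 (grid_pt i))|exact: measurable_fst].
have [|Y2 _ YC] := @pathwise_L2 _ T R P u u1 Y C mY C0.
  move=> t ut; have [i [si ti _]] := grid_pick (uM ut).
  have -> : Y t = fun w => Z (grid_pt i) w - Z t w.
    by apply/funext => w; rewrite /Y (si (fun i => Z (grid_pt i) w)).
  by split; [exact: L2B|apply: ZC; rewrite distrC].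
apply: le_trans YC; rewrite le_eqVlt; apply/orP; left; apply/eqP.
have F2 : L2 P F by apply: L2B => //; apply: L2_sum => i; exact: L2Z.
have [|_ ->//] := @L2_ae _ T R P F _ F2.1 Y2.
apply: filterS ae => w uZ.
rewrite /F (riemann_sumE (fun i => Z (grid_pt i) w)).
have i1 : L1 leb (fun t => u t * \sum_i \1_(grid_cell i) t * Z (grid_pt i) w).
  apply: (L1_le _ (L1Z (\sum_i `|Z (grid_pt i) w|) (L1_norm u1))).
    by apply: measurable_funM; [exact: L1_meas u1|exact: mstep].
  move=> t; rewrite normrM mulrC ler_wpM2r//; apply: le_trans (ler_norm_sum _ _ _) _.
  apply: ler_sum => i _; rewrite normrM indicE.
  by case: (_ \in _); rewrite ?normr1 ?mul1r ?normr0 ?mul0r.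
rewrite -rintB//; apply: eq_Rintegral => t _; rewrite /Y; ring.
Qed.

End riemann.

(** * Path integrals of a process with a spectral density *)

Section process.
Context d (T : measurableType d) (R : realType) (P : probability T R).
Notation leb := (@lebesgue_measure R).
Variables (Z : R -> T -> R) (rho : R -> R).
Hypothesis mZ : measurable_fun setT (fun p : T * measurableTypeR R => Z p.2 p.1).
Hypothesis Z2 : forall t, L2 P (Z t).
Hypothesis mrho : measurable_fun setT rho.
Hypothesis rho1 : L1 leb (fun x => (1 + x ^+ 2)^-1 * `|rho x|).
Hypothesis covZ : forall t s, ip P (Z t) (Z s) = \int[leb]_x (osc t s x * rho x).
Hypothesis concZ : forall m (t : 'I_m -> R) (K : finType) (a : K -> 'I_m -> R),
  sqsum_conc P 8 (fun k w => \sum_i a k i * Z (t i) w).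

Lemma measurable_osc t s : measurable_fun setT (osc t s : R -> R).
Proof.
have mc r : measurable_fun setT (fun x : R => cos (r * x)).
  apply: (measurableT_comp (measurable_cont (@continuous_cos R))); exact: measurable_funM.
have ms r : measurable_fun setT (fun x : R => sin (r * x)).
  apply: (measurableT_comp (measurable_cont (@continuous_sin R))); exact: measurable_funM.
apply: measurable_funM.
  apply: measurable_funD; apply: measurable_funM => //; exact: measurable_funB.
rewrite (_ : (fun x => _) = (fun x => `|x| `^ (- 2))); first exact: measurable_powR_norm.
by apply/funext => x; rewrite powRN powR_mulrn// real_normK// num_real.
Qed.

(* By [osc_bound] every covariance kernel is dominated by a multiple of the
   integrable weight of [rho1]. *)
Lemma L1_dominated (f : R -> R) (C : R) : measurable_fun setT f ->
  (forall x, `|f x| <= C / (1 + x ^+ 2)) -> L1 leb (fun x => f x * rho x).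
Proof.
move=> mf fC; apply: (L1_le _ (L1Z C rho1)); first exact: measurable_funM.
by move=> x; rewrite normrM mulrA ler_wpM2r.
Qed.

Lemma L1_osc t s : L1 leb (fun x => osc t s x * rho x).
Proof. by apply: L1_dominated; [exact: measurable_osc|exact: osc_bound]. Qed.

(** A bound for [|exp(itx) - exp(isx)|^2 / x^2] when [|t - s| <= 1 / (N + 1)]: the cosines, and
    likewise the sines, differ by at most [|x| / (N + 1)] and by at most 2. *)
Definition modulus (N : nat) (x : R) : R :=
  Num.min (2 * (N.+1%:R^-1) ^+ 2) (8 / x ^+ 2).

Lemma modulus_ge0 N x : 0 <= modulus N x.
Proof. by rewrite /modulus le_min mulr_ge0 ?sqr_ge0//= divr_ge0// sqr_ge0. Qed.

Lemma measurable_modulus N : measurable_fun setT (modulus N).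
Proof.
apply: measurable_minr => //; apply: measurable_funM => //.
rewrite (_ : (fun x => _) = (fun x => `|x| `^ (- 2))); first exact: measurable_powR_norm.
by apply/funext => x; rewrite powRN powR_mulrn// real_normK// num_real.
Qed.

Lemma modulus_le N x : `|modulus N x| <= 10 / (1 + x ^+ 2).
Proof.
rewrite ger0_norm ?modulus_ge0//.
have dx : 0 < 1 + x ^+ 2 by rewrite ltr_pwDl// sqr_ge0.
rewrite ler_pdivlMr//.
have m2 : modulus N x <= 2.
  apply: (@le_trans _ _ (2 * (N.+1%:R^-1) ^+ 2)); first by rewrite /modulus ge_min lexx.
  by rewrite -[leRHS]mulr1 ler_pM2l// exprn_ile1 ?invr_ge0// invf_le1// ler1n.
have m8 : modulus N x * x ^+ 2 <= 8.
  have [->|x0] := eqVneq x 0; first by rewrite expr0n mulr0.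
  rewrite -ler_pdivlMr ?exprn_even_gt0//.
  by rewrite /modulus ge_min lexx orbT.
lra.
Qed.

Lemma modulus_cvg0 x : modulus N x @[N --> \oo] --> (0 : R).
Proof.
have h0 : (2 * (N.+1%:R^-1) ^+ 2 : R) @[N --> \oo] --> (2 * (0 ^+ 2) : R).
  by apply: cvgM; [exact: cvg_cst|rewrite !expr2; apply: cvgM; exact: cvg_harmonic].
rewrite expr0n mulr0 in h0.
apply: (squeeze_cvgr _ (cvg_cst 0) h0); apply: nearW => N.
by rewrite modulus_ge0 /= /modulus ge_min lexx.
Qed.

Definition modint (N : nat) : R := \int[leb]_x (modulus N x * `|rho x|).

Let L1_modulus N : L1 leb (fun x => modulus N x * `|rho x|).
Proof.
apply: (L1_le _ (L1Z 10 rho1)).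
  by apply: measurable_funM; [exact: measurable_modulus|exact: measurableT_comp].
by move=> x; rewrite normrM normr_id mulrA ler_wpM2r// modulus_le.
Qed.

Lemma modint_ge0 N : 0 <= modint N.
Proof. by apply: Rintegral_ge0 => x _; rewrite mulr_ge0// modulus_ge0. Qed.

Lemma modint_cvg0 : modint N @[N --> \oo] --> (0 : R).
Proof.
have [|||||_] := @dct _ _ R leb (fun N x => modulus N x * `|rho x|) (fun=> 0)
  (fun x => 10 * ((1 + x ^+ 2)^-1 * `|rho x|)).
- by move=> N; exact: L1_meas (L1_modulus N).
- exact: measurable_cst.
- apply/nearW => x; rewrite -(mul0r `|rho x|); apply: cvgM; last exact: cvg_cst.
  exact: modulus_cvg0.
- exact: L1Z.
- by move=> N x; rewrite normrM normr_id mulrA ler_wpM2r// modulus_le.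
by rewrite rint0.
Qed.

Lemma process_modulus N t s : `|t - s| <= N.+1%:R^-1 ->
  ip P (fun w => Z t w - Z s w) (fun w => Z t w - Z s w) <= modint N.
Proof.
move=> ts; rewrite ip_sub// !covZ -rintZ; last exact: L1_osc.
rewrite -rintB; [|exact: L1_osc|by apply: L1Z; exact: L1_osc].
rewrite -rintD; [|apply: L1B; [exact: L1_osc|by apply: L1Z; exact: L1_osc]|exact: L1_osc].
apply: rint_le => //.
  by apply: L1D; [apply: L1B; [exact: L1_osc|by apply: L1Z; exact: L1_osc]|exact: L1_osc].
move=> x.
have -> : osc t t x * rho x - 2 * (osc t s x * rho x) + osc s s x * rho x =
   (((cos (t * x) - cos (s * x)) ^+ 2 + (sin (t * x) - sin (s * x)) ^+ 2) / x ^+ 2) * rho x.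
  by rewrite /osc; ring.
set V := _ / x ^+ 2.
have V0 : 0 <= V by rewrite divr_ge0 ?sqr_ge0// addr_ge0// sqr_ge0.
have Vm : V <= modulus N x.
  have [x0|x0] := eqVneq x 0; first by rewrite /V x0 expr0n invr0 mulr0 modulus_ge0.
  have x2 : 0 < x ^+ 2 by rewrite exprn_even_gt0.
  have sq (y b : R) : `|y| <= b -> y ^+ 2 <= b ^+ 2.
    by move=> yb; rewrite -(real_normK (num_real y)) lerXn2r// nnegrE (le_trans _ yb).
  rewrite /modulus le_min /V !ler_pdivrMr//; apply/andP; split.
    have c : `|t * x - s * x| <= N.+1%:R^-1 * `|x| by rewrite -mulrBl normrM ler_wpM2r.
    have := sq _ _ (le_trans (lipschitz_cos (t * x) (s * x)) c).
    have := sq _ _ (le_trans (lipschitz_sin (t * x) (s * x)) c).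
    rewrite !exprMn real_normK ?num_real//; move: (N.+1%:R^-1 : R) => q; lra.
  rewrite divfK ?gt_eqF//.
  have n2 (a b : R) : `|a| <= 1 -> `|b| <= 1 -> (a - b) ^+ 2 <= 2 ^+ 2.
    by move=> a1 b1; apply: sq; apply: le_trans (ler_normB _ _) _; lra.
  have := n2 _ _ (norm_cos_le1 (t * x)) (norm_cos_le1 (s * x)).
  have := n2 _ _ (norm_sin_le1 (t * x)) (norm_sin_le1 (s * x)).
  lra.
apply: le_trans (_ : V * `|rho x| <= _); first by rewrite ler_wpM2l// ler_norm.
by rewrite ler_wpM2r.
Qed.

Section one_function.
Variables (M : nat) (u : R -> R).
Hypotheses (u1 : L1 leb u) (uM : forall t, u t != 0 -> `|t| <= M%:R).

Definition pathint (w : T) : R := \int[leb]_t (u t * Z t w).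
Definition riemann (N : nat) (w : T) : R := \sum_(i < grid_size M N) cell_mass u i * Z (grid_pt R i) w.

Let ZC : exists2 C, 0 <= C & forall t, u t != 0 -> L2 P (Z t) /\ ip P (Z t) (Z t) <= C.
Proof.
pose C := \int[leb]_x ((2 * M%:R ^+ 2 + 5) * ((1 + x ^+ 2)^-1 * `|rho x|)).
have C0 : 0 <= C.
  apply: Rintegral_ge0 => x _; rewrite mulr_ge0 ?addr_ge0 ?mulr_ge0 ?sqr_ge0//.
  by rewrite invr_ge0 addr_ge0 ?sqr_ge0.
exists C => // t ut; split => //; rewrite covZ.
apply: le_trans (ler_norm _) _; apply: le_trans (rint_norm (L1_osc t t)) _.
apply: rint_le; [exact: L1_norm (L1_osc t t)|exact: L1Z|move=> x].
rewrite normrM mulrA ler_wpM2r//; apply: le_trans (osc_bound t t x) _.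
rewrite ler_wpM2r ?invr_ge0 ?addr_ge0 ?sqr_ge0// lerD2r ler_pM2l// normrM -expr2.
by rewrite lerXn2r ?nnegrE// uM.
Qed.

Lemma pathint_L2 : L2 P pathint.
Proof. by have [C C0 h] := ZC; have [] := @pathwise_L2 _ T R P u u1 Z C mZ C0 h. Qed.

Lemma pathint_ae : {ae P, forall w, L1 leb (fun t => u t * Z t w)}.
Proof. by have [C C0 h] := ZC; have [] := @pathwise_L2 _ T R P u u1 Z C mZ C0 h. Qed.

Lemma riemann_L2 N : L2 P (riemann N).
Proof. by apply: L2_sum => i; exact: L2Z. Qed.

Lemma riemann_cvg : cvg2 P riemann pathint.
Proof.
have [C C0 h] := ZC; have [X2 ae _] := @pathwise_L2 _ T R P u u1 Z C mZ C0 h.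
have b0 : modint N * (\int[leb]_t `|u t|) ^+ 2 @[N --> \oo] --> (0 * (\int[leb]_t `|u t|) ^+ 2 : R).
  by apply: cvgM; [exact: modint_cvg0|exact: cvg_cst].
rewrite mul0r in b0; apply: (squeeze_cvgr _ (cvg_cst 0) b0); apply: nearW => N.
rewrite ip_ge0 /=; apply: (riemann_process u1 uM mZ Z2 (modint_ge0 N) _ ae X2).
exact: process_modulus.
Qed.

End one_function.

Definition fcos (u : R -> R) (x : R) : R := \int[leb]_t (u t * cos (t * x)).
Definition fsin (u : R -> R) (x : R) : R := \int[leb]_t (u t * sin (t * x)).

Lemma L1_bounded_mul (u g : R -> R) : L1 leb u -> measurable_fun setT g ->
  (forall t, `|g t| <= 1) -> L1 leb (fun t => u t * g t).
Proof.
move=> u1 mg g1; apply: (L1_le _ (L1_norm u1)); first by apply: measurable_funM => //; exact: L1_meas u1.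
by move=> t; rewrite normrM ler_piMr.
Qed.

Lemma measurable_cosM (x : R) : measurable_fun setT (fun t : R => cos (t * x)).
Proof.
apply: (measurableT_comp (measurable_cont (@continuous_cos R))); exact: measurable_funM.
Qed.

Lemma measurable_sinM (x : R) : measurable_fun setT (fun t : R => sin (t * x)).
Proof.
apply: (measurableT_comp (measurable_cont (@continuous_sin R))); exact: measurable_funM.
Qed.

Lemma L1_ucos u x : L1 leb u -> L1 leb (fun t => u t * cos (t * x)).
Proof.
move=> u1; apply: L1_bounded_mul => //; first exact: measurable_cosM.
by move=> t; exact: norm_cos_le1.
Qed.

Lemma L1_usin u x : L1 leb u -> L1 leb (fun t => u t * sin (t * x)).
Proof.
move=> u1; apply: L1_bounded_mul => //; first exact: measurable_sinM.
by move=> t; exact: norm_sin_le1.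
Qed.

Lemma measurable_fcos u : L1 leb u -> measurable_fun setT (fcos u).
Proof.
move=> u1; apply: (@measurable_Rintegral_param _ (measurableTypeR R) R (fun p => u p.2 * cos (p.2 * p.1))).
apply: measurable_funM; first by apply: measurableT_comp => //; exact: L1_meas u1.
apply: (measurableT_comp (measurable_cont (@continuous_cos R))); exact: measurable_funM.
Qed.

Lemma measurable_fsin u : L1 leb u -> measurable_fun setT (fsin u).
Proof.
move=> u1; apply: (@measurable_Rintegral_param _ (measurableTypeR R) R (fun p => u p.2 * sin (p.2 * p.1))).
apply: measurable_funM; first by apply: measurableT_comp => //; exact: L1_meas u1.
apply: (measurableT_comp (measurable_cont (@continuous_sin R))); exact: measurable_funM.
Qed.

Lemma measurable_invsqr : measurable_fun setT (fun x : R => (x ^+ 2)^-1).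
Proof.
rewrite (_ : (fun x => _) = fun x : R => `|x| `^ (- 2)); first exact: measurable_powR_norm.
by apply/funext => x; rewrite powRN powR_mulrn// real_normK ?num_real.
Qed.

Section two_functions.
Variables (M : nat) (u v : R -> R).
Hypotheses (u1 : L1 leb u) (uM : forall t, u t != 0 -> `|t| <= M%:R) (u0 : \int[leb]_t u t = 0).
Hypotheses (v1 : L1 leb v) (vM : forall t, v t != 0 -> `|t| <= M%:R) (v0 : \int[leb]_t v t = 0).

Let cosum (f : R -> R) N x := \sum_(i < grid_size M N) cell_mass f i * (cos (grid_pt R i * x) - 1).
Let sisum (f : R -> R) N x := \sum_(i < grid_size M N) cell_mass f i * sin (grid_pt R i * x).

Let cosum_bound (f : R -> R) N x : L1 leb f -> (forall t, f t != 0 -> `|t| <= M%:R) ->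
  [/\ `|cosum f N x| <= 2 * \int[leb]_t `|f t|, `|sisum f N x| <= 2 * \int[leb]_t `|f t|,
   `|cosum f N x| <= M%:R * `|x| * \int[leb]_t `|f t| &
   `|sisum f N x| <= M%:R * `|x| * \int[leb]_t `|f t|].
Proof.
move=> f1 fM; split; apply: (riemann_sum_bound f1 fM) => i iM.
- exact: norm_cos_sub1_le2.
- by apply: le_trans (norm_sin_le1 _) _; lra.
- by apply: le_trans (norm_cos_sub1_le _) _; rewrite normrM ler_wpM2r.
- by apply: le_trans (norm_sin_le _) _; rewrite normrM ler_wpM2r.
Qed.

Let sum_cvg (f : R -> R) x : L1 leb f -> (forall t, f t != 0 -> `|t| <= M%:R) -> \int[leb]_t f t = 0 ->
  cosum f N x @[N --> \oo] --> fcos f x /\ sisum f N x @[N --> \oo] --> fsin f x.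
Proof.
move=> f1 fM f0.
have aux (F : nat -> R) (l K : R) : 0 <= K -> (forall N, `|F N - l| <= K * N.+1%:R^-1) ->
    F N @[N --> \oo] --> l.
  move=> K0 FK; apply/subr_cvg0/norm_cvg0P.
  have h0 : K * N.+1%:R^-1 @[N --> \oo] --> (K * 0 : R).
    by apply: cvgM; [exact: cvg_cst|exact: cvg_harmonic].
  rewrite mulr0 in h0; apply: (squeeze_cvgr _ (cvg_cst 0) h0); apply: nearW => N.
  by rewrite normr_ge0 FK.
have I0 : 0 <= \int[leb]_t `|f t| by exact: Rintegral_ge0.
split; apply: (aux _ _ (`|x| * \int[leb]_t `|f t|)); rewrite ?mulr_ge0// => N.
(* The zero mean of [f] absorbs the [- 1], so the sums of [cos - 1] converge to [fcos]. *)
- have -> : fcos f x = \int[leb]_t (f t * (cos (t * x) - 1)).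
    rewrite (_ : (fun t => _) = fun t => f t * cos (t * x) - f t); last first.
      by apply/funext => t; ring.
    by rewrite rintB ?f0 ?subr0//; exact: L1_ucos.
  apply: (@riemann_sum_error R M N f f1 fM (fun t => cos (t * x) - 1) `|x|) => //.
    move=> y z; apply: le_trans (_ : `|cos (y * x) - cos (z * x)| <= _).
      by rewrite le_eqVlt; apply/orP; left; apply/eqP; congr (`|_|); ring.
    by apply: le_trans (lipschitz_cos _ _) _; rewrite -mulrBl normrM mulrC.
  have := L1B (L1_ucos x f1) f1; congr (L1 _ _); apply/funext => t; ring.
- apply: (@riemann_sum_error R M N f f1 fM (fun t => sin (t * x)) `|x|) => //.
    by move=> y z; apply: le_trans (lipschitz_sin _ _) _; rewrite -mulrBl normrM mulrC.
  exact: L1_usin.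
Qed.

(** For Riemann sums the covariance is a finite combination of [covZ], and the sums over grid points
    move inside the integral over [x]. Both sides then pass to the limit. The domination follows the
    pattern of [osc_bound]: the numerator is at most [8 U V], and at most [2 M^2 U V x^2]. *)
Lemma pathint_cov : ip P (pathint u) (pathint v) =
  \int[leb]_x ((fcos u x * fcos v x + fsin u x * fsin v x) / x ^+ 2 * rho x).
Proof.
have lim1 := cvg2_ip (riemann_L2 M u) (riemann_L2 M v) (pathint_L2 u1 uM) (pathint_L2 v1 vM)
  (riemann_cvg u1 uM) (riemann_cvg v1 vM).
pose F N x := (cosum u N x * cosum v N x + sisum u N x * sisum v N x) / x ^+ 2 * rho x.
have FE N : F N = fun x => \sum_(i < grid_size M N) \sum_(j < grid_size M N) cell_mass u i * cell_mass v j *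
    (osc (grid_pt R i) (grid_pt R j) x * rho x).
  apply/funext => x; rewrite /F /cosum /sisum.
  under [RHS]eq_bigr => i _ do under eq_bigr => j _ do rewrite /osc.
  rewrite !mulr_suml -big_split !mulr_suml /=; apply: eq_bigr => i _.
  rewrite !mulr_sumr -big_split !mulr_suml /=; apply: eq_bigr => j _; ring.
have F1 N : L1 leb (F N).
  by rewrite FE; do 2 (apply: L1_sum => ?); apply: L1Z; exact: L1_osc.
have ipF N : ip P (riemann M u N) (riemann M v N) = \int[leb]_x F N x.
  rewrite FE rint_sum; last by move=> i; apply: L1_sum => j; apply: L1Z; exact: L1_osc.
  rewrite ip_dsum; try by move=> i; exact: L2Z.
  apply: eq_bigr => i _; rewrite rint_sum; last by move=> j; apply: L1Z; exact: L1_osc.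
  apply: eq_bigr => j _; rewrite rintZ; last exact: L1_osc.
  rewrite ipZl//; last exact: L2Z.
  have -> := @ipZr _ _ R P (cell_mass v j) _ _ (Z2 (grid_pt R j)) (Z2 (grid_pt R i)).
  by rewrite covZ; ring.
rewrite (funext ipF) in lim1.
pose U := \int[leb]_t `|u t|; pose V := \int[leb]_t `|v t|.
have U0 : 0 <= U by exact: Rintegral_ge0.
have V0 : 0 <= V by exact: Rintegral_ge0.
pose K := U * V * (2 * M%:R ^+ 2 + 8).
have K0 : 0 <= K by rewrite mulr_ge0 ?mulr_ge0// addr_ge0// mulr_ge0// sqr_ge0.
have [|||||_ lim2] := @dct _ _ R leb F
  (fun x => (fcos u x * fcos v x + fsin u x * fsin v x) / x ^+ 2 * rho x)
  (fun x => K * ((1 + x ^+ 2)^-1 * `|rho x|)).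
- by move=> N; exact: L1_meas.
- apply: measurable_funM => //; apply: measurable_funM.
    have := measurable_funD (measurable_funM (measurable_fcos u1) (measurable_fcos v1))
      (measurable_funM (measurable_fsin u1) (measurable_fsin v1)); exact.
  exact: measurable_invsqr.
- apply/nearW => x; rewrite /F.
  have [cu su] := sum_cvg x u1 uM u0; have [cv sv] := sum_cvg x v1 vM v0.
  apply: cvgM; last exact: cvg_cst.
  apply: cvgM; last exact: cvg_cst.
  by apply: cvgD; exact: cvgM.
- exact: L1Z.
- move=> N x; rewrite /F normrM mulrA ler_wpM2r//.
  have [x0|x0] := eqVneq x 0.
    by rewrite x0 expr0n invr0 mulr0 normr0 divr_ge0// addr_ge0.
  have x2 : 0 < x ^+ 2 by rewrite exprn_even_gt0.
  have dx : 0 < 1 + x ^+ 2 by rewrite addr_gt0.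
  rewrite normrM (ger0_norm (_ : 0 <= (x ^+ 2)^-1)); last by rewrite invr_ge0 ltW.
  rewrite ler_pdivrMr// mulrAC ler_pdivlMr// mulrDr mulr1.
  have [a1 a2 a3 a4] := cosum_bound N x u1 uM; have [b1 b2 b3 b4] := cosum_bound N x v1 vM.
  have h1 : `|cosum u N x * cosum v N x + sisum u N x * sisum v N x| <= 8 * (U * V).
    apply: le_trans (ler_normD _ _) _; rewrite !normrM.
    have := ler_pM (normr_ge0 _) (normr_ge0 _) a1 b1.
    have := ler_pM (normr_ge0 _) (normr_ge0 _) a2 b2.
    rewrite -/U -/V; lra.
  have h2 : `|cosum u N x * cosum v N x + sisum u N x * sisum v N x| <= 2 * M%:R ^+ 2 * (U * V) * x ^+ 2.
    apply: le_trans (ler_normD _ _) _; rewrite !normrM -(real_normK (num_real x)).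
    have := ler_pM (normr_ge0 _) (normr_ge0 _) a3 b3.
    have := ler_pM (normr_ge0 _) (normr_ge0 _) a4 b4.
    rewrite -/U -/V; lra.
  have h3 := ler_wpM2r (ltW x2) h1.
  rewrite /K; lra.
exact: cvg_unique lim1 lim2.
Qed.

End two_functions.

Lemma pathint_conc (K : finType) (M : nat) (u : K -> R -> R) :
  (forall k, L1 leb (u k)) -> (forall k t, u k t != 0 -> `|t| <= M%:R) ->
  sqsum_conc P 32 (fun k => pathint (u k)).
Proof.
move=> u1 uM; rewrite (_ : 32 = 4 * 8); last by ring.
apply: (@sqsum_conc_lim _ _ _ _ _ _ (fun N k => riemann M (u k) N)).
- by move=> N k; exact: riemann_L2.
- by move=> k; exact: pathint_L2 (u1 k) (uM k).
- by move=> k; exact: riemann_cvg (u1 k) (uM k).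
- by move=> N; exact: concZ.
Qed.

End process.

(** * Wavelet coefficients *)

Section wavelet_atoms.
Variables (R : realType) (psi : R -> R) (M : nat).
Notation leb := (@lebesgue_measure R).
Hypothesis psi1 : L1 leb psi.
Hypothesis psiM : forall t, psi t != 0 -> `|t| <= M%:R.

(** The two factors [s^(-1/2)] of the wavelet transform are combined into one. *)
Definition wavelet_atom (s : nat) (k : int) (t : R) : R := s%:R^-1 * psi (s%:R^-1 * t - k%:~R).

Lemma atom_integral (s : nat) (k : int) (g : R -> R) : (0 < s)%N ->
  L1 leb (fun y => psi y * g (s%:R * (y + k%:~R))) ->
  L1 leb (fun t => wavelet_atom s k t * g t) /\
  \int[leb]_t (wavelet_atom s k t * g t) = \int[leb]_y (psi y * g (s%:R * (y + k%:~R))).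
Proof.
move=> s0; have s0' : 0 < s%:R :> R by rewrite ltr0n.
move=> h; have si : 0 < (s%:R : R)^-1 by rewrite invr_gt0.
have [h1 h2] := L1_affine (- k%:~R) si h.
have E t : psi (s%:R^-1 * t - k%:~R) * g (s%:R * (s%:R^-1 * t - k%:~R + k%:~R)) =
    psi (s%:R^-1 * t - k%:~R) * g t by congr (_ * g _); rewrite subrK mulVKf// gt_eqF.
rewrite (funext E) in h1 h2.
have -> : (fun t => wavelet_atom s k t * g t) =
    (fun t => s%:R^-1 * (psi (s%:R^-1 * t - k%:~R) * g t)).
  by apply/funext => t; rewrite mulrA.
by split; [exact: L1Z|rewrite rintZ// h2].
Qed.

Lemma atom_L1 s k : (0 < s)%N -> L1 leb (wavelet_atom s k).
Proof.
move=> s0; have [|h _] := @atom_integral s k (fun=> 1) s0.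
  by rewrite (_ : (fun y => _) = psi)//; apply/funext => y; rewrite mulr1.
by rewrite (_ : wavelet_atom s k = fun t => wavelet_atom s k t * 1)//; apply/funext => t; rewrite mulr1.
Qed.

Lemma atom_int s k : (0 < s)%N -> \int[leb]_t wavelet_atom s k t = \int[leb]_t psi t.
Proof.
move=> s0; have [|_] := @atom_integral s k (fun=> 1) s0.
  by rewrite (_ : (fun y => _) = psi)//; apply/funext => y; rewrite mulr1.
by under eq_Rintegral do rewrite mulr1; under [RHS]eq_Rintegral do rewrite mulr1.
Qed.

Lemma atom_supp s k : (0 < s)%N ->
  forall t, wavelet_atom s k t != 0 -> `|t| <= (s * (M + `|k|))%:R.
Proof.
move=> s0 t; rewrite /wavelet_atom mulf_eq0 negb_or => /andP[_ /psiM].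
have s0' : 0 < s%:R :> R by rewrite ltr0n.
move=> h; rewrite (_ : t = s%:R * (s%:R^-1 * t - k%:~R + k%:~R)); last first.
  by rewrite subrK mulVKf// gt_eqF.
rewrite normrM (ger0_norm (ltW s0')) natrM ler_pM2l//.
apply: le_trans (ler_normD _ _) _; rewrite natrD lerD//.
by rewrite -intr_norm -abszE.
Qed.

Lemma atom_fcos s k x : (0 < s)%N ->
  fcos (wavelet_atom s k) x = cos (s%:R * k%:~R * x) * fcos psi (s%:R * x)
     - sin (s%:R * k%:~R * x) * fsin psi (s%:R * x).
Proof.
move=> s0; set b := s%:R * k%:~R * x.
have Lc := L1_ucos (s%:R * x) psi1; have Ls := L1_usin (s%:R * x) psi1.
have E y : psi y * cos (s%:R * (y + k%:~R) * x) =
    cos b * (psi y * cos (y * (s%:R * x))) - sin b * (psi y * sin (y * (s%:R * x))).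
  rewrite (_ : _ * _ * x = y * (s%:R * x) + b); last by rewrite /b; ring.
  by rewrite cosD; ring.
rewrite /fcos; have [|_ ->] := @atom_integral s k (fun t => cos (t * x)) s0; rewrite (funext E).
  by apply: L1B; exact: L1Z.
by rewrite rintB ?rintZ//; exact: L1Z.
Qed.

Lemma atom_fsin s k x : (0 < s)%N ->
  fsin (wavelet_atom s k) x = sin (s%:R * k%:~R * x) * fcos psi (s%:R * x)
     + cos (s%:R * k%:~R * x) * fsin psi (s%:R * x).
Proof.
move=> s0; set b := s%:R * k%:~R * x.
have Lc := L1_ucos (s%:R * x) psi1; have Ls := L1_usin (s%:R * x) psi1.
have E y : psi y * sin (s%:R * (y + k%:~R) * x) =
    sin b * (psi y * cos (y * (s%:R * x))) + cos b * (psi y * sin (y * (s%:R * x))).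
  rewrite (_ : _ * _ * x = y * (s%:R * x) + b); last by rewrite /b; ring.
  by rewrite sinD; ring.
rewrite /fsin; have [|_ ->] := @atom_integral s k (fun t => sin (t * x)) s0; rewrite (funext E).
  by apply: L1D; exact: L1Z.
by rewrite rintD ?rintZ//; exact: L1Z.
Qed.

(** The squared modulus of the Fourier transform over [x^2]; this division is the one from [osc], so
    what remains of the OFBM spectrum is [spectral_weight]. *)
Definition fpower (x : R) : R := (fcos psi x ^+ 2 + fsin psi x ^+ 2) / x ^+ 2.

(** A translation by [k] multiplies the Fourier transform by a phase, so the product for [k] and [l]
    depends on [k - l] only; [s^2] compensates for the argument [s x] in the division inside
    [fpower]. *)
Lemma atom_power s k l x : (0 < s)%N ->
  (fcos (wavelet_atom s k) x * fcos (wavelet_atom s l) x +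
   fsin (wavelet_atom s k) x * fsin (wavelet_atom s l) x) / x ^+ 2 =
  s%:R ^+ 2 * (cos (s%:R * x * (k - l)%:~R) * fpower (s%:R * x)).
Proof.
move=> s0; have s0' : s%:R != 0 :> R by rewrite pnatr_eq0 -lt0n.
rewrite !atom_fcos// !atom_fsin// /fpower exprMn intrB.
set C := fcos psi _; set S := fsin psi _.
rewrite (_ : s%:R * x * (k%:~R - l%:~R) = s%:R * k%:~R * x - s%:R * l%:~R * x); last by ring.
rewrite cosB; set ck := cos _; set sk := sin _; set cl := cos _; set sl := sin _.
rewrite (_ : _ + _ = (ck * cl + sk * sl) * (C ^+ 2 + S ^+ 2)); last by ring.
have [->|x0] := eqVneq x 0; first by rewrite expr0n /= !mulr0 invr0 !mulr0.
by field; rewrite s0' x0.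
Qed.

Hypothesis psi0 : \int[leb]_t psi t = 0.

Lemma fcos_sub1 x : fcos psi x = \int[leb]_t (psi t * (cos (t * x) - 1)).
Proof.
rewrite [RHS](_ : _ = \int[leb]_t (psi t * cos (t * x) - psi t)).
  by rewrite rintB// ?psi0 ?subr0//; exact: L1_ucos.
by apply: eq_Rintegral => t _; ring.
Qed.

Lemma psi_int_bound (g : R -> R) (K : R) : measurable_fun setT g -> 0 <= K ->
  (forall t, `|t| <= M%:R -> `|g t| <= K) ->
  L1 leb (fun t => psi t * g t) /\ `|\int[leb]_t (psi t * g t)| <= K * \int[leb]_t `|psi t|.
Proof.
move=> mg K0 gK.
have bnd t : `|psi t * g t| <= K * `|psi t|.
  rewrite normrM mulrC; have [->|pt] := eqVneq (psi t) 0; first by rewrite normr0 !mulr0.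
  by rewrite ler_wpM2r// gK// psiM.
have Kp : L1 leb (fun t => K * `|psi t|) by apply: L1Z; exact: L1_norm.
have L : L1 leb (fun t => psi t * g t).
  by apply: (L1_le _ Kp) => //; apply: measurable_funM => //; exact: L1_meas psi1.
split=> //; apply: le_trans (rint_norm L) _; rewrite -rintZ; last exact: L1_norm.
by apply: rint_le => //; exact: L1_norm.
Qed.

Lemma fpower_bound : exists2 K, 0 <= K & forall x, 0 <= fpower x <= K * (1 + x ^+ 2)^-1.
Proof.
pose U := \int[leb]_t `|psi t|; have U0 : 0 <= U by exact: Rintegral_ge0.
exists ((2 * M%:R ^+ 2 + 5) * U ^+ 2) => [|x].
  by rewrite mulr_ge0 ?sqr_ge0// addr_ge0// mulr_ge0// sqr_ge0.
rewrite divr_ge0 ?addr_ge0 ?sqr_ge0//=.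
have dx : 0 < 1 + x ^+ 2 by rewrite ltr_pwDl// sqr_ge0.
rewrite /fpower; have [->|x0] := eqVneq x 0.
  rewrite expr0n invr0 mulr0 divr_ge0 ?mulr_ge0 ?sqr_ge0 ?addr_ge0//.
have x2 : 0 < x ^+ 2 by rewrite exprn_even_gt0.
rewrite ler_pdivrMr// mulrAC ler_pdivlMr//.
have Mx : 0 <= M%:R * `|x| by rewrite mulr_ge0.
have mc1 : measurable_fun setT (fun t : R => cos (t * x) - 1).
  by apply: measurable_funB => //; exact: measurable_cosM.
have [_ c1] := psi_int_bound mc1 (ler0n R 2)
  (fun t _ => norm_cos_sub1_le2 (t * x)).
have [_ s1] := psi_int_bound (measurable_sinM x) ler01 (fun t _ => norm_sin_le1 (t * x)).
have [|_ c2] := psi_int_bound mc1 Mx.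
  by move=> t tM; apply: le_trans (norm_cos_sub1_le _) _; rewrite normrM ler_wpM2r.
have [|_ s2] := psi_int_bound (measurable_sinM x) Mx.
  by move=> t tM; apply: le_trans (norm_sin_le _) _; rewrite normrM ler_wpM2r.
rewrite -fcos_sub1 -/U in c1 c2; rewrite -/(fsin psi x) -/U in s1 s2.
have sq (y z : R) : `|y| <= z -> y ^+ 2 <= z ^+ 2.
  by move=> yz; rewrite -real_normK ?num_real// lerXn2r ?nnegrE//; apply: le_trans yz.
move: (sq _ _ c1) (sq _ _ s1) (sq _ _ c2) (sq _ _ s2).
rewrite !exprMn real_normK ?num_real// expr1n.
move=> *; rewrite mulrDr mulr1.
have b1 : fcos psi x ^+ 2 + fsin psi x ^+ 2 <= 5 * U ^+ 2 by lra.
have b2 := ler_wpM2r (ltW x2) b1; lra.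
Qed.

End wavelet_atoms.

Section ofbm_wavelet.
Context (R : realType) (n : nat) (H P : 'M[R]_n) (A : 'M[R[i]]_n) (h : 'I_n -> R).
Hypothesis PP : P *m P^T = 1%:M.
Hypothesis HP : H = P *m diag_mx (\row_q h q) *m invmx P.
Hypothesis ImA : map_mx (@complex.Im R) (A *m A ^t*) = 0.
Hypothesis h01 : forall q, 0 < h q < 1.
Context d (T : measurableType d) (Pr : probability T R) (B : R -> T -> 'cV[R]_n).
Hypothesis ofbmB : is_ofbm Pr H A B.
Notation leb := (@lebesgue_measure R).
Notation weight := (spectral_weight P A h).
Notation proj := (ofbm_proj P B).

Lemma measurable_weight c : measurable_fun setT (weight c).
Proof.
apply: measurable_sum => q; apply: measurable_sum => r; apply: measurable_funM => //.
by apply: measurable_funM => //; exact: measurable_powR_norm.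
Qed.

Lemma L1_spectral_weight c : L1 leb (fun x => (1 + x ^+ 2)^-1 * `|weight c x|).
Proof.
have -> : (fun x => (1 + x ^+ 2)^-1 * `|weight c x|) =
   (fun x => `|\sum_q \sum_r (c q * c r * ofbm_cov_matrix P A q r) * ((1 + x ^+ 2)^-1 * `|x| `^ (1 - h q - h r))|).
  apply/funext => x; rewrite -[in LHS](ger0_norm (_ : 0 <= (1 + x ^+ 2)^-1)); last first.
    by rewrite invr_ge0 addr_ge0// sqr_ge0.
  rewrite -normrM; congr (`|_|); rewrite mulr_sumr; apply: eq_bigr => q _.
  by rewrite mulr_sumr; apply: eq_bigr => r _; ring.
apply: L1_norm; apply: L1_sum => q; apply: L1_sum => r; apply: L1Z; apply: L1_weight.
by have := h01 q; have := h01 r; lra.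
Qed.

Lemma measurable_proj c : measurable_fun setT (fun p : T * measurableTypeR R => proj c p.2 p.1).
Proof.
have [_ mB _] := ofbmB.
by apply: measurable_sum => i; apply: measurable_funM => //; exact: mB.
Qed.

Lemma proj_conc c m (t : 'I_m -> R) (K : finType) (a : K -> 'I_m -> R) :
  sqsum_conc Pr 8 (fun k w => \sum_i a k i * proj c (t i) w).
Proof.
have [_ [_ hc]] := ofbm_fdd ofbmB t.
have := hc K (fun k t' i => a k t' * (\sum_q P i q * c q)).
congr (sqsum_conc _ _ _); apply/funext => k; apply/funext => w; apply: eq_bigr => t' _.
by rewrite mulr_sumr; apply: eq_bigr => i _; rewrite mulrA.
Qed.

Variables (psi : R -> R) (M : nat).
Hypothesis psi1 : L1 leb psi.
Hypothesis psiM : forall t, psi t != 0 -> `|t| <= M%:R.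
Hypothesis psi0 : \int[leb]_t psi t = 0.

Definition wavelet_density v y : R := fpower psi y * weight v y.

Lemma measurable_fpower : measurable_fun setT (fpower psi).
Proof.
apply: measurable_funM; last exact: measurable_invsqr.
by apply: measurable_funD; apply: measurable_funX; [exact: measurable_fcos|exact: measurable_fsin].
Qed.

Lemma wavelet_density_L1 v : L1 leb (wavelet_density v).
Proof.
have [K K0 hK] := fpower_bound psi1 psiM psi0.
apply: (L1_le _ (L1Z K (L1_spectral_weight v))).
  by apply: measurable_funM; [exact: measurable_fpower|exact: measurable_weight].
move=> x; have /andP[f0 fK] := hK x.
by rewrite normrM (ger0_norm f0) mulrA ler_wpM2r.
Qed.

(** The autocovariance at lag [z] of the rescaled coefficients in the direction [v]. *)
Definition wavelet_corr v (z : int) : R := \int[leb]_y (cos (z%:~R * y) * wavelet_density v y).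

(* With these coordinates the covariances of the wavelet coefficients of [ofbm_proj] do not depend
   on the scale [s]. *)
Definition scaled_coord (s : nat) (v : 'I_n -> R) (q : 'I_n) : R := s%:R `^ (- h q) * v q.

Lemma weight_scaled s v x : (0 < s)%N -> 
  weight (scaled_coord s v) x = s%:R^-1 * weight v (s%:R * x).
Proof.
move=> s0; rewrite /spectral_weight mulr_sumr; apply: eq_bigr => q _.
rewrite mulr_sumr; apply: eq_bigr => r _; rewrite /scaled_coord.
have s0' : 0 < s%:R :> R by rewrite ltr0n.
rewrite normrM (ger0_norm (ltW s0')) powRM ?(ltW s0')//.
have -> : (s%:R : R) `^ (1 - h q - h r) = s%:R * (s%:R `^ (- h q) * s%:R `^ (- h r)).
  rewrite -powRD ?(gt_eqF s0') ?implybT// -[X in X * _](powRr1 (ltW s0')) -powRD ?(gt_eqF s0') ?implybT//.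
  by congr (_ `^ _); ring.
by field; rewrite gt_eqF.
Qed.

Definition wavelet_coord s v k w := pathint (proj (scaled_coord s v)) (wavelet_atom psi s k) w.

(** The scale drops out: [s^2] from [atom_power] times [s^-1] from [weight_scaled] is the Jacobian
    of the substitution [y = s x]. *)
Lemma wavelet_coord_cov s v k l : (0 < s)%N ->
  ip Pr (wavelet_coord s v k) (wavelet_coord s v l) = wavelet_corr v (k - l).
Proof.
move=> s0; have s0' : 0 < s%:R :> R by rewrite ltr0n.
have mz := measurable_proj (scaled_coord s v).
pose Mk := (s * (M + `|k|) + s * (M + `|l|))%N.
rewrite (@pathint_cov _ _ _ _ _ (weight (scaled_coord s v)) mz (@ofbm_proj_L2 _ _ _ P _ _ _ _ _ ofbmB _)
   (measurable_weight _) (L1_spectral_weight _) (ofbm_proj_cov PP HP ImA ofbmB _) Mk).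
- have L1G : L1 leb (fun y => cos ((k - l)%:~R * y) * wavelet_density v y).
    apply: (L1_le _ (L1_norm (wavelet_density_L1 v))).
      apply: measurable_funM; last exact: L1_meas (wavelet_density_L1 v).
      by apply: (measurableT_comp (measurable_cont (@continuous_cos R))); exact: measurable_funM.
    by move=> y; rewrite normrM ler_piMl// norm_cos_le1.
  rewrite /wavelet_corr; have [h1 ->] := L1_affine 0 s0' L1G; rewrite -rintZ//.
  apply: eq_Rintegral => x _; rewrite atom_power// weight_scaled// addr0 /wavelet_density.
  rewrite (mulrC (k - l)%:~R); field; by rewrite gt_eqF.
- exact: atom_L1.
- by move=> t /(atom_supp psiM s0) ht; apply: le_trans ht _; rewrite ler_nat leq_addr.
- by rewrite atom_int.
- exact: atom_L1.
- by move=> t /(atom_supp psiM s0) ht; apply: le_trans ht _; rewrite ler_nat leq_addl.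
- by rewrite atom_int.
Qed.

Lemma wavelet_coord_conc s v K : (0 < s)%N ->
  sqsum_conc Pr 32 (fun k : 'I_K => wavelet_coord s v k.+1%:Z).
Proof.
move=> s0; apply: (@pathint_conc _ _ _ _ _ (weight (scaled_coord s v))) (measurable_proj _) _ _ _ _ _ _ (s * (M + K))%N _ _ _.
- exact: (@ofbm_proj_L2 _ _ _ P _ _ _ _ _ ofbmB _).
- exact: measurable_weight.
- exact: L1_spectral_weight.
- exact: (ofbm_proj_cov PP HP ImA ofbmB).
- exact: proj_conc.
- by move=> k; exact: atom_L1.
- move=> k t /(atom_supp psiM s0) ht; apply: le_trans ht _; rewrite ler_nat leq_mul2l leq_add2l.
  by rewrite absz_nat ltn_ord orbT.
Qed.

Lemma wavelet_coord_L2 s v k : (0 < s)%N -> L2 Pr (wavelet_coord s v k).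
Proof.
move=> s0; apply: (@pathint_L2 _ _ _ _ (proj (scaled_coord s v)) (weight (scaled_coord s v)) (measurable_proj _)
  (@ofbm_proj_L2 _ _ _ P _ _ _ _ _ ofbmB _) (measurable_weight _) (L1_spectral_weight _) (ofbm_proj_cov PP HP ImA ofbmB _)).
- exact: atom_L1.
- exact: (atom_supp psiM s0).
Qed.

Lemma measurable_wavelet_transform s k i :
  measurable_fun setT (fun w => wavelet_transform psi B s k w i 0).
Proof.
have [_ mB _] := ofbmB.
rewrite (_ : (fun w => _) = (fun w => (Num.sqrt s%:R)^-1 * \int[leb]_t
    ((Num.sqrt s%:R)^-1 * psi (s%:R^-1 * t - k%:~R) * B t w i 0))); last by apply/funext => w; rewrite mxE.
apply: measurable_funM => //.
apply: (@measurable_Rintegral_param _ _ R (fun p => (Num.sqrt s%:R)^-1 * psi (s%:R^-1 * p.2 - k%:~R) * B p.2 p.1 i 0)).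
apply: measurable_funM; last exact: mB.
apply: measurable_funM => //; apply: measurableT_comp; first exact: L1_meas psi1.
by apply: measurable_funB => //; exact: measurable_funM.
Qed.

(** Almost surely only: on the null set where some coordinate of the path is not integrable against
    the atom, the integrals need not be additive. *)
Lemma wavelet_coordE s v k : (0 < s)%N -> {ae Pr, forall w, 
  \sum_q scaled_coord s v q * (P^T *m wavelet_transform psi B s k w) q 0 = wavelet_coord s v k w}.
Proof.
move=> s0; have s0' : 0 < s%:R :> R by rewrite ltr0n.
(* The direction whose coordinates are row [i] of [P] is the [i]-th coordinate of [B], so
   integrability proved for projections holds for every coordinate. *)
have projP i : proj (fun q => P i q) = fun t w => B t w i 0.
  apply/funext => t; apply/funext => w; rewrite /ofbm_proj.
  have E i' : \sum_q P i' q * P i q = (i' == i)%:R.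
    by have := congr1 (fun M : 'M[R]_n => M i' i) PP; rewrite !mxE => <-; apply: eq_bigr => q _; rewrite mxE.
  under eq_bigr => i' _ do rewrite E.
  by rewrite (bigD1 i)//= eqxx mul1r big1 ?addr0// => i' /negbTE ->; rewrite mul0r.
have ae i : {ae Pr, forall w, L1 leb (fun t => wavelet_atom psi s k t * B t w i 0)}.
  have mz := measurable_proj (fun q => P i q).
  have := @pathint_ae _ _ _ _ _ (weight (fun q => P i q)) mz (@ofbm_proj_L2 _ _ _ P _ _ _ _ _ ofbmB _)
   (measurable_weight _) (L1_spectral_weight _) (ofbm_proj_cov PP HP ImA ofbmB _) _ _ 
     (atom_L1 psi1 k s0) (atom_supp psiM s0).
  by rewrite projP.
have : {ae Pr, forall w i, L1 leb (fun t => wavelet_atom psi s k t * B t w i 0)}.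
  exact: filter_forall.
apply: filterS => w Lw.
have Dw i : wavelet_transform psi B s k w i 0 = \int[leb]_t (wavelet_atom psi s k t * B t w i 0).
  rewrite mxE -rintZ.
    apply: eq_Rintegral => t _; rewrite /wavelet_atom !mulrA -invfM -expr2 sqr_sqrtr ?ltW//.
  have := L1Z (Num.sqrt s%:R) (Lw i); congr (L1 _ _); apply/funext => t.
  rewrite /wavelet_atom !mulrA; congr (_ * _ * _).
  rewrite -[X in _ * X^-1](sqr_sqrtr (ltW s0')); field.
  by rewrite gt_eqF// sqrtr_gt0.
rewrite /wavelet_coord /pathint /ofbm_proj.
under [RHS]eq_Rintegral => t _ do rewrite mulr_sumr.
under [RHS]eq_Rintegral => t _ do under eq_bigr => i _ do rewrite mulrCA.
rewrite rint_sum; last by move=> i; exact: L1Z.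
under [RHS]eq_bigr => i _ do rewrite rintZ// -Dw mulr_suml.
rewrite exchange_big; apply: eq_bigr => q _; rewrite mxE mulr_sumr; apply: eq_bigr => i _.
rewrite mxE; ring.
Qed.

End ofbm_wavelet.

(** * Decay of correlations *)

Lemma ae_neq (R : realType) (c : R) : {ae (@lebesgue_measure R), forall y : R, y != c}.
Proof.
exists [set c]; split => //; first exact: lebesgue_measure_set1.
by move=> y /= /negP; rewrite negbK => /eqP.
Qed.

Lemma continuous_powR_norm (R : realType) (p y : R) : y != 0 -> {for y, continuous (fun x : R => `|x| `^ p)}.
Proof.
move=> y0; have y0' : 0 < `|y| by rewrite normr_gt0.
have c : {for y, continuous (fun x : R => expR (p * ln `|x|))}.
  apply: (@continuous_comp _ _ _ (fun x : R => p * ln `|x|) expR); last exact: continuous_expR.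
  apply: cvgM; first exact: cvg_cst.
  apply: (@continuous_comp _ _ _ (fun x : R => `|x|) (@ln R)); last exact: continuous_ln.
  exact: norm_continuous.
have E : `|y| `^ p = expR (p * ln `|y|) by rewrite /powR (gt_eqF y0').
move: c; rewrite /prop_for /continuous_at E; apply: cvg_trans; apply: near_eq_cvg; near=> x.
have x0 : 0 < `|x|.
  near: x; have /cvgr_gt := @norm_continuous _ R^o y; exact.
by rewrite /powR gt_eqF.
Unshelve. all: by end_near. Qed.

Section riemann_lebesgue.
Variables (R : realType) (m : R -> R) (K : R).
Notation leb := (@lebesgue_measure R).
Hypothesis mm : measurable_fun setT m.
Hypothesis mK : forall y, `|m y| <= K * (1 + y ^+ 2)^-1.
Hypothesis mcont : forall y, y != 0 -> {for y, continuous m}.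

Lemma L1_inv1Dsqr : L1 leb (fun y : R => (1 + y ^+ 2)^-1).
Proof.
have := @L1_weight R 0; rewrite ltrN10 ltr01 => /(_ isT); congr (L1 _ _).
by apply/funext => y; rewrite powRr0 mulr1.
Qed.

Let m1 : L1 leb m.
Proof. by apply: (L1_le _ (L1Z K L1_inv1Dsqr)). Qed.

Let cosm1 (f : R -> R) b : L1 leb f -> L1 leb (fun y => cos (b * y) * f y).
Proof.
move=> f1; apply: (L1_le _ (L1_norm f1)).
  apply: measurable_funM; last exact: L1_meas f1.
  by apply: (measurableT_comp (measurable_cont (@continuous_cos R))); exact: measurable_funM.
by move=> y; rewrite normrM ler_piMl// norm_cos_le1.
Qed.

(** A shift by the half period [eta k] changes the sign of the cosine, so the integral is half that
    of the cosine against [m y - m (y + eta k)], which tends to 0 by continuity off 0 and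
    domination. *)
Lemma riemann_lebesgue : \int[leb]_y (cos (k%:R * y) * m y) @[k --> \oo] --> (0 : R).
Proof.
pose eta (k : nat) : R := pi / k.+1%:R.
have eta0 k : 0 <= eta k by rewrite divr_ge0// pi_ge0.
have eta1 k : eta k <= pi by rewrite ler_pdivrMr// ler_peMr ?pi_ge0// ler1n.
pose D k y := `|m y - m (y + eta k)|.
have mshift k : L1 leb (fun y => m (y + eta k)).
  have [+ _] := L1_affine (eta k) ltr01 m1; congr (L1 _ _); apply/funext => y; by rewrite mul1r.
have bnd k : `|\int[leb]_y (cos (k.+1%:R * y) * m y)| <= 2^-1 * \int[leb]_y D k y.
  have [_] := L1_affine (eta k) ltr01 (cosm1 k.+1%:R m1); rewrite mul1r.
  set I := (X in X = _ -> _) => E.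
  have E2 : I = - \int[leb]_y (cos (k.+1%:R * y) * m (y + eta k)).
    rewrite E -[RHS]mulN1r -rintZ; last exact: cosm1.
    apply: eq_Rintegral => y _; rewrite mul1r mulN1r -mulNr -cosDpi; congr (cos _ * _).
    by rewrite /eta mulrDr mulrCA divff ?pnatr_eq0// mulr1.
  have E3 : I = 2^-1 * \int[leb]_y (cos (k.+1%:R * y) * (m y - m (y + eta k))).
    have -> : (fun y : R => cos (k.+1%:R * y) * (m y - m (y + eta k))) =
      (fun y => cos (k.+1%:R * y) * m y - cos (k.+1%:R * y) * m (y + eta k)).
      by apply/funext => y; rewrite mulrBr.
    rewrite rintB; try exact: cosm1.
    by rewrite -/I; move: E2; lra.
  rewrite -/I E3 normrM ger0_norm ?invr_ge0// ler_wpM2l ?invr_ge0//.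
  have LB := L1B m1 (mshift k).
  apply: le_trans (rint_norm (cosm1 _ LB)) _; apply: rint_le; [exact/L1_norm/cosm1|exact: L1_norm|].
  by move=> y; rewrite normrM ler_piMl// norm_cos_le1.
have K0 : 0 <= K by have := mK 0; rewrite expr0n addr0 invr1 mulr1; apply: le_trans.
(* Since [y^2 <= 2 (y + eta k)^2 + 2 pi^2], one has [1 + y^2 <= C (1 + (y + eta k)^2)], and one
   integrable function dominates all the shifts of [m]. *)
pose C := 2 + 2 * pi ^+ 2 : R.
have C0 : 0 < C by rewrite ltr_wpDr// mulr_ge0// sqr_ge0.
have [|||||_ lim] := @dct _ _ R leb D (fun=> 0) (fun y => (K + K * C) * (1 + y ^+ 2)^-1).
- by move=> k; exact: L1_meas (L1_norm (L1B m1 (mshift k))).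
- exact: measurable_cst.
- apply: (@filterS _ _ (ae_filter_ringOfSetsType leb) _ _ _ (ae_neq (0 : R))) => y y0.
  apply/norm_cvg0P; rewrite -[X in _ --> X](subrr (m y)); apply: cvgB; first exact: cvg_cst.
  apply: (@continuous_cvg _ _ _ _ _ _ _ y) => //; first exact: mcont.
  rewrite -[X in _ --> X]addr0; apply: cvgD; first exact: cvg_cst.
  by rewrite -[X in _ --> X](mulr0 pi); apply: cvgM; [exact: cvg_cst|exact: cvg_harmonic].
- by apply: L1Z; exact: L1_inv1Dsqr.
- move=> k y; rewrite normr_id; apply: le_trans (ler_normB _ _) _.
  rewrite mulrDl lerD// -mulrA; apply: le_trans (mK _) _; rewrite ler_wpM2l//.
  have dx (x : R) : 0 < 1 + x ^+ 2 by rewrite ltr_pwDl// sqr_ge0.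
  rewrite ler_pdivlMr// mulrC ler_pdivrMr//.
  have e2 : eta k ^+ 2 <= pi ^+ 2 by rewrite lerXn2r ?nnegrE ?pi_ge0.
  have p2 : 0 <= (pi : R) ^+ 2 by exact: sqr_ge0.
  have q : 0 <= (y + 2 * eta k) ^+ 2 by exact: sqr_ge0.
  have q2 : 0 <= pi ^+ 2 * (y + eta k) ^+ 2 by rewrite mulr_ge0// sqr_ge0.
  rewrite /C; nra.
have h0 : 2^-1 * \int[leb]_y D k y @[k --> \oo] --> (2^-1 * 0 : R).
  by apply: cvgM; [exact: cvg_cst|rewrite rint0 in lim].
rewrite mulr0 in h0; rewrite -(cvg_shiftS (fun k => \int[leb]_y (cos (k%:R * y) * m y))).
apply/norm_cvg0P; apply: (squeeze_cvgr _ (cvg_cst 0) h0); apply: nearW => k.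
by rewrite normr_ge0 bnd.
Qed.

End riemann_lebesgue.

(** * Cesaro means over pairs of locations *)

Section cesaro_double.
Variables (R : realType) (f : nat -> R).
Hypothesis f0 : forall k, 0 <= f k.

(** Each distance is attained by at most [2 K] pairs; the induction adds the last row and the last
    column. *)
Lemma double_sum_dist K : \sum_(k < K) \sum_(l < K) f `|k%:Z - l%:Z|%N <= 2 * K%:R * \sum_(i < K) f i.
Proof.
have sym (k l : nat) : f `|k%:Z - l%:Z|%N = f `|l%:Z - k%:Z|%N by rewrite distnC.
elim: K => [|K IH]; first by rewrite !big_ord0 mulr0.
have E : \sum_(l < K) f `|K%:Z - l%:Z|%N = \sum_(l < K) f l.+1.
  rewrite (reindex_inj rev_ord_inj)/=; apply: eq_bigr => l _; congr f.
  by rewrite distnEl ?leq_subr// subKn.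
have -> : \sum_(k < K.+1) \sum_(l < K.+1) f `|k%:Z - l%:Z|%N =
   \sum_(k < K) \sum_(l < K) f `|k%:Z - l%:Z|%N + 2 * (\sum_(l < K) f l.+1) + f 0%N.
  rewrite big_ord_recr/= big_ord_recr/= distnn E.
  under eq_bigr => k _ do rewrite big_ord_recr/= sym.
  by rewrite big_split/= E; ring.
have F : \sum_(i < K.+1) f i = f 0%N + \sum_(l < K) f l.+1 by rewrite big_ord_recl.
have F2 : \sum_(i < K.+1) f i = \sum_(i < K) f i + f K by rewrite big_ord_recr.
rewrite -[K.+1%:R]natr1 mulrDr mulr1 mulrDl {2}F mulrDr.
have fK := f0 K; have f00 := f0 0%N.
have : 2 * K%:R * \sum_(i < K) f i <= 2 * K%:R * \sum_(i < K.+1) f i.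
  by rewrite ler_wpM2l ?mulr_ge0// F2 lerDl.
lra.
Qed.

Lemma cesaro_double : f k @[k --> \oo] --> (0 : R) ->
  (K%:R ^+ 2)^-1 * \sum_(k < K) \sum_(l < K) f `|k%:Z - l%:Z|%N @[K --> \oo] --> (0 : R).
Proof.
move=> /cesaro ces.
have h0 : 2 * arithmetic_mean f K @[K --> \oo] --> (2 * 0 : R) by apply: cvgM; [exact: cvg_cst|].
rewrite mulr0 in h0; rewrite -cvg_shiftS; apply: (squeeze_cvgr _ (cvg_cst 0) h0); apply: nearW => K.
rewrite mulr_ge0 ?invr_ge0 ?sqr_ge0 ?sumr_ge0//=; last by move=> k _; exact: sumr_ge0.
rewrite /arithmetic_mean /= /series /= big_mkord mulrC ler_pdivrMr ?exprn_gt0//.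
apply: le_trans (double_sum_dist _) _; rewrite le_eqVlt; apply/orP; left; apply/eqP.
by move: (ltr0Sn R K); set x := K.+1%:R => x0; field; rewrite gt_eqF.
Qed.

End cesaro_double.

(** * Decay of the power spectrum of the wavelet *)

Section wavelet_facts.
Variables (R : realType) (N : nat) (psi : R -> R).
Hypothesis wpsi : is_wavelet N psi.
Notation leb := (@lebesgue_measure R).

Lemma wavelet_L1_psi : L1 leb psi.
Proof. exact: wavelet_L1 wpsi. Qed.

Lemma wavelet_bounded : exists M : nat, forall t, psi t != 0 -> `|t| <= M%:R.
Proof.
have [a [b ab]] := wavelet_support wpsi.
exists (Num.truncn (Num.max `|a| `|b|)).+1 => t pt.
have : closure [set t | psi t != 0] t by exact: subset_closure.
rewrite ab /= in_itv/= => /andP[at' tb].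
apply: le_trans (ltW (truncnS_gt _)).
rewrite ler_norml; apply/andP; split.
  rewrite lerNl; apply: le_trans (_ : - a <= _); first by rewrite lerN2.
  by rewrite le_max -normrN ler_norm.
by apply: (le_trans tb); rewrite le_max ler_norm orbT.
Qed.

Lemma wavelet_moment p : (p < N)%N -> \int[leb]_t (t ^+ p * psi t) = 0.
Proof. by move=> /(wavelet_moments wpsi); rewrite /Rintegral => ->. Qed.

Lemma wavelet_int0 : \int[leb]_t psi t = 0.
Proof.
have := wavelet_moment (ltn_trans (ltn0Sn 0) (wavelet_moments_ge2 wpsi)).
by under eq_Rintegral do rewrite expr0 mul1r.
Qed.

Lemma wavelet_int1 : \int[leb]_t (t * psi t) = 0.
Proof.
have := wavelet_moment (wavelet_moments_ge2 wpsi).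
by under eq_Rintegral do rewrite expr1.
Qed.

(** The assumption [alpha > 1] enters as [1 + |x| <= (1 + |x|)^alpha], and
    [1 + x^2 <= (1 + |x|)^2]. *)
Lemma wavelet_power_decay : exists K, forall x,
  fcos psi x ^+ 2 + fsin psi x ^+ 2 <= K * (1 + x ^+ 2)^-1.
Proof.
have [al al1 [K0 hK]] := wavelet_fourier wpsi.
exists (K0 ^+ 2) => x.
have dx : 0 < 1 + x ^+ 2 by rewrite ltr_pwDl// sqr_ge0.
rewrite ler_pdivlMr//.
have : Normc.normc (fourier psi x) * (1 + `|x|) `^ al <= K0 by apply: hK; exists x.
have -> : Normc.normc (fourier psi x) = Num.sqrt (fcos psi x ^+ 2 + fsin psi x ^+ 2).
  rewrite /fourier /= sqrrN /fcos /fsin; congr (Num.sqrt (_ ^+ 2 + _ ^+ 2));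
    by apply: eq_Rintegral => t _; rewrite (mulrC x).
set Q := _ + _; have Q0 : 0 <= Q by rewrite addr_ge0// sqr_ge0.
have x1 : 1 <= 1 + `|x| by rewrite lerDl.
have : 1 + `|x| <= (1 + `|x|) `^ al.
  by rewrite -{1}(powRr1 (le_trans ler01 x1)); apply: ler_powR => //; exact: ltW.
move=> /(ler_wpM2l (sqrtr_ge0 Q)) h /(le_trans h) {}h.
have sq : (Num.sqrt Q * (1 + `|x|)) ^+ 2 <= K0 ^+ 2.
  have q0 : 0 <= Num.sqrt Q * (1 + `|x|) by rewrite mulr_ge0 ?sqrtr_ge0// (le_trans ler01).
  by rewrite lerXn2r ?nnegrE// (le_trans q0).
apply: le_trans sq; rewrite exprMn sqr_sqrtr// ler_wpM2l// sqrrD expr1n real_normK ?num_real//.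
by rewrite mul1r lerD2r lerDl mulrn_wge0.
Qed.

Variable M : nat.
Hypothesis psiM : forall t, psi t != 0 -> `|t| <= M%:R.
Let psi1 := wavelet_L1_psi.
Let psi0 := wavelet_int0.

(** The two vanishing moments allow subtracting [1] from the cosine and [t x] from the sine, and
    both remainders are at most [(t x)^2]. *)
Lemma wavelet_power_small : exists K, forall x,
  fcos psi x ^+ 2 + fsin psi x ^+ 2 <= K * x ^+ 4.
Proof.
pose U := \int[leb]_t `|psi t|; have U0 : 0 <= U by exact: Rintegral_ge0.
exists (2 * (M%:R ^+ 2 * U) ^+ 2) => x.
have Mx : 0 <= M%:R ^+ 2 * x ^+ 2 by rewrite -exprMn sqr_ge0.
have tx (t : R) : `|t| <= M%:R -> (t * x) ^+ 2 <= M%:R ^+ 2 * x ^+ 2.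
  move=> tM; rewrite exprMn ler_wpM2r ?sqr_ge0// -(real_normK (num_real t)).
  by rewrite lerXn2r ?nnegrE.
have [||_ c] := @psi_int_bound _ _ _ psi1 psiM (fun t => cos (t * x) - 1) _ _ Mx.
- by apply: measurable_funB => //; exact: measurable_cosM.
- by move=> t tM; apply: le_trans (norm_cos_sub1_sqr _) _; exact: tx.
have ms : measurable_fun setT (fun t : R => sin (t * x) - t * x).
  by apply: measurable_funB; [exact: measurable_sinM|exact: measurable_funM].
have [|Ls s] := @psi_int_bound _ _ _ psi1 psiM (fun t => sin (t * x) - t * x) _ ms Mx.
  by move=> t tM; apply: le_trans (norm_sin_sub_sqr _) _; exact: tx.
rewrite -(fcos_sub1 psi1 psi0) -/U in c.
have Es : \int[leb]_t (psi t * (sin (t * x) - t * x)) = fsin psi x.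
  have L := L1_usin x psi1; have L2' := L1B L Ls.
  have Ltp : L1 leb (fun t => x * (t * psi t)).
    by move: L2'; congr (L1 _ _); apply/funext => t; ring.
  have Lt : L1 leb (fun t => t * psi t).
    have [||h _] := @psi_int_bound _ _ _ psi1 psiM id M%:R _ (ler0n _ _) => //.
    by move: h; congr (L1 _ _); apply/funext => t; rewrite mulrC.
  rewrite [LHS](_ : _ = \int[leb]_t (psi t * sin (t * x) - x * (t * psi t))).
    by rewrite rintB// rintZ// wavelet_int1 mulr0 subr0.
  by apply: eq_Rintegral => t _; ring.
rewrite Es -/U in s.
have sq (y z : R) : `|y| <= z -> y ^+ 2 <= z ^+ 2.
  by move=> yz; rewrite -real_normK ?num_real// lerXn2r ?nnegrE//; apply: le_trans yz.
apply: le_trans (lerD (sq _ _ c) (sq _ _ s)) _.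
by rewrite le_eqVlt; apply/orP; left; apply/eqP; ring.
Qed.

(** Near 0 the order 4 of the power spectrum outweighs [y^-2] and [|y|^p]; at infinity [y^-4 |y|^p]
    is left. A merely integrable bound would not do: [riemann_lebesgue] needs a dominating function
    that is stable under shifts, hence bounded at 0. *)
Lemma wavelet_power_weight : exists2 K, 0 <= K & forall p y, -1 < p < 1 ->
  fpower psi y * `|y| `^ p <= K * (1 + y ^+ 2)^-1.
Proof.
have [K1 h1] := wavelet_power_small; have [K2 h2] := wavelet_power_decay.
have Q0 y : 0 <= fcos psi y ^+ 2 + fsin psi y ^+ 2 by rewrite addr_ge0// sqr_ge0.
have K10 : 0 <= K1 by have := le_trans (Q0 1) (h1 1); rewrite expr1n mulr1.
have K20 : 0 <= K2 by have := le_trans (Q0 0) (h2 0); rewrite expr0n addr0 invr1 mulr1.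
exists (4 * K1 + 2 * K2); first by rewrite addr_ge0// mulr_ge0.
move=> p y /andP[p0 p1]; rewrite /fpower.
have dy : 0 < 1 + y ^+ 2 by rewrite ltr_pwDl// sqr_ge0.
have [->|y0] := eqVneq y 0.
  by rewrite expr0n invr0 mulr0 mul0r divr_ge0 ?addr_ge0 ?mulr_ge0.
set Q := _ + _ in h1 h2 *.
pose r := `|y|; have r0 : 0 < r by rewrite normr_gt0.
have y2 : y ^+ 2 = r ^+ 2 by rewrite /r real_normK ?num_real.
have y4 : y ^+ 4 = r ^+ 4 by rewrite -[4%N]/(2 * 2)%N !exprM y2.
have := h1 y; have := h2 y; have := Q0 y; rewrite -/Q.
rewrite -/r y4 y2; rewrite y2 in dy; move=> Q1 hQ2 hQ1.
have pw : r `^ p * r <= 1 + r ^+ 2.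
  by rewrite -[X in _ * X](powRr1 (ltW r0)) -powR_gt0D//; apply: powR_le1Dsqr => //; lra.
(* Multiplying by [r^3] clears the negative powers: [r^2] for the division, and one [r] to bring the
   exponent [p + 1] into [[0, 2]]. *)
rewrite ler_pdivlMr// -(ler_pM2r (exprn_gt0 3 r0)).
rewrite (_ : Q / r ^+ 2 * r `^ p * (1 + r ^+ 2) * r ^+ 3 = Q * (1 + r ^+ 2) * (r `^ p * r)); last first.
  by field; rewrite gt_eqF.
have Qd : 0 <= Q * (1 + r ^+ 2) by rewrite mulr_ge0// ltW.
apply: le_trans (ler_wpM2l Qd pw) _.
have [r1|r1] := leP r 1.
  have rr : r ^+ 2 <= 1 by rewrite expr_le1// ltW.
  have s1 : (1 + r ^+ 2) * (1 + r ^+ 2) <= 4.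
    by apply: (@le_trans _ _ (2 * 2)); [apply: ler_pM; rewrite ?(ltW dy)//; lra|lra].
  have s2 : Q * (1 + r ^+ 2) * (1 + r ^+ 2) <= K1 * r ^+ 4 * 4.
    by rewrite -mulrA; apply: ler_pM => //; rewrite mulr_ge0 ?ltW.
  apply: (le_trans s2); have : r ^+ 4 <= r ^+ 3 by rewrite exprS ler_piMl// exprn_ge0// (ltW r0).
  move=> /(ler_wpM2l K10); have : 0 <= K2 * r ^+ 3 by rewrite mulr_ge0 ?exprn_ge0 ?(ltW r0).
  lra.
have : Q * (1 + r ^+ 2) <= K2 by rewrite -ler_pdivlMr.
move=> /(ler_wpM2r (ltW dy)) s2; apply: (le_trans s2).
have : 1 + r ^+ 2 <= 2 * r ^+ 3.
  have a1 : 1 <= r ^+ 3 by rewrite exprn_ege1// ltW.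
  have : r ^+ 2 <= r ^+ 3 by rewrite [leRHS]exprS ler_peMl// ?exprn_ge0 ?(ltW r0)// (ltW r1).
  lra.
move=> /(ler_wpM2l K20); have : 0 <= K1 * r ^+ 3 by rewrite mulr_ge0 ?exprn_ge0 ?(ltW r0).
lra.
Qed.

Lemma lipschitz_continuous (f : R -> R) (K : R) :
  (forall x y, `|f x - f y| <= K * `|x - y|) -> continuous f.
Proof.
move=> fK x; apply/subr_cvg0/norm_cvg0P.
have h0 : K * `|z - x| @[z --> x] --> (K * `|x - x| : R).
  apply: cvgM; first exact: cvg_cst.
  apply: cvg_norm; apply: cvgB; [exact: cvg_id|exact: cvg_cst].
rewrite subrr normr0 mulr0 in h0; apply: (squeeze_cvgr _ (cvg_cst 0) h0); apply: nearW => z.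
by rewrite normr_ge0 fK.
Qed.

Lemma continuous_fcos : continuous (fcos psi).
Proof.
pose U := \int[leb]_t `|psi t|; have U0 : 0 <= U by exact: Rintegral_ge0.
apply: (@lipschitz_continuous _ (M%:R * U)) => x y.
have K0 : 0 <= M%:R * `|x - y| by rewrite mulr_ge0.
have [||_] := @psi_int_bound _ _ _ psi1 psiM (fun t => cos (t * x) - cos (t * y)) _ _ K0.
- by apply: measurable_funB; exact: measurable_cosM.
- move=> t tM; apply: le_trans (lipschitz_cos _ _) _.
  by rewrite -mulrBr normrM ler_wpM2r.
rewrite (_ : \int[leb]_t _ = fcos psi x - fcos psi y).
  by rewrite -/U mulrAC.
rewrite /fcos -rintB; try exact: L1_ucos.
by apply: eq_Rintegral => t _; ring.
Qed.

Lemma continuous_fsin : continuous (fsin psi).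
Proof.
pose U := \int[leb]_t `|psi t|; have U0 : 0 <= U by exact: Rintegral_ge0.
apply: (@lipschitz_continuous _ (M%:R * U)) => x y.
have K0 : 0 <= M%:R * `|x - y| by rewrite mulr_ge0.
have [||_] := @psi_int_bound _ _ _ psi1 psiM (fun t => sin (t * x) - sin (t * y)) _ _ K0.
- by apply: measurable_funB; exact: measurable_sinM.
- move=> t tM; apply: le_trans (lipschitz_sin _ _) _.
  by rewrite -mulrBr normrM ler_wpM2r.
rewrite (_ : \int[leb]_t _ = fsin psi x - fsin psi y).
  by rewrite -/U mulrAC.
rewrite /fsin -rintB; try exact: L1_usin.
by apply: eq_Rintegral => t _; ring.
Qed.

End wavelet_facts.

Lemma ae_le_measure d (T : measurableType d) (R : realType) (mu : {measure set T -> \bar R}) (A B : set T) :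
  measurable A -> measurable B -> {ae mu, forall w, A w -> B w} -> (mu A <= mu B)%E.
Proof.
move=> mA mB [N [mN N0 AB]].
apply: (@le_trans _ _ (mu (B `|` N))).
  apply: le_measure; rewrite ?inE//; first exact: measurableU.
  move=> w Aw; have [Bw|Bw] := pselect (B w); first by left.
  by right; apply: AB => /= /(_ Aw).
apply: (le_trans (measureU2 _ mB mN)) => //.
by rewrite -[leRHS]adde0 leeD2l// le_eqVlt; apply/orP; left; apply/eqP.
Qed.

(** * Concentration of the quadratic forms *)

Section form_concentration.
Context (R : realType) (n : nat) (H P : 'M[R]_n) (A : 'M[R[i]]_n) (h : 'I_n -> R).
Hypothesis PP : P *m P^T = 1%:M.
Hypothesis HP : H = P *m diag_mx (\row_q h q) *m invmx P.
Hypothesis ImA : map_mx (@complex.Im R) (A *m A ^t*) = 0.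
Hypothesis h01 : forall q, 0 < h q < 1.
Context d (T : measurableType d) (Pr : probability T R) (B : R -> T -> 'cV[R]_n).
Hypothesis ofbmB : is_ofbm Pr H A B.
Variables (N : nat) (psi : R -> R).
Hypothesis wpsi : is_wavelet N psi.
Notation leb := (@lebesgue_measure R).
Notation density := (wavelet_density P A h psi).
Notation corr := (wavelet_corr P A h psi).

Let psi1 := wavelet_L1_psi wpsi.
Let psi0 := wavelet_int0 wpsi.

Lemma density_bound v : exists K, forall y, `|density v y| <= K * (1 + y ^+ 2)^-1.
Proof.
have [M psiM] := wavelet_bounded wpsi.
have [K K0 hK] := wavelet_power_weight wpsi psiM.
exists (\sum_q \sum_r `|v q * v r * ofbm_cov_matrix P A q r| * K) => y.
rewrite /wavelet_density /spectral_weight mulr_sumr mulr_suml.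
apply: le_trans (ler_norm_sum _ _ _) _; apply: ler_sum => q _.
rewrite mulr_sumr mulr_suml; apply: le_trans (ler_norm_sum _ _ _) _; apply: ler_sum => r _.
rewrite (_ : fpower psi y * _ = (v q * v r * ofbm_cov_matrix P A q r) * (fpower psi y * `|y| `^ (1 - h q - h r))); last by ring.
have f0 : 0 <= fpower psi y by apply: divr_ge0; [apply: addr_ge0; exact: sqr_ge0|exact: sqr_ge0].
have fp0 := mulr_ge0 f0 (powR_ge0 `|y| (1 - h q - h r)).
rewrite normrM -[leRHS]mulrA ler_wpM2l// ger0_norm//.
by apply: hK; have := h01 q; have := h01 r; lra.
Qed.

Lemma continuous_density v y : y != 0 -> {for y, continuous (density v)}.
Proof.
move=> y0; have [M psiM] := wavelet_bounded wpsi.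
apply: cvgM.
  apply: cvgM.
    have cc := continuous_fcos wpsi psiM (x := y); have cs := continuous_fsin wpsi psiM (x := y).
    by apply: cvgD; rewrite !expr2; under eq_fun do rewrite expr2; apply: cvgM.
  apply: cvgV; first by rewrite expf_eq0.
  by rewrite expr2; under eq_fun do rewrite expr2; apply: cvgM; exact: cvg_id.
apply: cvg_bigsum => q; apply: cvg_bigsum => r.
apply: cvgM; first exact: cvg_cst.
by apply: cvgM; [exact: cvg_cst|exact: continuous_powR_norm].
Qed.

Lemma corr_sym v z : corr v z = corr v `|z|%:Z.
Proof.
rewrite /wavelet_corr; apply: eq_Rintegral => y _; congr (_ * _).
have [z0|z0] := leP 0 z; first by rewrite gez0_abs.
by rewrite ltz0_abs// mulrNz mulNr cosN.
Qed.

Lemma corr_cvg0 v : corr v k%:Z @[k --> \oo] --> (0 : R).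
Proof.
have [M psiM] := wavelet_bounded wpsi; have [K hK] := density_bound v.
have md := L1_meas (wavelet_density_L1 P A h01 psi1 psiM psi0 v).
exact: (riemann_lebesgue md hK (@continuous_density v)).
Qed.

Lemma corr_cesaro v :
  (K%:R ^+ 2)^-1 * \sum_(k < K) \sum_(l < K) corr v (k%:Z - l%:Z) ^+ 2 @[K --> \oo] --> (0 : R).
Proof.
have := @cesaro_double _ (fun k => corr v k%:Z ^+ 2) (fun=> sqr_ge0 _).
have c2 : corr v k%:Z ^+ 2 @[k --> \oo] --> (0 : R).
  by under eq_fun do rewrite expr2; rewrite -(mulr0 (0 : R)); apply: cvgM; exact: corr_cvg0.
move=> /(_ c2).
rewrite [X in X @ _ --> _](_ : _ = (fun K : nat =>
  (K%:R ^+ 2)^-1 * \sum_(k < K) \sum_(l < K) corr v (k%:Z - l%:Z) ^+ 2))//.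
apply/funext => K; congr (_ * _); apply: eq_bigr => k _; apply: eq_bigr => l _.
by rewrite -corr_sym.
Qed.

(* The quadratic form at [v] of the sample wavelet variance, written in the eigenbasis of [H] with
   the coordinate [q] rescaled by [s ^ - h q]. *)
Definition wavelet_form (s K : nat) (v : 'I_n -> R) (w : T) : R :=
  K%:R^-1 * \sum_(k < K) (\sum_q scaled_coord h s v q * (P^T *m wavelet_transform psi B s k.+1%:Z w) q 0) ^+ 2.

Lemma measurable_wavelet_form s K v : measurable_fun setT (wavelet_form s K v).
Proof.
apply: measurable_funM => //; apply: measurable_sum => k; apply: measurable_funX.
apply: measurable_sum => q; apply: measurable_funM => //.
rewrite (_ : (fun w => _) = (fun w => \sum_i P^T q i * wavelet_transform psi B s k.+1%:Z w i 0)).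
  apply: measurable_sum => i; apply: measurable_funM => //.
  exact: (measurable_wavelet_transform ofbmB psi1).
by apply/funext => w; rewrite mxE.
Qed.

(** [K0] does not depend on [s], because [corr] does not involve the scale; this is what allows the
    scale to grow with the sample size. *)
Lemma wavelet_form_conc v (e dl : R) : 0 < e -> 0 < dl -> exists K0 : nat, forall K s : nat,
  (K0 <= K)%N -> (0 < K)%N -> (0 < s)%N ->
  (Pr [set w | (e < `|wavelet_form s K v w - corr v 0|)%R] <= dl%:E)%E.
Proof.
move=> e0 d0; have [M psiM] := wavelet_bounded wpsi.
(* The level required of the Cesaro mean; 32 is the constant of [wavelet_coord_conc]. *)
have dl' : 0 < dl * e ^+ 2 / 32 by rewrite divr_gt0// mulr_gt0// exprn_gt0.
have [K0 _ hK0] := (cvgr_lt _ (corr_cesaro v)) _ dl'.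
exists K0 => K s KK K1 s0.
have K1' : 0 < K%:R :> R by rewrite ltr0n.
have X2 (k : 'I_K) := wavelet_coord_L2 PP HP ImA h01 ofbmB psi1 psiM v k.+1%:Z s0.
pose Q w := K%:R^-1 * \sum_(k < K) wavelet_coord P h B psi s v k.+1%:Z w ^+ 2.
have mQ : measurable_fun setT Q.
  apply: measurable_funM => //; apply: measurable_sum => k; apply: measurable_funX.
  by case: (X2 k).
apply: (@le_trans _ _ (Pr [set w | (e < `|Q w - corr v 0|)%R])).
  apply: ae_le_measure.
  - apply: measurable_gt; apply: measurableT_comp => //; apply: measurable_funB => //.
    exact: measurable_wavelet_form.
  - by apply: measurable_gt; apply: measurableT_comp => //; apply: measurable_funB.
  - have : {ae Pr, forall w (k : 'I_K), 
      \sum_q scaled_coord h s v q * (P^T *m wavelet_transform psi B s k.+1%:Z w) q 0 =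
      wavelet_coord P h B psi s v k.+1%:Z w}.
      apply: filter_forall => k; exact: (wavelet_coordE PP HP ImA h01 ofbmB psi1 psiM).
    by apply: filterS => w Ew; rewrite /= /wavelet_form; under eq_bigr do rewrite Ew.
have eK : 0 < e * K%:R by rewrite mulr_gt0.
have := wavelet_coord_conc PP HP ImA h01 ofbmB psi1 psiM v K s0 eK.
have cov (k l : 'I_K) : ip Pr (wavelet_coord P h B psi s v k.+1%:Z) (wavelet_coord P h B psi s v l.+1%:Z) =
   corr v (k%:Z - l%:Z).
  rewrite (wavelet_coord_cov PP HP ImA h01 ofbmB psi1 psiM psi0)//; congr (corr v _).
  by rewrite -addn1 -(addn1 l) !PoszD opprD addrACA subrr addr0.
rewrite (_ : [set w | (e < `|Q w - corr v 0|)%R] = [set w | (e * K%:R < `|\sum_(k < K) wavelet_coord P h B psi s v k.+1%:Z w ^+ 2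
    - \sum_(k < K) ip Pr (wavelet_coord P h B psi s v k.+1%:Z) (wavelet_coord P h B psi s v k.+1%:Z)|)%R]); last first.
  have E : \sum_(k < K) ip Pr (wavelet_coord P h B psi s v k.+1%:Z) (wavelet_coord P h B psi s v k.+1%:Z) =
      K%:R * corr v 0.
    by under eq_bigr do rewrite cov subrr; rewrite sumr_const card_ord -[_ *+ K]mulr_natl.
  rewrite E; apply/funext => w; apply/propext => /=.
  have -> : \sum_(k < K) wavelet_coord P h B psi s v k.+1%:Z w ^+ 2 = K%:R * Q w.
    by rewrite /Q mulVKf// gt_eqF.
  by rewrite -mulrBr normrM (ger0_norm (ltW K1')) mulrC ltr_pM2l.
move=> hh; apply: (le_trans hh); rewrite lee_fin.
under eq_bigr do under eq_bigr do rewrite cov.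
have := ltW (hK0 K KK); rewrite ler_pdivlMr//; set S := \sum_k _.
rewrite exprMn ler_pdivrMr; last by rewrite mulr_gt0 ?exprn_gt0.
rewrite -mulrA ler_pdivrMl ?exprn_gt0// => h1; lra.
Qed.

End form_concentration.

(** * Nondegeneracy of the limit *)

Section fourier_uniqueness.
Variables (R : realType) (psi : R -> R) (M : nat).
Notation leb := (@lebesgue_measure R).
Hypothesis psi1 : L1 leb psi.
Hypothesis psiM : forall t, psi t != 0 -> `|t| <= M%:R.
Hypothesis fc0 : forall x, fcos psi x = 0.
Hypothesis fs0 : forall x, fsin psi x = 0.

(* The annihilator of [psi] among the bounded multipliers: it is an algebra containing the
   trigonometric polynomials. *)
Definition annihilates (phi : R -> R) : Prop :=
  [/\ measurable_fun setT phi, exists B, forall t, `|phi t| <= B &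
      forall x b, \int[leb]_t (psi t * phi t * sin (t * x + b)) = 0].

Let msin x b : measurable_fun setT (fun t : R => sin (t * x + b)).
Proof.
apply: (measurableT_comp (measurable_cont (@continuous_sin R))).
by apply: measurable_funD => //; exact: measurable_funM.
Qed.

Let L1mul phi : annihilates phi -> forall x b, L1 leb (fun t => psi t * phi t * sin (t * x + b)).
Proof.
move=> [mphi [B hB] _] x b; apply: (L1_le _ (L1Z B (L1_norm psi1))).
  apply: measurable_funM; last exact: msin.
  by apply: measurable_funM => //; exact: L1_meas psi1.
move=> t; rewrite normrM; apply: le_trans (_ : `|psi t * phi t| <= _).
  by rewrite ler_piMr// norm_sin_le1.
by rewrite normrM mulrC ler_wpM2r.
Qed.

Lemma annihilates1 : annihilates (fun=> 1).
Proof.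
split => //; first by exists 1 => t; rewrite normr1.
move=> x b; rewrite [LHS](_ : _ = \int[leb]_t (cos b * (psi t * sin (t * x)) + sin b * (psi t * cos (t * x)))).
  rewrite rintD ?rintZ; try (by exact: L1_usin); try (by exact: L1_ucos); try (by apply: L1Z; exact: L1_usin);
    try (by apply: L1Z; exact: L1_ucos).
  by rewrite -/(fcos psi x) -/(fsin psi x) fc0 fs0 !mulr0 addr0.
by apply: eq_Rintegral => t _; rewrite sinD; ring.
Qed.

Lemma annihilatesD c c' phi phi' : annihilates phi -> annihilates phi' ->
  annihilates (fun t => c * phi t + c' * phi' t).
Proof.
move=> a1 a2; have [m1 [B1 b1] h1] := a1; have [m2 [B2 b2] h2] := a2; split.
- by apply: measurable_funD; exact: measurable_funM.
- exists (`|c| * B1 + `|c'| * B2) => t; apply: le_trans (ler_normD _ _) _.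
  by rewrite !normrM lerD// ler_wpM2l.
- move=> x b; have l1 := L1mul a1 x b; have l2 := L1mul a2 x b.
  rewrite [LHS](_ : _ = \int[leb]_t (c * (psi t * phi t * sin (t * x + b)) + c' * (psi t * phi' t * sin (t * x + b)))).
    by rewrite rintD ?rintZ ?h1 ?h2 ?mulr0 ?addr0//; exact: L1Z.
  by apply: eq_Rintegral => t _; ring.
Qed.

(** Product-to-sum formula, with cosines written as sines shifted by [pi / 2] so that the defining
    integrals apply again. *)
Lemma annihilates_sin a be phi : annihilates phi -> annihilates (fun t => sin (t * a + be) * phi t).
Proof.
move=> a1; have [m1 [B1 b1] h1] := a1; split.
- exact: measurable_funM.
- by exists B1 => t; rewrite normrM; apply: le_trans (b1 t); rewrite ler_piMl// norm_sin_le1.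
- move=> x b; have l1 := L1mul a1.
  rewrite [LHS](_ : _ = \int[leb]_t (2^-1 * (psi t * phi t * sin (t * (a - x) + (be - b + pi / 2)))
     - 2^-1 * (psi t * phi t * sin (t * (a + x) + (be + b + pi / 2))))).
    by rewrite rintB ?rintZ ?h1 ?mulr0 ?subr0//; exact: L1Z.
  apply: eq_Rintegral => t _.
  have e1 : t * (a - x) + (be - b + pi / 2) = (t * a + be) - (t * x + b) + pi / 2 by ring.
  have e2 : t * (a + x) + (be + b + pi / 2) = (t * a + be) + (t * x + b) + pi / 2 by ring.
  rewrite e1 e2 !sinDpihalf; move: (t * a + be) (t * x + b) => y z.
  by rewrite cosB cosD; field.
Qed.

Variable c : R.

Let a : R := (M%:R + `|c| + 1)^-1.
(** A trigonometric polynomial with values in [[0, 1]]. On the support of [psi] it exceeds 1/2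
    exactly to the right of [c], because [a] is small enough to keep the angle inside
    [(-pi, pi)]. *)
Let f (t : R) : R := (1 + sin (t * a + - (c * a))) / 2.

Let f01 t : 0 <= f t <= 1.
Proof.
have := norm_sin_le1 (t * a + - (c * a)); rewrite ler_norml /f => /andP[h1 h2].
by apply/andP; split; lra.
Qed.

Lemma annihilates_approx n m : annihilates (fun t => (1 - f t ^+ n) ^+ m).
Proof.
have fM phi : annihilates phi -> annihilates (fun t => f t * phi t).
  move=> h; have := annihilatesD 2^-1 2^-1 h (annihilates_sin a (- (c * a)) h).
  by congr annihilates; apply/funext => t; rewrite /f; ring.
have fnM phi k : annihilates phi -> annihilates (fun t => f t ^+ k * phi t).
  move=> h; elim: k => [|k IH].
    by move: h; congr annihilates; apply/funext => t; rewrite expr0 mul1r.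
  by have := fM _ IH; congr annihilates; apply/funext => t; rewrite exprS mulrA.
elim: m => [|m IH].
  by have := annihilates1; congr annihilates; apply/funext => t; rewrite expr0.
have := annihilatesD 1 (-1) IH (fnM _ n IH); congr annihilates; apply/funext => t.
by rewrite exprS; ring.
Qed.

Let bern1 (x : R) m : 0 <= x <= 1 -> 1 - m%:R * x <= (1 - x) ^+ m.
Proof.
move=> /andP[x0 x1]; elim: m => [|m IH]; first by rewrite mul0r subr0 expr0.
have x1' : 0 <= 1 - x by rewrite subr_ge0.
rewrite exprS; apply: le_trans (ler_wpM2l x1' IH).
have : 0 <= m%:R * x ^+ 2 by rewrite mulr_ge0// sqr_ge0.
by rewrite -natr1; nra.
Qed.

Let bern2 (x : R) m : 0 <= x <= 1 -> (1 - x) ^+ m * (1 + m%:R * x) <= 1.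
Proof.
move=> /andP[x0 x1]; elim: m => [|m IH]; first by rewrite mul0r addr0 expr0 mulr1.
have x1' : 0 <= (1 - x) ^+ m by rewrite exprn_ge0// subr_ge0.
apply: le_trans IH; rewrite exprSr -mulrA ler_wpM2l//.
have : 0 <= m%:R * x ^+ 2 by rewrite mulr_ge0// sqr_ge0.
have := sqr_ge0 x; rewrite -natr1; nra.
Qed.

(** The device of the Stone-Weierstrass theorem: by Bernoulli's inequality [(1 - f^n)^(2^n)] is at
    least [1 - (2 f)^n], which tends to 1 where [f < 1/2], and at most [1 / (1 + (2 f)^n)], which
    tends to 0 where [f > 1/2]. *)
Let g n t := (1 - f t ^+ n) ^+ (2 ^ n).

Let fn01 n t : 0 <= f t ^+ n <= 1.
Proof. by have /andP[h1 h2] := f01 t; rewrite exprn_ge0// exprn_ile1. Qed.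

Let g01 n t : 0 <= g n t <= 1.
Proof.
have /andP[h1 h2] := fn01 n t; apply/andP; split.
  by rewrite exprn_ge0// subr_ge0.
by rewrite exprn_ile1 ?subr_ge0// gerBl.
Qed.

Let sin_sign t : `|t| <= M%:R -> (t < c -> sin (t * a + - (c * a)) < 0) /\
  (c < t -> 0 < sin (t * a + - (c * a))).
Proof.
move=> tM; have d0 : 0 < M%:R + `|c| + 1 by rewrite ltr_wpDl// addr_ge0.
have a0 : 0 < a by rewrite invr_gt0.
have b1 (u : R) : `|u| <= M%:R + `|c| -> u * a < pi.
  move=> uM; apply: (@lt_trans _ _ 1); last by have := @pi_ge2 R; lra.
  by rewrite /a ltr_pdivrMr// mul1r; apply: (le_lt_trans (ler_norm u)); lra.
rewrite -mulrBl; split => h.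
- rewrite -oppr_gt0 -sinN -mulNr opprB; apply: sin_gt0_pi; apply/andP; split.
    by rewrite mulr_gt0 ?subr_gt0.
  by apply: b1; apply: le_trans (ler_normB _ _) _; lra.
- apply: sin_gt0_pi; apply/andP; split; first by rewrite mulr_gt0 ?subr_gt0.
  by apply: b1; apply: le_trans (ler_normB _ _) _; lra.
Qed.

Lemma half_line_int : \int[leb]_t (psi t * \1_(`]-oo, c]%classic) t) = 0.
Proof.
have mpsi := L1_meas psi1.
(* The integral in [annihilates] at frequency 0 and phase [pi / 2], where the sine is 1. *)
have h0 n : \int[leb]_t (psi t * g n t) = 0.
  have [_ _ h] := annihilates_approx n (2 ^ n).
  rewrite -[RHS](h 0 (pi / 2)); apply: eq_Rintegral => t _.
  by rewrite mulr0 add0r sin_pihalf mulr1.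
have mg n : measurable_fun setT (g n) by have [] := annihilates_approx n (2 ^ n).
have [|||||_ lim] := @dct _ _ R leb (fun n t => psi t * g n t) (fun t => psi t * \1_(`]-oo, c]%classic) t) (fun t => `|psi t|).
- by move=> n; exact: measurable_funM mpsi (mg n).
- by apply: measurable_funM => //; exact: measurable_indic.
- apply: (@filterS _ _ (ae_filter_ringOfSetsType leb) _ _ _ (ae_neq c)) => t tc.
  have [->|pt] := eqVneq (psi t) 0.
    by under eq_fun do rewrite mul0r; rewrite mul0r; exact: cvg_cst.
  apply: cvgM; first exact: cvg_cst.
  have [s1 s2] := sin_sign (psiM pt).
  have /andP[f0 f1] := f01 t.
  have f2 n : (2 ^ n)%N%:R * f t ^+ n = (2 * f t) ^+ n by rewrite natrX (exprMn n 2 (f t)).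
  have [tlc|clt|E] := ltgtP t c; last by rewrite E eqxx in tc.
  + rewrite indicE mem_set/= ?in_itv/= ?ltW// .
    have sl := s1 tlc.
    have h : 1 - (2 * f t) ^+ n @[n --> \oo] --> (1 - 0 : R).
      apply: cvgB; first exact: cvg_cst.
      apply: cvg_expr; rewrite ger0_norm ?mulr_ge0//.
      by rewrite /f; lra.
    rewrite subr0 in h; apply: (squeeze_cvgr _ h (cvg_cst (1 : R))); apply: nearW => n.
    by have /andP[_ ->] := g01 n t; rewrite andbT -f2; exact: bern1.
  + rewrite indicE memNset/=; last by rewrite in_itv/= leNgt clt.
    have sg := s2 clt; set s := sin _ in sg.
    have h : s^-1 * n.+1%:R^-1 @[n --> \oo] --> (s^-1 * 0 : R).
      by apply: cvgM; [exact: cvg_cst|exact: cvg_harmonic].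
    rewrite mulr0 in h; apply: (squeeze_cvgr _ (cvg_cst 0) h); apply: nearW => n.
    have /andP[g0 _] := g01 n t; rewrite g0 /=.
    rewrite -invfM -[X in _ <= X]mul1r ler_pdivlMr ?mulr_gt0//.
    apply: le_trans (bern2 (2 ^ n) (fn01 n t)); rewrite ler_wpM2l// f2.
    have -> : 2 * f t = 1 + s by rewrite /f -/s; field.
    have bn : 1 + n%:R * s <= (1 + s) ^+ n.
      elim: n {g0} => [|n IH]; first by rewrite mul0r addr0 expr0.
      have s10 : 0 <= 1 + s by rewrite addr_ge0// ltW.
      rewrite exprS; apply: le_trans (ler_wpM2l s10 IH).
      have : 0 <= n%:R * s ^+ 2 by rewrite mulr_ge0// sqr_ge0.
      by rewrite -natr1; nra.
    have : s <= 1 by have := norm_sin_le1 (t * a + - (c * a)); rewrite ler_norml -/s => /andP[].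
    by rewrite -natr1; move: bn; lra.
- exact: L1_norm.
- move=> n t; have /andP[g0 g1] := g01 n t; by rewrite normrM (ger0_norm g0) ler_piMr.
rewrite (funext h0) in lim.
by apply: (cvg_unique _ lim (cvg_cst 0)).
Qed.

End fourier_uniqueness.

(** The primitive of [psi] from minus infinity vanishes by [half_line_int], and [psi] is its
    derivative almost everywhere. *)
Lemma fourier_injective (R : realType) (psi : R -> R) (M : nat) :
  L1 lebesgue_measure psi -> (forall t, psi t != 0 -> `|t| <= M%:R) ->
  (forall x, fcos psi x = 0) -> (forall x, fsin psi x = 0) ->
  {ae (@lebesgue_measure R), forall t, psi t = 0}.
Proof.
move=> psi1 psiM fc0 fs0.
have int1 y : (@lebesgue_measure R).-integrable `]-oo, y] (EFin \o psi).
  exact: integrableS psi1.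
have loc : locally_integrable [set: R] psi by apply: open_integrable_locally => //; exact: openT.
have := FTC1Ny int1 loc; apply: filterS; first exact: (ae_filter_ringOfSetsType lebesgue_measure).
move=> t /= [_ <-].
rewrite (_ : (fun x => _) = fun=> 0); first by rewrite derive1_cst.
apply/funext => x; rewrite -[RHS](half_line_int psi1 psiM fc0 fs0 x) [LHS]Rintegral_mkcond.
apply: eq_Rintegral => y _; rewrite patchE indicE; case: ifP => _; rewrite ?mulr1 ?mulr0//.
Qed.

Lemma rint_gt0 (R : realType) (f : R -> R) (y : R) : L1 lebesgue_measure f -> (forall x, 0 <= f x) ->
  {for y, continuous f} -> 0 < f y -> 0 < \int[lebesgue_measure]_x f x.
Proof.
move=> f1 f0 cf fy.
have fy2 : 0 < f y / 2 by rewrite divr_gt0.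
have : \forall x \near y, f y / 2 <= f x.
  have /cvgrPdist_lt/(_ _ fy2) := cf; apply: filterS => x.
  by rewrite ltr_norml => /andP[_ h]; lra.
move=> [e /= e0 he].
pose g x := f y / 2 * \1_(ball y e) x.
have L1g : L1 lebesgue_measure (\1_(ball y e) : R -> R).
  by rewrite ball_itv; exact: integrable_indic_itv.
have gf : \int[lebesgue_measure]_x g x <= \int[lebesgue_measure]_x f x.
  apply: rint_le => //; first exact: L1Z.
  move=> x; rewrite /g indicE; have [xB|xB] := boolP (x \in (ball y e : set R)); last by rewrite mulr0.
  by rewrite mulr1; apply: he; rewrite inE in xB.
apply: lt_le_trans gf; rewrite /g rintZ// mulr_gt0//.
rewrite /Rintegral integral_indic//; last exact: measurable_ball.
rewrite setIT; have bm := lebesgue_measure_ball y (ltW e0).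
by rewrite (_ : fine _ = e *+ 2) ?pmulrn_rgt0//; apply: etrans (congr1 fine bm) _.
Qed.

(** * Positivity of the limiting forms *)

Section corr_positive.
Context (R : realType) (n : nat) (P : 'M[R]_n) (A : 'M[R[i]]_n) (h : 'I_n -> R).
Hypothesis PP : P *m P^T = 1%:M.
Hypothesis ImA : map_mx (@complex.Im R) (A *m A ^t*) = 0.
Hypothesis rkA : \rank (map_mx (@complex.Re R) (A *m A ^t*)) = n.
Hypothesis h01 : forall q, 0 < h q < 1.
Variables (N : nat) (psi : R -> R).
Hypothesis wpsi : is_wavelet N psi.
Notation leb := (@lebesgue_measure R).
Notation Re := complex.Re.
Notation Im := complex.Im.

Lemma gram_form (x : 'I_n -> R) :
  \sum_i \sum_j x i * x j * Re ((A *m A ^t*) i j) =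
  \sum_k ((\sum_i x i * Re (A i k)) ^+ 2 + (\sum_i x i * Im (A i k)) ^+ 2).
Proof.
transitivity (\sum_i \sum_j \sum_k (x i * Re (A i k) * (x j * Re (A j k)) + x i * Im (A i k) * (x j * Im (A j k)))).
  apply: eq_bigr => i _; apply: eq_bigr => j _.
  rewrite !mxE Re_sum mulr_sumr; apply: eq_bigr => k _; rewrite !mxE.
  by case: (A i k) (A j k) => [a b] [c d] /=; ring.
under eq_bigr do rewrite exchange_big; rewrite exchange_big; apply: eq_bigr => k _.
rewrite !expr2 !mulr_suml -big_split; apply: eq_bigr => i _ /=.
rewrite !mulr_sumr -big_split; apply: eq_bigr => j _ /=; ring.
Qed.

Lemma gram_ge0 (x : 'I_n -> R) : 0 <= \sum_i \sum_j x i * x j * Re ((A *m A ^t*) i j).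
Proof. by rewrite gram_form sumr_ge0// => k _; rewrite addr_ge0// sqr_ge0. Qed.

(** The form is the squared norm of the row [x] times [A]; if it vanishes, [x] is in the kernel of a
    matrix of full rank. *)
Lemma gram_gt0 (x : 'I_n -> R) i0 : x i0 != 0 -> 0 < \sum_i \sum_j x i * x j * Re ((A *m A ^t*) i j).
Proof.
move=> x0; rewrite lt_neqAle gram_ge0 andbT eq_sym; apply/eqP; rewrite gram_form => E.
have zero k : \sum_i x i * Re (A i k) = 0 /\ \sum_i x i * Im (A i k) = 0.
  have /eqP := E; rewrite psumr_eq0; last by move=> j _; rewrite addr_ge0// sqr_ge0.
  move=> /allP/(_ k (mem_index_enum _)); rewrite paddr_eq0 ?sqr_ge0// !sqrf_eq0.
  by move=> /andP[/eqP -> /eqP ->].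
pose S : 'M[R]_n := map_mx (@complex.Re R) (A *m A ^t*).
have uS : S \in unitmx by rewrite -row_full_unit /row_full rkA.
have : (\row_i x i) *m S = 0.
  apply/rowP => j; rewrite !mxE.
  transitivity (\sum_k ((\sum_i x i * Re (A i k)) * Re (A j k) + (\sum_i x i * Im (A i k)) * Im (A j k))).
    under [RHS]eq_bigr do rewrite !mulr_suml -big_split; rewrite exchange_big; apply: eq_bigr => i _.
    rewrite !mxE Re_sum mulr_sumr; apply: eq_bigr => k _; rewrite !mxE /=.
    by case: (A i k) (A j k) => [a b] [c d] /=; ring.
  by rewrite big1// => k _; have [-> ->] := zero k; rewrite !mul0r addr0.
move=> /(congr1 (fun M => M *m invmx S)); rewrite mulmxK// mul0mx => /rowP/(_ i0).
by rewrite !mxE => /eqP; rewrite (negbTE x0).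
Qed.

Lemma cov_matrix_form (c : 'I_n -> R) :
  \sum_q \sum_r c q * c r * ofbm_cov_matrix P A q r =
  \sum_i \sum_j (\sum_q P i q * c q) * (\sum_r P j r * c r) * Re ((A *m A ^t*) i j).
Proof.
pose S : 'M[R]_n := map_mx (@complex.Re R) (A *m A ^t*).
pose cv : 'cV[R]_n := \col_q c q.
have f (X : 'M[R]_n) (y : 'cV[R]_n) : (y^T *m X *m y) 0 0 = \sum_q \sum_r y q 0 * y r 0 * X q r.
  rewrite mxE exchange_big; apply: eq_bigr => r _; rewrite mxE mulr_suml; apply: eq_bigr => q _.
  by rewrite !mxE; ring.
have := f (ofbm_cov_matrix P A) cv.
have -> : cv^T *m ofbm_cov_matrix P A *m cv = (P *m cv)^T *m S *m (P *m cv).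
  by rewrite /ofbm_cov_matrix trmx_mul !mulmxA.
rewrite f => E; symmetry; move: E; congr (_ = _).
  apply: eq_bigr => i _; apply: eq_bigr => j _; rewrite !mxE.
  by congr (_ * _ * _); apply: eq_bigr => q _; rewrite mxE.
by apply: eq_bigr => i _; apply: eq_bigr => j _; rewrite !mxE.
Qed.

(** A congruence by a positive diagonal matrix, which reduces positivity at every nonzero [y] to
    that of [ofbm_cov_matrix]. *)
Lemma weight_form (c : 'I_n -> R) y : y != 0 -> spectral_weight P A h c y =
  `|y| * \sum_q \sum_r (`|y| `^ (- h q) * c q) * (`|y| `^ (- h r) * c r) * ofbm_cov_matrix P A q r.
Proof.
move=> y0; have y0' : 0 < `|y| by rewrite normr_gt0.
rewrite /spectral_weight mulr_sumr; apply: eq_bigr => q _; rewrite mulr_sumr; apply: eq_bigr => r _.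
rewrite !powR_gt0D// powRr1 ?ltW//; ring.
Qed.

Lemma weight_ge0 c y : y != 0 -> 0 <= spectral_weight P A h c y.
Proof. by move=> y0; rewrite weight_form// cov_matrix_form mulr_ge0// gram_ge0. Qed.

Lemma weight_gt0 c q y : c q != 0 -> y != 0 -> 0 < spectral_weight P A h c y.
Proof.
move=> cq y0; have y0' : 0 < `|y| by rewrite normr_gt0.
rewrite weight_form// cov_matrix_form mulr_gt0//.
pose w := fun q => `|y| `^ (- h q) * c q.
have [i hi] : exists i, \sum_q P i q * w q != 0.
  apply: contrapT => /forallNP no.
  have : P *m (\col_q w q) = 0.
    apply/colP => i; rewrite !mxE; under eq_bigr do rewrite mxE.
    by apply/eqP; apply: contrapT => /negP; exact: no.
  move=> /(congr1 (fun M => P^T *m M)); rewrite mulmxA mulmx0.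
  rewrite (mulmx1C PP) mul1mx => /colP/(_ q); rewrite !mxE => /eqP.
  by rewrite mulf_eq0 gt_eqF ?powR_gt0// (negbTE cq).
exact: gram_gt0 hi.
Qed.

(** The density is nonnegative, and positive and continuous at some nonzero [y]. Otherwise the
    Fourier transform of [psi] would vanish off 0, and at 0 by the zero mean, so [psi] would be 0
    almost everywhere, against its unit norm. *)
Lemma corr_gt0 v q : v q != 0 -> 0 < wavelet_corr P A h psi v 0.
Proof.
move=> vq; have psi1 := wavelet_L1_psi wpsi; have psi0 := wavelet_int0 wpsi.
have [M psiM] := wavelet_bounded wpsi.
rewrite /wavelet_corr; under eq_Rintegral do rewrite mul0r cos0 mul1r.
have [y [y0 py]] : exists y, y != 0 /\ 0 < fcos psi y ^+ 2 + fsin psi y ^+ 2.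
  apply: contrapT => no.
  have Q0 y : fcos psi y ^+ 2 + fsin psi y ^+ 2 = 0.
    have [->|y0] := eqVneq y 0.
      rewrite (_ : fcos psi 0 = \int[leb]_t psi t); last first.
        by apply: eq_Rintegral => t _; rewrite mulr0 cos0 mulr1.
      rewrite (_ : fsin psi 0 = 0) ?psi0 ?expr0n ?addr0//.
      rewrite -[RHS](@rint0 _ (measurableTypeR R) R leb).
      by apply: eq_Rintegral => t _; rewrite mulr0 sin0 mulr0.
    apply/eqP; rewrite eq_le addr_ge0 ?sqr_ge0// andbT leNgt; apply/negP => py.
    by apply: no; exists y.
  have [c0 s0] : (forall x, fcos psi x = 0) /\ (forall x, fsin psi x = 0).
    split=> x; have /eqP := Q0 x; rewrite paddr_eq0 ?sqr_ge0// !sqrf_eq0 => /andP[/eqP ? /eqP ?]//.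
  have ae0 := fourier_injective psi1 psiM c0 s0.
  have := wavelet_sqr wpsi; rewrite (ae_eq_integral (cst 0%E))//=.
  - by rewrite integral0 => -[] /esym/eqP; rewrite oner_eq0.
  - by apply/measurable_EFinP; apply: measurable_funX; exact: L1_meas psi1.
  - apply: (@filterS _ _ (ae_filter_ringOfSetsType leb) _ _ _ ae0) => t -> _.
    by rewrite expr0n.
have fp0 x : 0 <= fpower psi x by apply: divr_ge0; [apply: addr_ge0; exact: sqr_ge0|exact: sqr_ge0].
apply: (@rint_gt0 _ _ y).
- exact: (wavelet_density_L1 P A h01 psi1 psiM psi0 v).
- move=> x; rewrite /wavelet_density; have [->|x0] := eqVneq x 0.
    by rewrite /fpower expr0n invr0 mulr0 mul0r.
  by rewrite mulr_ge0// weight_ge0.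
- exact: (@continuous_density _ _ P A h _ _ wpsi v y y0).
- rewrite mulr_gt0//; last exact: weight_gt0 vq y0.
  by rewrite divr_gt0// exprn_even_gt0.
Qed.

End corr_positive.

(** * Spectrum of symmetric matrices *)

Section euclid.
Variables (R : realType).

Definition sqn (n : nat) (x : 'cV[R]_n) : R := \sum_i x i 0 ^+ 2.
Definition qform (n : nat) (S : 'M[R]_n) (x : 'cV[R]_n) : R := (x^T *m S *m x) 0 0.

Lemma sqnE n (x : 'cV[R]_n) : sqn x = (x^T *m x) 0 0.
Proof. by rewrite /sqn mxE; apply: eq_bigr => i _; rewrite mxE. Qed.

Lemma sqn_ge0 n (x : 'cV[R]_n) : 0 <= sqn x.
Proof. by apply: sumr_ge0 => i _; exact: sqr_ge0. Qed.

Lemma sqn_gt0 n (x : 'cV[R]_n) : (0 < sqn x) = (x != 0).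
Proof.
rewrite lt_neqAle sqn_ge0 andbT eq_sym /sqn psumr_eq0; last by move=> i _; exact: sqr_ge0.
congr (~~ _); apply/allP/eqP => [h|-> i _].
  by apply/colP => i; rewrite mxE; apply/eqP; rewrite -sqrf_eq0; exact: h (mem_index_enum _).
by rewrite mxE expr0n /= eqxx.
Qed.

Lemma sqn_orth n (Q : 'M[R]_n) (x : 'cV[R]_n) : Q *m Q^T = 1%:M -> sqn (Q *m x) = sqn x.
Proof.
by move=> /mulmx1C QQ; rewrite !sqnE trmx_mul -mulmxA (mulmxA Q^T) QQ mul1mx.
Qed.

Lemma sqnZ n c (x : 'cV[R]_n) : sqn (c *: x) = c ^+ 2 * sqn x.
Proof. by rewrite /sqn mulr_sumr; apply: eq_bigr => i _; rewrite mxE exprMn. Qed.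

Lemma qformE n (S : 'M[R]_n) x : qform S x = \sum_i \sum_j x i 0 * x j 0 * S i j.
Proof.
rewrite /qform mxE exchange_big; apply: eq_bigr => j _; rewrite mxE mulr_suml.
by apply: eq_bigr => i _; rewrite mxE; ring.
Qed.

Lemma qform_diag n (Q : 'M[R]_n) (l : 'I_n -> R) x :
  qform (Q *m diag_mx (\row_i l i) *m Q^T) x = \sum_i l i * (Q^T *m x) i 0 ^+ 2.
Proof.
rewrite /qform (_ : _ *m x = (Q^T *m x)^T *m diag_mx (\row_i l i) *m (Q^T *m x)); last first.
  by rewrite trmx_mul trmxK !mulmxA.
move: (Q^T *m x) => y; rewrite -/(qform _ y) qformE; apply: eq_bigr => i _.
rewrite (bigD1 i)//= big1 ?addr0; first by rewrite !mxE eqxx mulr1n; ring.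
by move=> j ji; rewrite !mxE eq_sym (negbTE ji) mulr0n mulr0.
Qed.

(** A complex eigenvector exists; symmetry makes its eigenvalue real, and then its real or its
    imaginary part is a real eigenvector. *)
Lemma real_eigenvector n (S : 'M[R]_n.+1) : S^T = S ->
  exists (l : R) (v : 'cV[R]_n.+1), sqn v = 1 /\ S *m v = l *: v.
Proof.
move=> SS; pose C := cplxmx S.
have [z rz] : exists z, root (char_poly C) z.
  by apply: closed_rootP; rewrite size_char_poly.
have /eigenvalueP[w wz w0] : eigenvalue C z by rewrite eigenvalue_root_char.
have Sji i j : S j i = S i j by rewrite -{1}SS mxE.
pose a := fun i => complex.Re (w 0 i); pose b := fun i => complex.Im (w 0 i).
have eqs j : \sum_i a i * S i j = complex.Re z * a j - complex.Im z * b j /\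
    \sum_i b i * S i j = complex.Re z * b j + complex.Im z * a j.
  have := congr1 (fun M : 'rV[R[i]]_n.+1 => M 0 j) wz; rewrite !mxE => E; split.
    have := congr1 (@complex.Re R) E; rewrite Re_sum Re_mul => <-.
    by apply: eq_bigr => i _; rewrite !mxE Re_mul /= mulr0 subr0.
  have := congr1 (@complex.Im R) E; rewrite Im_sum Im_mul => E2.
  rewrite -[RHS]E2; apply: eq_bigr => i _.
  by rewrite !mxE Im_mul /= mulr0 ?addr0 ?add0r.
have imz : complex.Im z = 0.
  have sym : \sum_j (\sum_i a i * S i j) * b j = \sum_j (\sum_i b i * S i j) * a j.
    under eq_bigr do rewrite mulr_suml; rewrite exchange_big; apply: eq_bigr => i _.
    by rewrite mulr_suml; apply: eq_bigr => j _; rewrite Sji; ring.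
  (* Pairing the two eigenvalue equations with [b] and [a] and subtracting leaves [Im z] times the
     squared norm. *)
  have : complex.Im z * \sum_j (a j ^+ 2 + b j ^+ 2) = 0.
    move: sym; under eq_bigr do rewrite (proj1 (eqs _)).
    under [X in _ = X]eq_bigr do rewrite (proj2 (eqs _)).
    move=> /eqP; rewrite -subr_eq0 -sumrB => /eqP E; rewrite -[RHS]oppr0 -[X in _ = - X]E -sumrN mulr_sumr.
    by apply: eq_bigr => j _; ring.
  move=> /eqP; rewrite mulf_eq0 => /orP[/eqP//|].
  rewrite psumr_eq0 => [/allP h|j _]; last by rewrite addr_ge0// sqr_ge0.
  case/negP: w0; apply/eqP/rowP => j; rewrite mxE.
  have := h j (mem_index_enum _); rewrite paddr_eq0 ?sqr_ge0// !sqrf_eq0 /a /b.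
  by case: (w 0 j) => x y /= /andP[/eqP -> /eqP ->].
have [v v0 Sv] : exists2 v : 'cV[R]_n.+1, v != 0 & S *m v = complex.Re z *: v.
  have aux (c : 'I_n.+1 -> R) j : c j != 0 -> (forall j, \sum_i c i * S i j = complex.Re z * c j) ->
     exists2 v : 'cV[R]_n.+1, v != 0 & S *m v = complex.Re z *: v.
    move=> cj hc; exists (\col_i c i).
      by apply/negP => /eqP/colP/(_ j); rewrite !mxE => /eqP; rewrite (negbTE cj).
    apply/colP => i; rewrite !mxE -hc; apply: eq_bigr => k _; rewrite !mxE Sji; ring.
  have [j wj] : exists j, w 0 j != 0.
    apply: contrapT => /forallNP no; move/eqP: w0; apply; apply/rowP => j; rewrite mxE.
    by apply/eqP; apply: contrapT => /negP; exact: no.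
  have : (a j != 0) || (b j != 0).
    by apply: contraR wj; rewrite negb_or !negbK /a /b; case: (w 0 j) => x y /= /andP[/eqP -> /eqP ->].
  move=> /orP[] hj; apply: (aux _ _ hj) => k; have [e1 e2] := eqs k.
    by rewrite e1 imz mul0r subr0.
  by rewrite e2 imz mul0r addr0.
have s0 : 0 < sqn v by rewrite sqn_gt0.
exists (complex.Re z), ((Num.sqrt (sqn v))^-1 *: v); split.
  by rewrite sqnZ exprVn sqr_sqrtr ?ltW// mulVf// gt_eqF.
by rewrite -scalemxAr Sv !scalerA mulrC.
Qed.

(** The reflection exchanging [v] and the first basis vector, or the identity when they agree. *)
Lemma householder n (v : 'cV[R]_n.+1) : sqn v = 1 ->
  exists Q : 'M[R]_n.+1, Q *m Q^T = 1%:M /\ Q *m delta_mx 0 0 = v.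
Proof.
move=> v1; pose e : 'cV[R]_n.+1 := delta_mx 0 0; pose w := e - v.
have [w0|w0] := eqVneq w 0.
  exists 1%:M; rewrite trmx1 mul1mx mul1mx; split => //.
  by move/eqP: w0; rewrite subr_eq0 => /eqP.
have sw : 0 < sqn w by rewrite sqn_gt0.
pose c := 2 / sqn w.
have wTw : w^T *m w = (sqn w)%:M by rewrite [LHS]mx11_scalar sqnE.
have swE : sqn w = 2 - 2 * v 0 0.
  have se (f : 'I_n.+1 -> R) : \sum_i e i 0 * f i = f 0.
    rewrite (bigD1 (ord0 : 'I_n.+1))//= big1 => [|i /negbTE i0]; first by rewrite mxE !eqxx mul1r addr0.
    by rewrite mxE i0 mul0r.
  have -> : sqn w = \sum_i (e i 0 * (e i 0 - 2 * v i 0) + v i 0 ^+ 2).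
    by apply: eq_bigr => i _; rewrite !mxE; ring.
  rewrite big_split /= -/(sqn v) v1 se mxE !eqxx /=; ring.
exists (1%:M - c *: (w *m w^T)); split.
  rewrite (_ : (1%:M - c *: (w *m w^T))^T = 1%:M - c *: (w *m w^T)); last first.
    by apply/matrixP => i j; rewrite !mxE eq_sym !big_ord1 !mxE; ring.
  rewrite mulmxBl mul1mx mulmxBr mulmx1.
  rewrite -scalemxAl -scalemxAr mulmxA -(mulmxA w) wTw mul_mx_scalar -scalemxAl !scalerA.
  rewrite (_ : c * (c * sqn w) = c + c); last by rewrite /c; field; rewrite gt_eqF.
  by rewrite scalerDl; move: (c *: _) => Y; apply/matrixP => i j; rewrite !mxE; ring.
rewrite mulmxBl mul1mx -scalemxAl -mulmxA (_ : w^T *m delta_mx 0 0 = (1 - v 0 0)%:M); last first.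
  rewrite [LHS]mx11_scalar; congr (_%:M); rewrite mxE (bigD1 ord0)//= big1 => [|i /negbTE i0].
    by rewrite !mxE !eqxx mulr1 addr0.
  by rewrite !mxE i0 mulr0.
rewrite mul_mx_scalar scalerA (_ : c * (1 - v 0 0) = 1); last first.
  by rewrite /c swE; field; rewrite -swE gt_eqF.
by rewrite scale1r opprB addrC subrK.
Qed.

(** Deflation: in an orthonormal basis starting with a unit eigenvector, symmetry clears the first
    row along with the first column, and the induction handles the lower block. *)
Lemma real_spectral n (S : 'M[R]_n) : S^T = S ->
  exists (Q : 'M[R]_n) (l : 'I_n -> R), Q *m Q^T = 1%:M /\ S = Q *m diag_mx (\row_i l i) *m Q^T.
Proof.
elim: n S => [|n IH] S SS.
  by exists 1%:M, (fun=> 0); split; apply/matrixP => -[].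
have [l [v [v1 Sv]]] := real_eigenvector SS.
have [Q [QQ Qe]] := householder v1.
have QTQ := mulmx1C QQ.
pose T : 'M[R]_(1 + n) := Q^T *m S *m Q.
have ET0 : T = Q^T *m S *m Q by [].
have TT : T^T = T by rewrite /T !trmx_mul trmxK SS mulmxA.
have Te : T *m delta_mx 0 0 = l *: delta_mx 0 (0 : 'I_1).
  by rewrite /T -!mulmxA Qe Sv -scalemxAr -Qe mulmxA QTQ mul1mx.
clearbody T.
have Ti0 i : T i 0 = l * (i == 0)%:R.
  have := congr1 (fun M : 'cV[R]_n.+1 => M i 0) Te; rewrite -colE !mxE => ->.
  by rewrite eqxx andbT.
have [Q' [l' [QQ' E']]] : exists (Q : 'M[R]_n) (l : 'I_n -> R), Q *m Q^T = 1%:M /\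
    drsubmx T = Q *m diag_mx (\row_i l i) *m Q^T.
  by apply: IH; rewrite trmx_drsub TT.
have ET : T = block_mx l%:M 0 0 (drsubmx T).
  rewrite -[LHS]submxK; congr block_mx.
  - by apply/matrixP => i j; rewrite !mxE !ord1 lshift0 Ti0 eqxx mulr1 mulr1n.
  - by apply/matrixP => i j; rewrite !mxE !ord1 lshift0 -TT mxE Ti0 mulr0.
  - by apply/matrixP => i j; rewrite !mxE !ord1 lshift0 Ti0 mulr0.
pose X : 'M[R]_(1 + n) := block_mx 1%:M 0 0 Q'.
have XX : X *m X^T = 1%:M.
  rewrite /X tr_block_mx !trmx0 trmx1 mulmx_block.
  by rewrite !mulmx0 !mul0mx !addr0 add0r mulmx1 QQ' -scalar_mx_block.
pose ll (i : 'I_(1 + n)) := match fintype.split i with inl _ => l | inr j => l' j end.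
have XD : X *m diag_mx (\row_i ll i) *m X^T = T.
  have -> : diag_mx (\row_i ll i) = block_mx (l%:M : 'M[R]_1) 0 0 (diag_mx (\row_i l' i)).
    rewrite -[LHS]submxK; congr block_mx; apply/matrixP => i j; rewrite !mxE /ll.
    - by rewrite (unsplitK (inl i : 'I_1 + 'I_n)) !ord1 eqxx.
    - by rewrite (_ : (lshift n i == rshift 1 j) = false)// eq_lrshift.
    - by rewrite (_ : (rshift 1 i == lshift n j) = false)// eq_rlshift.
    - by rewrite (unsplitK (inr i : 'I_1 + 'I_n)) (inj_eq (@rshift_inj _ _)).
  rewrite /X tr_block_mx !trmx0 trmx1 !mulmx_block.
  by rewrite [RHS]ET !mulmx0 !mul0mx !addr0 !add0r !mul1mx !mulmx1 !(mul0mx, mulmx0) ?addr0 ?add0r E'.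
exists (Q *m X), ll; split.
  by rewrite trmx_mul mulmxA -(mulmxA Q) XX mulmx1.
rewrite trmx_mul !mulmxA -(mulmxA Q X) -(mulmxA Q (X *m _)) XD ET0.
by rewrite !mulmxA QQ mul1mx -mulmxA QQ mulmx1.
Qed.

End euclid.

Section ordered_spectrum.
Variable R : realType.

Lemma char_poly_orth (n : nat) (Q : 'M[R]_n) (l : 'I_n -> R) : Q *m Q^T = 1%:M ->
  char_poly (Q *m diag_mx (\row_i l i) *m Q^T) = \prod_i ('X - (l i)%:P).
Proof.
move=> QQ; pose D := diag_mx (\row_i l i).
have -> : \prod_i ('X - (l i)%:P) = char_poly D.
  rewrite char_poly_trig ?diag_mx_is_trig//; apply: eq_bigr => i _.
  by rewrite !mxE eqxx mulr1n.
pose q := map_mx polyC Q.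
have qT : q^T = map_mx polyC Q^T by apply/matrixP => i j; rewrite !mxE.
have qq : q *m q^T = 1%:M by rewrite qT /q -map_mxM QQ map_mx1.
have -> : char_poly (Q *m D *m Q^T) = \det (q *m char_poly_mx D *m q^T).
  congr (\det _); rewrite /char_poly_mx mulmxBr mulmxBl mul_mx_scalar -scalemxAl qq scalemx1.
  by rewrite qT !map_mxM.
rewrite !det_mulmx mulrC mulrA -det_mulmx (mulmx1C qq) det1 mul1r //.
Qed.

Lemma eig_real_parts_orth (n : nat) (Q : 'M[R]_n) (l : 'I_n -> R) : Q *m Q^T = 1%:M ->
  eig_real_parts (Q *m diag_mx (\row_i l i) *m Q^T) = sort <=%R [seq l i | i <- enum 'I_n].
Proof.
move=> QQ; rewrite /eig_real_parts; set S := Q *m _ *m _.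
apply/perm_sort_leP; rewrite /eigenvalues.
case: closed_field_poly_normal => s /= Es.
have cp : char_poly (cplxmx S) = \prod_(x <- [seq (l i)%:C | i <- enum 'I_n]) ('X - x%:P).
  rewrite /cplxmx -map_char_poly char_poly_orth// rmorph_prod big_map big_enum /=.
  by apply: eq_bigr => i _; rewrite rmorphB /= map_polyX map_polyC.
have : perm_eq s [seq (l i)%:C | i <- enum 'I_n].
  apply: prod_XsubC_eq; rewrite -cp Es (monicP (char_poly_monic _)) scale1r//.
by move=> /(perm_map (@complex.Re R)); rewrite -map_comp.
Qed.

(** The sorted list of roots and the diagonal entries agree up to a permutation, which is applied to
    the columns of [Q]. *)
Lemma ordered_spectral (n : nat) (S : 'M[R]_n) : S^T = S ->
  exists Q : 'M[R]_n, [/\ Q *m Q^T = 1%:M,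
     S = Q *m diag_mx (\row_i ordered_eigenvalue S i) *m Q^T &
     forall i j : 'I_n, (i <= j)%N -> ordered_eigenvalue S i <= ordered_eigenvalue S j].
Proof.
move=> SS; have [Q [l [QQ SE]]] := real_spectral SS.
have sz : size (eig_real_parts S) = n.
  by rewrite SE eig_real_parts_orth// size_sort size_map size_enum_ord.
have : perm_eq (eig_real_parts S) [tuple l i | i < n].
  by rewrite SE eig_real_parts_orth// perm_sort.
move=> /tuple_permP[p Ep].
have Ei i : ordered_eigenvalue S i = l (p i).
  rewrite /ordered_eigenvalue Ep (nth_map i) ?size_enum_ord// nth_ord_enum.
  by rewrite tnth_mktuple.
exists (\matrix_(i, j) Q i (p j)); split.
- rewrite -QQ; apply/matrixP => i j; rewrite !mxE [RHS](reindex_inj (@perm_inj _ p)) /=.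
  by apply: eq_bigr => k _; rewrite !mxE.
- rewrite [LHS]SE; apply/matrixP => i j; rewrite !mul_mx_diag !mxE.
  rewrite [LHS](reindex_inj (@perm_inj _ p)) /=; apply: eq_bigr => k _.
  by rewrite !mxE Ei.
- move=> i j ij; rewrite /ordered_eigenvalue.
  have := sorted_leq_nth (@le_trans _ R) (@lexx _ R) 0 (s := eig_real_parts S).
  move=> /(_ (sort_le_sorted _) i j); rewrite !inE sz; exact.
Qed.

(** Clearing row [q] makes the determinant 0. This replaces the dimension count in the
    Courant-Fischer principle. *)
Lemma singular_row (n : nat) (M : 'M[R]_n) (q : 'I_n) :
  exists2 x : 'cV[R]_n, x != 0 & forall j, j != q -> (M *m x) j 0 = 0.
Proof.
pose M' : 'M[R]_n := \matrix_(i, j) (if i == q then 0 else M i j).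
have d0 : \det M'^T == 0.
  apply/eqP; rewrite det_tr (expand_det_row M' q) big1// => j _.
  by rewrite mxE eqxx mul0r.
have /det0P[v v0 vM] := d0.
exists v^T; first by rewrite -(inj_eq trmx_inj) trmxK trmx0.
move=> j jq; have := congr1 (fun X : 'rV[R]_n => X 0 j) vM; rewrite !mxE => E.
by rewrite -[RHS]E; apply: eq_bigr => k _; rewrite !mxE (negbTE jq) mulrC.
Qed.

Section courant_fischer.
Variables (n : nat) (S : 'M[R]_n) (q : 'I_n).
Hypothesis SS : S^T = S.
Notation lam := (ordered_eigenvalue S).

(** The test space is cut out by the rows of [G] before [q]. Some nonzero [x] lies in it and is
    orthogonal to the eigenvectors after [q], so its form is at most the [q]-th eigenvalue times
    [sqn x]. *)
Lemma ordered_eigenvalue_ge (G : 'M[R]_n) (c : R) :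
  (forall x : 'cV[R]_n, (forall j : 'I_n, (j < q)%N -> (G *m x) j 0 = 0) -> c * sqn x <= qform S x) ->
  c <= lam q.
Proof.
move=> h; have [Q [QQ SE sl]] := ordered_spectral SS.
have [x x0 hx] := singular_row (\matrix_(i, j) if (i < q)%N then G i j else Q^T i j) q.
have xs : 0 < sqn x by rewrite sqn_gt0.
rewrite -(ler_pM2r xs); apply: le_trans (h x _) _.
  move=> j jq; rewrite -[RHS](hx j); last by rewrite neq_ltn jq.
  by rewrite !mxE; apply: eq_bigr => k _; rewrite !mxE jq.
rewrite {1}SE qform_diag -(sqn_orth (Q := Q^T)); last by rewrite trmxK (mulmx1C QQ).
rewrite /sqn mulr_sumr; apply: ler_sum => i _.
have [iq|qi] := leqP i q; first by rewrite ler_wpM2r ?sqr_ge0// sl.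
rewrite (_ : (Q^T *m x) i 0 = 0); first by rewrite expr0n !mulr0.
rewrite -[RHS](hx i); last by rewrite neq_ltn qi orbT.
by rewrite !mxE; apply: eq_bigr => k _; rewrite [in RHS]mxE ltnNge (ltnW qi).
Qed.

Lemma ordered_eigenvalue_le (G : 'M[R]_n) (c : R) :
  (forall x : 'cV[R]_n, (forall j : 'I_n, (q < j)%N -> (G *m x) j 0 = 0) -> qform S x <= c * sqn x) ->
  lam q <= c.
Proof.
move=> h; have [Q [QQ SE sl]] := ordered_spectral SS.
have [x x0 hx] := singular_row (\matrix_(i, j) if (q < i)%N then G i j else Q^T i j) q.
have xs : 0 < sqn x by rewrite sqn_gt0.
rewrite -(ler_pM2r xs); apply: le_trans _ (h x _); last first.
  move=> j jq; rewrite -[RHS](hx j); last by rewrite neq_ltn jq orbT.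
  by rewrite !mxE; apply: eq_bigr => k _; rewrite !mxE jq.
rewrite {2}SE qform_diag -(sqn_orth (Q := Q^T)); last by rewrite trmxK (mulmx1C QQ).
rewrite /sqn mulr_sumr; apply: ler_sum => i _.
have [qi|iq] := leqP q i; first by rewrite ler_wpM2r ?sqr_ge0// sl.
rewrite (_ : (Q^T *m x) i 0 = 0); first by rewrite expr0n !mulr0.
rewrite -[RHS](hx i); last by rewrite neq_ltn iq.
by rewrite !mxE; apply: eq_bigr => k _; rewrite [in RHS]mxE ltnNge (ltnW iq).
Qed.

End courant_fischer.

Lemma qform_norm_le (n : nat) (D : 'M[R]_n) (e : R) (x : 'cV[R]_n) : (forall i j, `|D i j| <= e) ->
  `|qform D x| <= n%:R * e * sqn x.
Proof.
move=> De; rewrite qformE.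
have le_ij i j : `|x i 0 * x j 0 * D i j| <= e * 2^-1 * (x i 0 ^+ 2 + x j 0 ^+ 2).
  have e0 : 0 <= e by apply: le_trans (De i j).
  rewrite normrM; apply: le_trans (ler_wpM2l _ (De i j)) _ => //.
  rewrite mulrC -mulrA ler_wpM2l// normrM.
  rewrite -(real_normK (num_real (x i 0))) -(real_normK (num_real (x j 0))).
  by have := sqr_ge0 (`|x i 0| - `|x j 0|); rewrite sqrrB; lra.
apply: le_trans (ler_norm_sum _ _ _) _.
apply: (@le_trans _ _ (\sum_i \sum_j (e * 2^-1 * (x i 0 ^+ 2 + x j 0 ^+ 2)))).
  apply: ler_sum => i _; apply: le_trans (ler_norm_sum _ _ _) _.
  by apply: ler_sum => j _; exact: le_ij.
under eq_bigr do rewrite -mulr_sumr big_split /= sumr_const card_ord.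
rewrite -mulr_sumr big_split /= sumr_const card_ord sumrMnl -/(sqn x).
by rewrite -[sqn x *+ n]mulr_natl; move: (sqn x) (n%:R : R) => s N; lra.
Qed.

Lemma qformB n (S S' : 'M[R]_n) x : qform (S - S') x = qform S x - qform S' x.
Proof. by rewrite /qform mulmxBr mulmxBl !mxE. Qed.

Lemma weyl_le n (S S' : 'M[R]_n) (q : 'I_n) (e : R) : S^T = S -> S'^T = S' ->
  (forall i j, `|S i j - S' i j| <= e) ->
  ordered_eigenvalue S' q - n%:R * e <= ordered_eigenvalue S q.
Proof.
move=> SS SS' d; have [Q [QQ SE sl]] := ordered_spectral SS'.
apply: (@ordered_eigenvalue_ge _ S q SS (Q^T)) => x hx.
have : `|qform (S - S') x| <= n%:R * e * sqn x.
  by apply: qform_norm_le => i j; rewrite !mxE.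
rewrite qformB ler_norml => /andP[h _].
suff : ordered_eigenvalue S' q * sqn x <= qform S' x by move: h; lra.
rewrite [X in _ <= qform X _]SE qform_diag -[X in _ * X](sqn_orth (Q := Q^T)); last by rewrite trmxK (mulmx1C QQ).
rewrite /sqn mulr_sumr; apply: ler_sum => i _.
have [qi|iq] := leqP q i; first by rewrite ler_wpM2r ?sqr_ge0// sl.
by rewrite hx// expr0n !mulr0.
Qed.

(** Continuity of the ordered eigenvalues in the entries, from the Courant-Fischer bound with the
    eigenvectors of the other matrix as test space; it serves their measurability. *)
Lemma weyl n (S S' : 'M[R]_n) (q : 'I_n) (e : R) : S^T = S -> S'^T = S' ->
  (forall i j, `|S i j - S' i j| <= e) ->
  `|ordered_eigenvalue S q - ordered_eigenvalue S' q| <= n%:R * e.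
Proof.
move=> SS SS' d; rewrite ler_norml; have := weyl_le q SS SS' d.
have := @weyl_le _ S' S q e SS' SS; move=> /(_ _)/wrap[]; first by move=> i j; rewrite distrC.
by move: (ordered_eigenvalue S q) (ordered_eigenvalue S' q) (n%:R * e) => a b c *; apply/andP; split; lra.
Qed.

End ordered_spectrum.

(** * Measurable eigenvectors *)

Section measurable_spectrum.
Context d (T : measurableType d) (R : realType).

Lemma measurable_countable_comp (C : countType) (m : T -> C) (F : C -> R) :
  (forall c, measurable (m @^-1` [set c])) -> measurable_fun setT (F \o m).
Proof.
move=> mm _ Y mY; rewrite setTI.
rewrite (_ : _ @^-1` _ = \bigcup_k (if unpickle k is Some c then
   if `[< Y (F c) >] then m @^-1` [set c] else set0 else set0)).
  apply: bigcupT_measurable => k; case: unpickle => [c|//]; case: ifP => // _; exact: mm.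
apply/seteqP; split=> w /=.
  by move=> Yw; exists (pickle (m w)) => //; rewrite pickleK; rewrite asboolT.
by move=> [k _]; case: unpickle => [c|//]; case: ifPn => // /asboolP Yc /= ->.
Qed.

Variables (n : nat) (S : T -> 'M[R]_n).
Hypothesis mS : forall i j, measurable_fun setT (fun w => S w i j).
Hypothesis SS : forall w, (S w)^T = S w.

Lemma measurable_floor (f : T -> R) (z : int) : measurable_fun setT f ->
  measurable [set w | Num.floor (f w) = z].
Proof.
move=> mf; rewrite (_ : [set w | _] = f @^-1` `[z%:~R, (z + 1)%:~R[).
  by rewrite -[X in measurable X]setTI; exact: mf.
apply/seteqP; split=> w /=; rewrite in_itv/=.
  by move=> <-; exact: floor_itv.
by move=> h; apply/eqP; rewrite floor_eq.
Qed.

(** The eigenvalues come from a chosen list of roots. Rounding the entries down to multiples of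
    [1 / (N + 1)] leaves countably many matrices, on which any function is measurable, and [weyl]
    bounds the error by [n / (N + 1)]. *)
Lemma measurable_ordered_eigenvalue q : measurable_fun setT (fun w => ordered_eigenvalue (S w) q).
Proof.
pose m N w : 'M[int]_n := \matrix_(i, j) Num.floor (N.+1%:R * S w i j).
pose F N (M : 'M[int]_n) := ordered_eigenvalue (\matrix_(i, j) ((M i j)%:~R / N.+1%:R : R)) q.
apply: (@measurable_fun_cvg _ _ _ _ (fun N => F N \o m N)).
  move=> N; apply: measurable_countable_comp => M.
  rewrite (_ : _ @^-1` _ = \bigcap_(i in [set: 'I_n]) \bigcap_(j in [set: 'I_n]) [set w | Num.floor (N.+1%:R * S w i j) = M i j]).
    apply: fin_bigcap_measurable => // i _; apply: fin_bigcap_measurable => // j _.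
    by apply: measurable_floor; exact: measurable_funM.
  apply/seteqP; split=> w /=.
    by move=> <- i _ j _ /=; rewrite mxE.
  by move=> h; apply/matrixP => i j; rewrite mxE; exact: h.
move=> w _; apply/subr_cvg0/norm_cvg0P.
have h0 : n%:R * N.+1%:R^-1 @[N --> \oo] --> (n%:R * 0 : R).
  by apply: cvgM; [exact: cvg_cst|exact: cvg_harmonic].
rewrite mulr0 in h0; apply: (squeeze_cvgr _ (cvg_cst 0) h0); apply: nearW => N.
rewrite normr_ge0 /= /F; apply: weyl => //.
  by apply/matrixP => i j; rewrite !mxE -[in RHS](SS w) mxE.
move=> i j; rewrite !mxE.
have N0 : 0 < N.+1%:R :> R by [].
have /andP[f1 f2] := floor_itv (N.+1%:R * S w i j); rewrite intrD in f2.
rewrite -(ler_pM2r N0) mulVf ?gt_eqF// -[X in _ * X](ger0_norm (ltW N0)) -normrM mulrBl divfK ?gt_eqF//.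
by rewrite ler_norml; move: f1 f2; rewrite mulrC => f1 f2; apply/andP; split; lra.
Qed.

Section eigenprojector.
Variable q : 'I_n.

(** A Lagrange factor, equal to 1 at the [q]-th eigenvalue and 0 at the [r]-th; repetitions of the
    [q]-th eigenvalue contribute the identity. *)
Definition eigenfactor (M : 'M[R]_n) (r : 'I_n) : 'M[R]_n :=
  let l := ordered_eigenvalue M in
  if l r == l q then 1%:M else (l q - l r)^-1 *: (M - (l r)%:M).

(* Lagrange interpolation at the eigenvalues: the orthogonal projector on the [q]-th eigenspace,
   as a measurable function of the matrix. *)
Definition eigenprojector (M : 'M[R]_n) : 'M[R]_n :=
  foldr (fun r X => eigenfactor M r *m X) 1%:M (enum 'I_n).

Lemma eigenprojectorE (M Q : 'M[R]_n) : Q *m Q^T = 1%:M ->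
  M = Q *m diag_mx (\row_i ordered_eigenvalue M i) *m Q^T ->
  eigenprojector M = Q *m diag_mx (\row_i (ordered_eigenvalue M i == ordered_eigenvalue M q)%:R) *m Q^T.
Proof.
move=> QQ ME; have QTQ := mulmx1C QQ; pose l := ordered_eigenvalue M.
pose f (r i : 'I_n) : R := if l r == l q then 1 else (l i - l r) / (l q - l r).
have facE r : eigenfactor M r = Q *m diag_mx (\row_i f r i) *m Q^T.
  rewrite /eigenfactor /f -/l; case: ifP => _.
    rewrite (_ : diag_mx _ = 1%:M) ?mulmx1//; apply/matrixP => i j; rewrite !mxE//.
  have E1 : (l r)%:M = Q *m (l r)%:M *m Q^T by rewrite mul_mx_scalar -scalemxAl QQ scalemx1.
  rewrite {1}ME -/l E1 -mulmxBl -mulmxBr.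
  rewrite scalemxAl scalemxAr; congr (_ *m _ *m _); apply/matrixP => i j; rewrite !mxE.
  by case: eqP => [->|_]; rewrite ?mulr1n ?mulr0n ?subr0 ?mulr0// mulrC.
have prodE s : foldr (fun r X => eigenfactor M r *m X) 1%:M s =
    Q *m diag_mx (\row_i \prod_(r <- s) f r i) *m Q^T.
  elim: s => [|r s IH] /=.
    rewrite (_ : diag_mx _ = 1%:M) ?mulmx1//; apply/matrixP => i j; rewrite !mxE big_nil//.
  rewrite IH facE !mulmxA -(mulmxA _ Q^T Q) QTQ mulmx1; congr (_ *m _); rewrite -mulmxA; congr (_ *m _).
  by rewrite mulmx_diag; congr diag_mx; apply/rowP => i; rewrite !mxE big_cons.
rewrite /eigenprojector prodE; congr (_ *m diag_mx _ *m _); apply/rowP => i; rewrite !mxE.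
case: eqP => [E|E].
  rewrite big1// => r _; rewrite /f; case: eqP => // /eqP rq; rewrite -/l in E; rewrite E divff//.
  by rewrite subr_eq0 eq_sym.
(* The factor with [r = i] vanishes at the [i]-th eigenvalue. *)
rewrite (bigD1_seq i) ?mem_enum ?enum_uniq//= /f; case: eqP => // _.
by rewrite subrr mul0r mul0r.
Qed.

Lemma eigenprojectorP (M : 'M[R]_n) : M^T = M ->
  [/\ (eigenprojector M)^T = eigenprojector M,
      eigenprojector M *m eigenprojector M = eigenprojector M,
      M *m eigenprojector M = ordered_eigenvalue M q *: eigenprojector M,
      forall v : 'cV[R]_n, M *m v = ordered_eigenvalue M q *: v -> eigenprojector M *m v = v &
      exists i : 'I_n, eigenprojector M *m delta_mx i 0 != 0 :> 'cV[R]_n].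
Proof.
move=> MM; have [Q [QQ ME _]] := ordered_spectral MM.
have EE := eigenprojectorE QQ ME; set l := ordered_eigenvalue M in ME EE *.
have QTQ := mulmx1C QQ; set D := diag_mx _ in EE.
have DD : D *m D = D.
  by rewrite mulmx_diag; congr diag_mx; apply/rowP => i; rewrite !mxE; case: eqP; rewrite ?mulr1 ?mulr0.
have LD : diag_mx (\row_i l i) *m D = l q *: D.
  rewrite mulmx_diag -linearZ; congr diag_mx; apply/rowP => i; rewrite !mxE.
  by case: eqP => [->|]; rewrite ?mulr1 ?mulr0.
split.
- by rewrite EE !trmx_mul trmxK tr_diag_mx mulmxA.
- by rewrite EE !mulmxA -(mulmxA _ Q^T Q) QTQ mulmx1 -(mulmxA Q D) DD.
- rewrite {1}ME EE !mulmxA -(mulmxA _ Q^T Q) QTQ mulmx1 -(mulmxA Q _ D) LD.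
  by rewrite -scalemxAr -scalemxAl.
- move=> v Mv; rewrite EE -mulmxA; set y := Q^T *m v.
  have yl i : (l i - l q) * y i 0 = 0.
    have : diag_mx (\row_i l i) *m y = l q *: y.
      by rewrite /y scalemxAr -Mv {1}ME !mulmxA QTQ mul1mx.
    by move=> /colP/(_ i); rewrite mul_diag_mx !mxE => E; rewrite mulrBl E subrr.
  rewrite -mulmxA (_ : D *m y = y); first by rewrite mulmxA QQ mul1mx.
  apply/colP => i; rewrite mul_diag_mx !mxE; case: eqP => [_|/eqP lq]; first by rewrite mul1r.
  move/eqP: (yl i); rewrite mulf_eq0 subr_eq0 (negbTE lq) /= => /eqP; rewrite /y mxE => ->.
  by rewrite mul0r.
- apply: contrapT => /forallNP no.
  have E0 : eigenprojector M = 0.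
    apply/matrixP => i j; have /negP := no j; rewrite negbK => /eqP/colP/(_ i).
    by rewrite -colE !mxE.
  move: EE; rewrite E0 => /esym/(congr1 (fun X => Q^T *m X *m Q)).
  rewrite mulmx0 mul0mx !mulmxA QTQ mul1mx -mulmxA QTQ mulmx1 => /matrixP/(_ q q).
  by rewrite !mxE !eqxx mulr1n => /eqP; rewrite oner_eq0.
Qed.

Lemma measurable_mulmx (p1 p2 p3 : nat) (X : T -> 'M[R]_(p1, p2)) (Y : T -> 'M[R]_(p2, p3)) :
  (forall i j, measurable_fun setT (fun w => X w i j)) ->
  (forall i j, measurable_fun setT (fun w => Y w i j)) ->
  forall i j, measurable_fun setT (fun w => (X w *m Y w) i j).
Proof.
move=> mX mY i j; rewrite (_ : (fun w => _) = fun w => \sum_k X w i k * Y w k j).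
  by apply: measurable_sum => k; exact: measurable_funM.
by apply/funext => w; rewrite mxE.
Qed.

Lemma measurable_inv (f : T -> R) : measurable_fun setT f -> measurable_fun setT (fun w => (f w)^-1).
Proof.
move=> mf; rewrite (_ : (fun w => _) = fun w => f w * (f w ^+ 2)^-1).
  apply: measurable_funM => //; exact: (measurableT_comp (@measurable_invsqr R) mf).
apply/funext => w; have [->|f0] := eqVneq (f w) 0; first by rewrite invr0 mul0r.
by field; rewrite f0.
Qed.

Lemma measurable_eigenprojector i j : measurable_fun setT (fun w => eigenprojector (S w) i j).
Proof.
rewrite /eigenprojector; elim: (enum 'I_n) i j => [|r s IH] i j /=; first exact: measurable_cst.
apply: (measurable_mulmx (X := fun w => eigenfactor (S w) r)) => // {}i {}j.
pose g w := (ordered_eigenvalue (S w) q - ordered_eigenvalue (S w) r)^-1 *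
   (S w i j - ordered_eigenvalue (S w) r * (i == j)%:R).
rewrite (_ : (fun w => _) = fun w => if ordered_eigenvalue (S w) r == ordered_eigenvalue (S w) q
    then (i == j)%:R else g w).
  apply: measurable_fun_ifT => //.
    by apply: measurable_fun_eqr; exact: measurable_ordered_eigenvalue.
  apply: measurable_funM.
    by apply: measurable_inv; apply: measurable_funB; exact: measurable_ordered_eigenvalue.
  by apply: measurable_funB => //; apply: measurable_funM => //; exact: measurable_ordered_eigenvalue.
by apply/funext => w; rewrite /eigenfactor; case: ifP; rewrite !mxE // /g mulr_natr.
Qed.

(** The normalized projection of the first vector of [l] that the projector does not kill; the
    default 0 is excluded once [l] contains a basis. *)
Definition eigenselect (l : seq 'cV[R]_n) (M : 'M[R]_n) : 'cV[R]_n :=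
  foldr (fun v u => let x := eigenprojector M *m v in
    if sqn x == 0 then u else (Num.sqrt (sqn x))^-1 *: x) 0 l.

Lemma measurable_sqn (x : T -> 'cV[R]_n) : (forall i, measurable_fun setT (fun w => x w i 0)) ->
  measurable_fun setT (fun w => sqn (x w)).
Proof. by move=> mx; apply: measurable_sum => i; exact: measurable_funX. Qed.

Lemma measurable_eigenselect l i : measurable_fun setT (fun w => eigenselect l (S w) i 0).
Proof.
elim: l => [|v l IH] /=; first by under eq_fun do rewrite mxE; exact: measurable_cst.
have mx k : measurable_fun setT (fun w => (eigenprojector (S w) *m v) k 0).
  by apply: (measurable_mulmx (Y := fun=> v)) => //; exact: measurable_eigenprojector.
pose g w := (Num.sqrt (sqn (eigenprojector (S w) *m v)))^-1 * (eigenprojector (S w) *m v) i 0.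
rewrite (_ : (fun w => _) = fun w => if sqn (eigenprojector (S w) *m v) == 0 then eigenselect l (S w) i 0 else g w).
  apply: measurable_fun_ifT => //.
    by apply: measurable_fun_eqr => //; exact: measurable_sqn.
  apply: measurable_funM => //; apply: measurable_inv.
  apply: (measurableT_comp (measurable_cont (@sqrt_continuous R))); exact: measurable_sqn.
by apply/funext => w; case: ifP => // _; rewrite [LHS]mxE.
Qed.

Lemma eigenselectP (M : 'M[R]_n) l : M^T = M -> (exists2 v, v \in l & eigenprojector M *m v != 0) ->
  sqn (eigenselect l M) = 1 /\ M *m eigenselect l M = ordered_eigenvalue M q *: eigenselect l M.
Proof.
move=> MM; have [_ _ ME _ _] := eigenprojectorP MM.
elim: l => [|v l IH] /= [v0]; first by rewrite in_nil.
case: (eqVneq (sqn (eigenprojector M *m v)) 0) => [s0|s0].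
  move=> vl Ev; apply: IH; exists v0 => //.
  move: vl; rewrite inE => /orP[/eqP E|//]; move: Ev.
  by rewrite E -sqn_gt0 s0 ltxx.
move=> _ _; have sp : 0 < sqn (eigenprojector M *m v) by rewrite lt_neqAle eq_sym s0 sqn_ge0.
split; first by rewrite sqnZ exprVn sqr_sqrtr ?(ltW sp)// mulVf.
by rewrite -scalemxAr mulmxA ME -scalemxAl !scalerA mulrC.
Qed.

End eigenprojector.

(** With [p] first in the list, [u] is the normalized projection of [p] unless [p] is orthogonal to
    the eigenspace, and its product with [p] is the norm of that projection. The basis vectors are a
    fallback that yields a unit eigenvector for every [w]. *)
Lemma measurable_eigenvector (q : 'I_n) (p : 'cV[R]_n) : exists u : T -> 'cV[R]_n,
  (forall i, measurable_fun setT (fun w => u w i 0)) /\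
  forall w, [/\ sqn (u w) = 1, S w *m u w = ordered_eigenvalue (S w) q *: u w &
    forall v : 'cV[R]_n, S w *m v = ordered_eigenvalue (S w) q *: v -> (v^T *m p) 0 0 != 0 -> 0 <= ((u w)^T *m p) 0 0].
Proof.
pose l : seq 'cV[R]_n := p :: [seq delta_mx i 0 | i <- enum 'I_n].
exists (fun w => eigenselect q l (S w)); split; first exact: measurable_eigenselect.
move=> w; have [Et EE ME Ev [i Ei]] := eigenprojectorP q (SS w).
have [|u1 Mu] := @eigenselectP q (S w) l (SS w).
  by exists (delta_mx i 0) => //; rewrite inE; apply/orP; right; apply: map_f; rewrite mem_enum.
split => // v Mv vp; rewrite /l /=.
have -> : (sqn (eigenprojector q (S w) *m p) == 0) = false.
  apply/negbTE; rewrite gt_eqF// sqn_gt0; apply: contra vp => /eqP E0.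
  by rewrite -(Ev _ Mv) trmx_mul Et -mulmxA E0 mulmx0 mxE.
rewrite linearZ /= -scalemxAl mxE mulr_ge0 ?invr_ge0 ?sqrtr_ge0//.
by rewrite trmx_mul Et -EE mulmxA -{1}Et -trmx_mul -mulmxA -sqnE sqn_ge0.
Qed.

End measurable_spectrum.

(** * Perturbation of eigenvectors *)

Section perturbation.
Context (R : realType) (n : nat) (P V : 'M[R]_n) (a : 'I_n -> R) (m be t : R).
Hypothesis PP : P *m P^T = 1%:M.
Hypothesis VV : V^T = V.
Hypothesis Vm : forall i j, `|V i j| <= m.
Hypothesis be0 : 0 < be.
Hypothesis Vbe : forall z : 'cV[R]_n, be * sqn z <= qform V z.
Hypothesis a0 : forall r, 0 < a r.
Hypothesis t0 : 0 <= t <= 1.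
Hypothesis ta : forall q r : 'I_n, (q < r)%N -> a q <= t * a r.

Let L := diag_mx (\row_r a r).
Let S := P *m L *m V *m L *m P^T.
Let M := n%:R * m.

Let SS : S^T = S.
Proof. by rewrite /S !trmx_mul trmxK tr_diag_mx VV !mulmxA. Qed.

Let amono (q r : 'I_n) : (q <= r)%N -> a q <= a r.
Proof.
rewrite leq_eqVlt => /orP[/eqP/ord_inj ->//|/ta h]; apply: (le_trans h).
by have /andP[_ t1] := t0; rewrite ler_piMl// ltW.
Qed.

Let Ly (y : 'cV[R]_n) r : (L *m y) r 0 = a r * y r 0.
Proof. by rewrite mul_diag_mx !mxE. Qed.

Let qformS x : qform S x = qform V (L *m (P^T *m x)).
Proof. by rewrite /qform /S !trmx_mul tr_diag_mx trmxK !mulmxA. Qed.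

Let Vup z : qform V z <= M * sqn z.
Proof. by apply: le_trans (ler_norm _) _; exact: qform_norm_le. Qed.

Let sqnP x : sqn (P^T *m x) = sqn x.
Proof. by rewrite (sqn_orth (Q := P^T))// trmxK (mulmx1C PP). Qed.

Let m0 (q : 'I_n) : 0 <= m.
Proof. exact: le_trans (Vm q q). Qed.

(** Test space: the vectors whose coordinates before [q] in the basis [P] vanish; there [L]
    multiplies norms by at least [a q]. *)
Lemma eigenvalue_lower q : be * a q ^+ 2 <= ordered_eigenvalue S q.
Proof.
apply: (@ordered_eigenvalue_ge _ _ S q SS P^T) => x hx.
rewrite qformS -sqnP; apply: le_trans (Vbe _); rewrite -mulrA ler_wpM2l ?(ltW be0)//.
rewrite /sqn mulr_sumr; apply: ler_sum => r _; rewrite Ly exprMn.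
have [rq|qr] := ltnP r q; first by rewrite hx// expr0n !mulr0.
by rewrite ler_wpM2r ?sqr_ge0// lerXn2r ?nnegrE ?(ltW (a0 _))// amono.
Qed.

Lemma eigenvalue_upper q : ordered_eigenvalue S q <= M * a q ^+ 2.
Proof.
have M0 : 0 <= M by rewrite mulr_ge0// (m0 q).
apply: (@ordered_eigenvalue_le _ _ S q SS P^T) => x hx.
rewrite qformS -sqnP; apply: le_trans (Vup _) _; rewrite -mulrA ler_wpM2l//.
rewrite /sqn mulr_sumr; apply: ler_sum => r _; rewrite Ly exprMn.
have [qr|rq] := ltnP q r; first by rewrite hx// expr0n !mulr0.
by rewrite ler_wpM2r ?sqr_ge0// lerXn2r ?nnegrE ?(ltW (a0 _))// amono.
Qed.

Lemma sqn_mul_le (z : 'cV[R]_n) (q : 'I_n) : sqn (V *m z) <= M ^+ 2 * sqn z.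
Proof.
have -> : sqn (V *m z) = qform (V *m V) z by rewrite sqnE /qform trmx_mul VV !mulmxA.
apply: le_trans (ler_norm _) _.
have -> : M ^+ 2 = n%:R * (n%:R * m ^+ 2) by rewrite /M; ring.
apply: qform_norm_le => i j; rewrite mxE; apply: le_trans (ler_norm_sum _ _ _) _.
apply: (@le_trans _ _ (\sum_(k < n) m ^+ 2)); last by rewrite sumr_const card_ord mulr_natl.
by apply: ler_sum => k _; rewrite normrM expr2 ler_pM.
Qed.

Lemma eigenvector_close q (u : 'cV[R]_n) : sqn u = 1 -> S *m u = ordered_eigenvalue S q *: u ->
  1 - n%:R * (M ^+ 2 / be ^+ 2 + M / be) * t ^+ 2 <= ((u^T *m col q P) 0 0) ^+ 2.
Proof.
move=> u1 Su; set l := ordered_eigenvalue S q in Su.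
have l1 : be * a q ^+ 2 <= l by exact: eigenvalue_lower.
have l2 : l <= M * a q ^+ 2 by exact: eigenvalue_upper.
have aq2 : 0 < a q ^+ 2 by rewrite exprn_gt0.
have l0 : 0 < l by apply: lt_le_trans l1; rewrite mulr_gt0.
have M0 : 0 <= M by rewrite mulr_ge0// (m0 q).
pose y := P^T *m u; pose z := V *m (L *m y).
have y1 : sqn y = 1 by rewrite sqnP.
have -> : (u^T *m col q P) 0 0 = y q 0.
  by rewrite !mxE; apply: eq_bigr => i _; rewrite !mxE mulrC.
have zE r : a r * z r 0 = l * y r 0.
  have : L *m z = l *: y.
    by rewrite /z /y scalemxAr -Su /S !mulmxA (mulmx1C PP) mul1mx.
  by move=> /colP/(_ r); rewrite Ly => ->; rewrite mxE.
have qV : qform V (L *m y) = l.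
  have -> : qform V (L *m y) = qform S u by rewrite qformS.
  by rewrite /qform -mulmxA Su -scalemxAr mxE -sqnE u1 mulr1.
have sL : be * sqn (L *m y) <= l by rewrite -qV.
have t2 : 0 <= t ^+ 2 by exact: sqr_ge0.
have ta2 (r r' : 'I_n) : (r < r')%N -> a r ^+ 2 <= t ^+ 2 * a r' ^+ 2.
  have /andP[tt0 _] := t0.
  by move=> rr; rewrite -exprMn lerXn2r ?nnegrE ?(ltW (a0 _))// ?ta// mulr_ge0// ltW.
have C1 : 0 <= M ^+ 2 / be ^+ 2 by rewrite divr_ge0 ?sqr_ge0.
have C2 : 0 <= M / be by rewrite divr_ge0 ?(ltW be0).
have yr r : r != q -> y r 0 ^+ 2 <= (M ^+ 2 / be ^+ 2 + M / be) * t ^+ 2.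
  rewrite neq_ltn => /orP[rq|qr].
  (* Smaller scales: [l y_r = a_r z_r], where [|z| <= M |L y|], [be |L y|^2 <= l] and
     [l >= be a_q^2]. *)
  - apply: (@le_trans _ _ (M ^+ 2 / be ^+ 2 * t ^+ 2)); last by rewrite ler_wpM2r// lerDl.
    have h1 : l ^+ 2 * y r 0 ^+ 2 <= a r ^+ 2 * (M ^+ 2 * sqn (L *m y)).
      rewrite -exprMn -zE exprMn ler_wpM2l ?sqr_ge0//.
      apply: le_trans (sqn_mul_le _ q); rewrite -/z /sqn (bigD1 r)//= lerDl.
      by apply: sumr_ge0 => i _; exact: sqr_ge0.
    have h2 : be * (l ^+ 2 * y r 0 ^+ 2) <= a r ^+ 2 * M ^+ 2 * l.
      apply: le_trans (ler_wpM2l (ltW be0) h1) _.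
      have := ler_wpM2l (mulr_ge0 (sqr_ge0 (a r)) (sqr_ge0 M)) sL; lra.
    have h3 : be * l * y r 0 ^+ 2 <= a r ^+ 2 * M ^+ 2.
      by rewrite -(ler_pM2r l0); move: h2; lra.
    have h4 : be ^+ 2 * a q ^+ 2 * y r 0 ^+ 2 <= a r ^+ 2 * M ^+ 2.
      apply: le_trans h3; rewrite ler_wpM2r ?sqr_ge0//.
      by have := ler_wpM2l (ltW be0) l1; lra.
    have h5 : be ^+ 2 * y r 0 ^+ 2 <= t ^+ 2 * M ^+ 2.
      rewrite -(ler_pM2r aq2); have := ler_wpM2r (sqr_ge0 M) (ta2 _ _ rq); lra.
    rewrite mulrAC ler_pdivlMr ?exprn_gt0//; lra.
  (* Larger scales: [a_r^2 y_r^2 <= |L y|^2 <= l / be <= M a_q^2 / be]. *)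
  - apply: (@le_trans _ _ (M / be * t ^+ 2)); last by rewrite ler_wpM2r// lerDr.
    have h1 : a r ^+ 2 * y r 0 ^+ 2 <= sqn (L *m y).
      rewrite -exprMn -Ly /sqn (bigD1 r)//= lerDl.
      by apply: sumr_ge0 => i _; exact: sqr_ge0.
    have h2 := ler_wpM2l (ltW be0) h1.
    have h3 := ler_wpM2l M0 (ta2 _ _ qr).
    have ar2 : 0 < a r ^+ 2 by rewrite exprn_gt0.
    have h4 : be * y r 0 ^+ 2 <= M * t ^+ 2 by rewrite -(ler_pM2r ar2); move: sL h2 h3 l2; lra.
    rewrite mulrAC ler_pdivlMr//; lra.
set C := _ + _ in yr *.
have C0 : 0 <= C by exact: addr_ge0.
rewrite -[X in X - _]y1 /sqn (bigD1 q)//= -addrA gerDl subr_le0.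
apply: (@le_trans _ _ (\sum_(i < n) C * t ^+ 2)); last by rewrite sumr_const card_ord -[leLHS]mulr_natl mulrA.
rewrite [leRHS](bigD1 q)//=; apply: ler_wpDl; first exact: mulr_ge0 C0 t2.
by apply: ler_sum => r /yr.
Qed.

End perturbation.

Lemma sqn_sub_unit (R : realType) (n : nat) (u p : 'cV[R]_n) : sqn u = 1 -> sqn p = 1 ->
  sqn (u - p) = 2 - 2 * (u^T *m p) 0 0.
Proof.
move=> u1 p1; have -> : sqn (u - p) = sqn u + sqn p - 2 * (u^T *m p) 0 0.
  rewrite mxE /sqn mulr_sumr -big_split -sumrB; apply: eq_bigr => i _.
  by rewrite !mxE /=; ring.
by rewrite u1 p1; ring.
Qed.

Lemma sqn_col (R : realType) (n : nat) (P : 'M[R]_n) q : P *m P^T = 1%:M -> sqn (col q P) = 1.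
Proof.
move=> /mulmx1C /matrixP/(_ q q); rewrite !mxE eqxx mulr1n => <-.
by apply: eq_bigr => i _; rewrite !mxE expr2.
Qed.

(** [be] is the smallest ordered eigenvalue; [q] witnesses that the dimension is positive. *)
Lemma pos_def_lower (R : realType) (n : nat) (b : 'M[R]_n) (q : 'I_n) : b^T = b ->
  (forall x : 'cV[R]_n, x != 0 -> 0 < qform b x) ->
  exists2 be, 0 < be & forall x : 'cV[R]_n, be * sqn x <= qform b x.
Proof.
move=> bb pos; have [Q [QQ bE sl]] := ordered_spectral bb.
have QTQ := mulmx1C QQ.
pose i0 : 'I_n := Ordinal (leq_ltn_trans (leq0n q) (ltn_ord q)).
exists (ordered_eigenvalue b i0).
  have : 0 < qform b (Q *m delta_mx i0 0).
    apply: pos; apply/eqP => /(congr1 (fun X => Q^T *m X)); rewrite mulmxA QTQ mul1mx mulmx0.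
    by move=> /matrixP/(_ i0 0); rewrite !mxE !eqxx => /eqP; rewrite oner_eq0.
  rewrite {1}bE qform_diag mulmxA QTQ mul1mx (bigD1 i0)//= big1 => [|i /negbTE ii].
    by rewrite mxE !eqxx expr1n mulr1 addr0.
  by rewrite mxE ii expr0n mulr0.
move=> x; rewrite {2}bE qform_diag -(sqn_orth (Q := Q^T)); last by rewrite trmxK.
rewrite /sqn mulr_sumr; apply: ler_sum => i _.
by rewrite ler_wpM2r ?sqr_ge0// sl.
Qed.

(* [D q r = (f q r - f q q / 4 - f r r / 4) / 2], where [f q r] is the form at [e_q + e_r]. *)
Lemma polarization_bound (R : realType) (n : nat) (D : 'M[R]_n) (e : R) : D^T = D ->
  (forall q r, `|qform D (delta_mx q 0 + delta_mx r 0)| <= e) -> forall q r, `|D q r| <= e.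
Proof.
move=> DD he q r.
have f (x y : 'I_n) : qform D (delta_mx x 0 + delta_mx y 0) = D x x + D x y + D y x + D y y.
  rewrite /qform [(_ + _)^T]raddfD /= !trmx_delta !mulmxDl !mulmxDr -!colE -!rowE.
  by rewrite !mxE; ring.
have := he q r; have := he q q; have := he r r; rewrite !f.
rewrite (_ : D r q = D q r); last by rewrite -{1}DD mxE.
by rewrite !ler_norml => /andP[? ?] /andP[? ?] /andP[? ?]; apply/andP; split; lra.
Qed.

(** * Consistency *)

Lemma measure_bigU_le d (T : measurableType d) (R : realType) (mu : {measure set T -> \bar R})
    (I : Type) (s : seq I) (B : I -> set T) (c : R) :
  (forall i, measurable (B i)) -> (forall i, (mu (B i) <= c%:E)%E) ->
  measurable (\big[setU/set0]_(i <- s) B i) /\ (mu (\big[setU/set0]_(i <- s) B i) <= ((size s)%:R * c)%:E)%E.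
Proof.
move=> mB Bc; elim: s => [|i s [mIH IH]].
  by rewrite big_nil measure0 mul0r; split.
rewrite big_cons; split; first exact: measurableU.
apply: le_trans (measureU2 _ (mB i) mIH) _.
by rewrite /= -natr1 mulrDl mul1r addrC EFinD leeD.
Qed.

(** The first term of [scaling_rate] sends the number of locations to infinity, the second sends the
    scale to infinity. *)
Lemma scaling_near (R : realType) (n : nat) (H : 'M[R]_n) (j : nat) (a : nat -> nat) :
  is_scaling_factor H j a -> forall (K0 : nat) (S0 : R),
  \forall nu \near within (sample_sizes a j) \oo,
    [/\ (0 < a nu * 2 ^ j)%N, (K0 <= nu %/ (a nu * 2 ^ j))%N, (0 < nu %/ (a nu * 2 ^ j))%N &
        S0 <= (a nu * 2 ^ j)%N%:R].
Proof.
move=> [pow2 _ rate] K0 S0; set p := 1 + 2 * _ in rate.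
(* If [a nu < S1], then [nu < (a nu)^p <= S1^|p|], which fails for large [nu]; the absolute value
   covers either sign of the exponent. *)
pose S1 := Num.max 1 S0; have S11 : 1 <= S1 by rewrite le_max lexx.
have dl0 : 0 < (K0.+1 * 2 ^ j)%N%:R^-1 :> R by rewrite invr_gt0 ltr0n muln_gt0 expn_gt0.
have FF : Filter (nbhs (within (sample_sizes a j) \oo))  by apply: within_filter.
have h1 := cvgr_lt _ rate _ dl0.
have h2 : \forall nu \near within (sample_sizes a j) \oo, sample_sizes a j nu /\ S1 `^ `|p| <= nu%:R.
  by rewrite near_withinE; near=> nu => Dnu; split=> //; near: nu; exact: nbhs_infty_ger.
apply: (@filterS2 _ _ FF _ _ _ _ (h1 FF) h2) => nu f [Dn Ln].
have [m am] := pow2 nu Dn; have [nu0 dv] := Dn.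
have a0 : (0 < a nu)%N by rewrite am expn_gt0.
have s0 : (0 < a nu * 2 ^ j)%N by rewrite muln_gt0 a0 expn_gt0.
set s := (a nu * 2 ^ j)%N in s0 dv *; set K := (nu %/ s)%N.
have nuE : nu = (K * s)%N by rewrite /K divnK.
have K0' : (0 < K)%N by move: nu0; rewrite nuE muln_gt0 => /andP[].
have a0' : 0 < (a nu)%:R :> R by rewrite ltr0n.
have nu0' : 0 < nu%:R :> R by rewrite ltr0n.
have t1 : 0 <= (a nu)%:R / nu%:R :> R by rewrite divr_ge0.
have t2 : 0 <= nu%:R / (a nu)%:R `^ p :> R by rewrite divr_ge0// powR_ge0.
split => //.
- have : (a nu)%:R / nu%:R < (K0.+1 * 2 ^ j)%N%:R^-1 :> R.
    by apply: le_lt_trans f; rewrite lerDl.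
  rewrite ltr_pdivrMr// mulrC ltr_pdivlMr ?ltr0n ?muln_gt0 ?expn_gt0//.
  rewrite -natrM ltr_nat [X in (_ < X)%N]nuE mulnCA -/s ltn_pmul2r//.
  by move/ltnW/ltnW.
- apply: (@le_trans _ _ (a nu)%:R); last by rewrite ler_nat leq_pmulr ?expn_gt0.
  have : nu%:R / (a nu)%:R `^ p < 1 :> R.
    apply: lt_le_trans (_ : (K0.+1 * 2 ^ j)%N%:R^-1 <= 1); first by apply: le_lt_trans f; rewrite lerDr.
    by rewrite invf_le1 ?ltr0n ?ler1n ?muln_gt0 ?expn_gt0.
  rewrite ltr_pdivrMr ?powR_gt0// mul1r => nup.
  apply: contraTT Ln; rewrite -!ltNge => aS.
  apply: (lt_le_trans nup); apply: (@le_trans _ _ ((a nu)%:R `^ `|p|)).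
    by apply: ler_powR; rewrite ?ler1n ?ler_norm.
  apply: ge0_ler_powR; rewrite ?nnegrE ?(le_trans ler01 S11)//.
  by apply/ltW/(lt_le_trans aS); rewrite le_max lexx orbT.
Unshelve. all: by end_near. Qed.

Section assembly.
Context (R : realType) (n : nat) (H P : 'M[R]_n) (A : 'M[R[i]]_n) (h : 'I_n -> R).
Hypothesis PP : P *m P^T = 1%:M.
Hypothesis HP : H = P *m diag_mx (\row_q h q) *m invmx P.
Hypothesis ImA : map_mx (@complex.Im R) (A *m A ^t*) = 0.
Hypothesis rkA : \rank (map_mx (@complex.Re R) (A *m A ^t*)) = n.
Hypothesis h01 : forall q, 0 < h q < 1.
Context d (T : measurableType d) (Pr : probability T R) (B : R -> T -> 'cV[R]_n).
Hypothesis ofbmB : is_ofbm Pr H A B.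
Variables (N : nat) (psi : R -> R).
Hypothesis wpsi : is_wavelet N psi.
Notation leb := (@lebesgue_measure R).
Notation corr := (wavelet_corr P A h psi).

(** The matrix [V] of the overview; [limit_variance] is its limit [b]. *)
Definition normalized_variance (s K : nat) (w : T) : 'M[R]_n := \matrix_(q, r)
  (K%:R^-1 * \sum_(k < K) (s%:R `^ (- h q) * (P^T *m wavelet_transform psi B s k.+1%:Z w) q 0) *
                          (s%:R `^ (- h r) * (P^T *m wavelet_transform psi B s k.+1%:Z w) r 0)).

Definition limit_variance : 'M[R]_n := \matrix_(q, r)
  \int[leb]_y (fpower psi y * (ofbm_cov_matrix P A q r * `|y| `^ (1 - h q - h r))).

Lemma limit_variance_L1 q r :
  L1 leb (fun y => fpower psi y * (ofbm_cov_matrix P A q r * `|y| `^ (1 - h q - h r))).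
Proof.
have [M psiM] := wavelet_bounded wpsi; have [K K0 hK] := wavelet_power_weight wpsi psiM.
have -> : (fun y => fpower psi y * (ofbm_cov_matrix P A q r * `|y| `^ (1 - h q - h r))) =
  (fun y => ofbm_cov_matrix P A q r * (fpower psi y * `|y| `^ (1 - h q - h r))).
  by apply/funext => y; ring.
apply: L1Z; apply: (L1_le _ (L1Z K (@L1_inv1Dsqr R))).
  apply: measurable_funM; last exact: measurable_powR_norm.
  exact: (measurable_fpower (wavelet_L1_psi wpsi)).
move=> y; have f0 : 0 <= fpower psi y by apply: divr_ge0; [apply: addr_ge0; exact: sqr_ge0|exact: sqr_ge0].
rewrite ger0_norm; last exact: mulr_ge0 f0 (powR_ge0 _ _).
by apply: hK; have := h01 q; have := h01 r; lra.
Qed.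

Lemma limit_variance_form (v : 'cV[R]_n) : qform limit_variance v = corr (fun q => v q 0) 0.
Proof.
rewrite qformE /wavelet_corr.
have -> : (fun y => cos (0%:~R * y) * wavelet_density P A h psi (fun q => v q 0) y) =
  (fun y => \sum_q \sum_r v q 0 * v r 0 * (fpower psi y * (ofbm_cov_matrix P A q r * `|y| `^ (1 - h q - h r)))).
  apply/funext => y; rewrite mul0r cos0 mul1r /wavelet_density /spectral_weight mulr_sumr.
  by apply: eq_bigr => q _; rewrite mulr_sumr; apply: eq_bigr => r _; ring.
rewrite rint_sum; last by move=> q; apply: L1_sum => r; apply: L1Z; exact: limit_variance_L1.
apply: eq_bigr => q _; rewrite rint_sum; last by move=> r; apply: L1Z; exact: limit_variance_L1.
apply: eq_bigr => r _; rewrite rintZ; last exact: limit_variance_L1.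
by rewrite mxE.
Qed.

Lemma limit_variance_sym : limit_variance^T = limit_variance.
Proof.
have cs : (ofbm_cov_matrix P A)^T = ofbm_cov_matrix P A.
  rewrite /ofbm_cov_matrix !trmx_mul trmxK mulmxA; congr (_ *m _ *m _).
  apply/matrixP => q r; rewrite !mxE !Re_sum; apply: eq_bigr => i _; rewrite !mxE.
  by case: (A q i) (A r i) => [x y] [z t] /=; ring.
have csE q r : ofbm_cov_matrix P A r q = ofbm_cov_matrix P A q r by rewrite -{1}cs mxE.
apply/matrixP => q r; rewrite [LHS]mxE [LHS]mxE [RHS]mxE; apply: eq_Rintegral => y _.
by rewrite csE addrAC.
Qed.

Lemma limit_variance_pos (x : 'cV[R]_n) : x != 0 -> 0 < qform limit_variance x.
Proof.
move=> x0; rewrite limit_variance_form.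
have [q xq] : exists q, x q 0 != 0.
  apply: contrapT => /forallNP no; move/eqP: x0; apply; apply/colP => q; rewrite mxE.
  by apply/eqP; apply: contrapT => /negP; exact: no.
exact: (@corr_gt0 _ _ P A h PP rkA h01 _ _ wpsi (fun q => x q 0) q xq).
Qed.

Lemma normalized_variance_form s K w (v : 'cV[R]_n) :
  qform (normalized_variance s K w) v = wavelet_form P h B psi s K (fun q => v q 0) w.
Proof.
rewrite qformE /wavelet_form mulr_sumr.
under eq_bigr do under eq_bigr do rewrite mxE mulrCA mulr_sumr mulr_sumr.
under eq_bigr do rewrite exchange_big; rewrite exchange_big; apply: eq_bigr => k _.
rewrite expr2 mulr_suml mulr_sumr; apply: eq_bigr => q _.
rewrite !mulr_sumr; apply: eq_bigr => r _; rewrite /scaled_coord; ring.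
Qed.

Lemma normalized_variance_sym s K w : (normalized_variance s K w)^T = normalized_variance s K w.
Proof.
by apply/matrixP => q r; rewrite !mxE; congr (_ * _); apply: eq_bigr => k _; rewrite mulrC.
Qed.

(** One exceptional event for all entries: the union over pairs [(q, r)] of the events where the
    form at [e_q + e_r] deviates, with [dl] shared among them. [polarization_bound] then passes from
    these forms to the entries. *)
Lemma normalized_variance_cvg (e dl : R) : 0 < e -> 0 < dl -> exists K0 : nat, forall K s : nat,
  (K0 <= K)%N -> (0 < K)%N -> (0 < s)%N -> exists bad : set T,
  [/\ measurable bad, (Pr bad <= dl%:E)%E & forall w, ~ bad w -> forall q r,
     `|normalized_variance s K w q r - limit_variance q r| <= e].
Proof.
move=> e0 dl0; pose v (p : 'I_n * 'I_n) : 'cV[R]_n := delta_mx p.1 0 + delta_mx p.2 0.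
pose m := size (enum [set: 'I_n * 'I_n]%SET).
have dl1 : 0 < dl / m.+1%:R by rewrite divr_gt0.
have /choice[K0 hK0] := fun p => wavelet_form_conc PP HP ImA h01 ofbmB wpsi (fun q => v p q 0) e0 dl1.
exists (\max_p K0 p)%N => K s KK K1 s0.
pose bad p := [set w | (e < `|wavelet_form P h B psi s K (fun q => v p q 0) w - corr (fun q => v p q 0) 0|)%R].
have mbad p : measurable (bad p).
  apply: measurable_gt; apply: measurableT_comp => //; apply: measurable_funB => //.
  exact: (measurable_wavelet_form P h ofbmB wpsi).
have bdl p : (Pr (bad p) <= (dl / m.+1%:R)%:E)%E.
  by apply: hK0 => //; apply: leq_trans KK; exact: leq_bigmax.
have [mb hb] := measure_bigU_le (enum [set: 'I_n * 'I_n]%SET) mbad bdl.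
exists (\big[setU/set0]_(i <- enum [set: 'I_n * 'I_n]%SET) bad i); split => //.
  apply: le_trans hb _; rewrite lee_fin -/m mulrCA ger_pMr// ler_pdivrMr// mul1r ler_nat//.
move=> w nb; set D := normalized_variance s K w - limit_variance.
have DD : D^T = D by rewrite /D [LHS]raddfB /= normalized_variance_sym limit_variance_sym.
move=> q r; have := @polarization_bound R n D e DD; rewrite /D; move=> /(_ _ q r).
rewrite !mxE; apply => x y.
rewrite qformB normalized_variance_form limit_variance_form leNgt; apply/negP => lt.
apply: nb; rewrite -bigcup_seq /=; exists (x, y) => //=.
by rewrite mem_enum inE.
Qed.

Lemma sample_wavelet_varianceE (a : nat -> nat) (j nu : nat) w (s := (a nu * 2 ^ j)%N) : (0 < s)%N ->
  sample_wavelet_variance psi B a j nu w =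
  P *m diag_mx (\row_q s%:R `^ h q) *m normalized_variance s (nu %/ s) w *m diag_mx (\row_q s%:R `^ h q) *m P^T.
Proof.
move=> s0; have s0' : 0 < s%:R :> R by rewrite ltr0n.
rewrite /sample_wavelet_variance -/s; set K := (nu %/ s)%N.
rewrite big_add1 /= big_mkord; set W := _ *: _.
have WE : W = P *m (P^T *m W *m P) *m P^T.
  by rewrite !mulmxA PP mul1mx -mulmxA PP mulmx1.
transitivity (P *m (diag_mx (\row_q s%:R `^ h q) *m normalized_variance s K w *m
   diag_mx (\row_q s%:R `^ h q)) *m P^T); last by rewrite !mulmxA.
rewrite [LHS]WE; congr (_ *m _ *m _).
rewrite /W -scalemxAr -scalemxAl mulmx_sumr mulmx_suml.
apply/matrixP => q r; rewrite mul_mx_diag mxE mxE mul_diag_mx !mxE summxE.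
rewrite mulrCA -mulrA; congr (_ * _); rewrite mulr_sumr mulr_suml; apply: eq_bigr => k _.
set D := wavelet_transform _ _ _ _ _.
rewrite (_ : P^T *m (D *m D^T) *m P = (P^T *m D) *m (P^T *m D)^T); last first.
  by rewrite trmx_mul trmxK !mulmxA.
rewrite mxE big_ord1 [(_^T) _ _]mxE.
rewrite [LHS](_ : _ = (P^T *m D) q 0 * (P^T *m D) r 0)//.
have e x : s%:R `^ x * s%:R `^ (- x) = 1 :> R.
  by rewrite -powR_gt0D// subrr powRr0.
rewrite [RHS](_ : _ = (s%:R `^ h q * s%:R `^ (- h q)) * (s%:R `^ h r * s%:R `^ (- h r)) *
  ((P^T *m D) q 0 * (P^T *m D) r 0)); last by ring.
by rewrite !e !mul1r.
Qed.

Hypothesis hmono : forall q r : 'I_n, (q < r)%N -> h q < h r.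

Lemma spectral_gap : exists2 de, 0 < de & forall q r : 'I_n, (q < r)%N -> de <= h r - h q.
Proof.
exists (\big[Num.min/1]_(p : 'I_n * 'I_n | (p.1 < p.2)%N) (h p.2 - h p.1)).
  by apply: lt_bigmin => // p /hmono; rewrite subr_gt0.
by move=> q r qr; apply: (bigmin_le_cond _ (j := (q, r))).
Qed.

(** [s^(h r - h q) >= s^de >= 1 / t] as soon as [s >= t^(-1/de)]. *)
Lemma powR_gap (t : R) : 0 < t <= 1 -> exists S0 : R, forall s : nat, S0 <= s%:R -> (0 < s)%N ->
  forall q r : 'I_n, (q < r)%N -> s%:R `^ h q <= t * s%:R `^ h r.
Proof.
move=> /andP[t0 t1]; have [de de0 hde] := spectral_gap.
exists (t^-1 `^ de^-1) => s sS s0 q r qr.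
have s0' : 0 < s%:R :> R by rewrite ltr0n.
have -> : h r = h q + (h r - h q) by rewrite addrC subrK.
rewrite powR_gt0D// mulrCA ler_pMr ?powR_gt0// mulrC -ler_pdivrMr// div1r.
apply: (@le_trans _ _ (s%:R `^ de)); last by apply: ler_powR; rewrite ?ler1n ?hde.
have -> : t^-1 = (t^-1 `^ de^-1) `^ de by rewrite -powRrM mulVf ?gt_eqF// powRr1// invr_ge0 ltW.
by apply: ge0_ler_powR; rewrite ?nnegrE ?powR_ge0 ?(ltW de0)// ltW.
Qed.

Lemma eigenvector_estimate q (e : R) : 0 < e -> exists (eV S0 : R), 0 < eV /\
  forall (s K : nat) w (u : 'cV[R]_n), (0 < s)%N -> S0 <= s%:R ->
  (forall x y, `|normalized_variance s K w x y - limit_variance x y| <= eV) ->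
  let S := P *m diag_mx (\row_q s%:R `^ h q) *m normalized_variance s K w *m diag_mx (\row_q s%:R `^ h q) *m P^T in
  sqn u = 1 -> S *m u = ordered_eigenvalue S q *: u ->
  (forall v : 'cV[R]_n, S *m v = ordered_eigenvalue S q *: v -> (v^T *m col q P) 0 0 != 0 ->
     0 <= (u^T *m col q P) 0 0) ->
  enorm (u - col q P) <= e.
Proof.
move=> e0; have [be be0 hbe] := pos_def_lower q limit_variance_sym limit_variance_pos.
have n0 : (0 < n)%N := leq_ltn_trans (leq0n q) (ltn_ord q).
have n0' : 0 < n%:R :> R by rewrite ltr0n.
(* An entrywise error [be / (2 n)] changes the form by at most [be / 2] times [sqn], so the lower
   bound [be / 2] survives for [V]. *)
pose eV := be / (2 * n%:R); have eV0 : 0 < eV by rewrite divr_gt0// mulr_gt0.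
pose m := \sum_x \sum_y `|limit_variance x y| + eV.
pose M := n%:R * m; have m0 : 0 <= m.
  by rewrite addr_ge0 ?(ltW eV0)// sumr_ge0// => x _; exact: sumr_ge0.
pose C := M ^+ 2 / (be / 2) ^+ 2 + M / (be / 2).
have be2 : 0 < be / 2 by rewrite divr_gt0.
have C0 : 0 <= C.
  by rewrite addr_ge0// divr_ge0 ?sqr_ge0 ?(ltW be2)// mulr_ge0// ltW.
have nC : 0 < n%:R * C + 1 by rewrite ltr_wpDl// mulr_ge0// ltW.
(* Chosen so that [n C t^2 <= n C t <= min(1, e^2) / 2]; the [+ 1] keeps the denominator
   positive. *)
pose t := Num.min 1 (e ^+ 2) / (2 * (n%:R * C + 1)).
have me : 0 < Num.min 1 (e ^+ 2) by rewrite lt_min ltr01 exprn_gt0.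
have t0 : 0 < t by rewrite divr_gt0// mulr_gt0.
have tE : (n%:R * C + 1) * t = Num.min 1 (e ^+ 2) / 2.
  by rewrite /t; field; rewrite gt_eqF.
have nC0 : 0 <= n%:R * C by rewrite mulr_ge0// ltW.
have t1 : t <= 1.
  have : Num.min 1 (e ^+ 2) <= 1 by rewrite ge_min lexx.
  have := mulr_ge0 nC0 (ltW t0); move: tE; lra.
have [|S0 hS0] := @powR_gap t; first by rewrite t0.
exists eV, S0; split => // s K w u s0 sS hV S u1 Su usel.
have s0' : 0 < s%:R :> R by rewrite ltr0n.
set V := normalized_variance s K w in hV S Su usel *.
have VV : V^T = V by exact: normalized_variance_sym.
have Vm x y : `|V x y| <= m.
  rewrite (_ : V x y = limit_variance x y + (V x y - limit_variance x y)); last by rewrite addrC subrK.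
  apply: le_trans (ler_normD _ _) _; rewrite /m lerD ?hV//.
  rewrite (bigD1 x)//= (bigD1 y)//= -addrA lerDl addr_ge0 ?sumr_ge0// => i _.
  by rewrite sumr_ge0.
have Vbe (z : 'cV[R]_n) : be / 2 * sqn z <= qform V z.
  have : `|qform (V - limit_variance) z| <= n%:R * eV * sqn z.
    by apply: qform_norm_le => x y; rewrite mxE [X in _ + X]mxE; exact: hV.
  rewrite (_ : n%:R * eV = be / 2); last by rewrite /eV; field; rewrite gt_eqF.
  by rewrite qformB ler_norml => /andP[+ _]; have := hbe z; lra.
have a0 r : 0 < s%:R `^ h r :> R by rewrite powR_gt0.
have t01 : 0 <= t <= 1 by rewrite (ltW t0).
have := @eigenvector_close R n P V (fun r => s%:R `^ h r) m (be / 2) t PP VV Vm be2 Vbe a0 t01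
  (hS0 s sS s0) q u u1 Su.
rewrite -/M -/C; set y := (u^T *m col q P) 0 0 in usel * => hy.
have eta : n%:R * C * t ^+ 2 <= Num.min 1 (e ^+ 2) / 2.
  have : n%:R * C * t ^+ 2 <= n%:R * C * t by rewrite expr2 ler_wpM2l// ler_piMl// ltW.
  by move: tE t0; lra.
(* The estimate gives [y^2 >= 1/2], so [u] itself is an eigenvector that is not orthogonal to the
   column, and the sign clause applies. *)
have y0 : 0 <= y.
  apply: (usel u Su); apply/eqP => y0; rewrite -/y in y0.
  have : Num.min 1 (e ^+ 2) <= 1 by rewrite ge_min lexx.
  by move: hy; rewrite y0 expr0n /=; move: eta; lra.
have sE := sqn_sub_unit u1 (sqn_col q PP); rewrite -/y in sE.
have y1 : y <= 1 by have := sqn_ge0 (u - col q P); rewrite sE; lra.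
have yy : y ^+ 2 <= y by rewrite expr2 ler_piMl.
(* As [0 <= y <= 1], [2 - 2 y <= 2 - 2 y^2 <= min(1, e^2)]. *)
have le2 : sqn (u - col q P) <= e ^+ 2.
  have : Num.min 1 (e ^+ 2) <= e ^+ 2 by rewrite ge_min lexx orbT.
  by rewrite sE; move: hy eta yy; lra.
rewrite /enorm -[leRHS](ger0_norm (ltW e0)) -sqrtr_sqr; apply: ler_wsqrtr; exact: le2.
Qed.

End assembly.

Theorem corollary3p1 (R : realType) (d : measure_display)
    (T : measurableType d) (Pr : probability T R) (n : nat)
    (H : 'M[R]_n) (A : 'M[R[i]]_n) (B : R -> T -> 'cV[R]_n)
    (P : 'M[R]_n) (h : 'I_n -> R)
    (Npsi : nat) (psi : R -> R) (a : nat -> nat) (j : nat) :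
  (2 <= n)%N ->
  is_ofbm Pr H A B ->
  \rank (map_mx (@complex.Re R) (A *m A ^t*)) = n ->
  map_mx (@complex.Im R) (A *m A ^t*) = 0 ->
  P *m P^T = 1%:M ->
  (forall q, 0 < h q < 1) ->
  (forall q r : 'I_n, (q < r)%N -> h q < h r) ->
  H = P *m diag_mx (\row_q h q) *m invmx P ->
  is_wavelet Npsi psi ->
  is_scaling_factor H j a ->
  forall q : 'I_n, exists u : nat -> T -> 'cV[R]_n,
    (forall nu : nat, sample_sizes a j nu ->
       (forall i, measurable_fun setT (fun w => u nu w i 0)) /\
       forall w, let W := sample_wavelet_variance psi B a j nu w in
         enorm (u nu w) = 1 /\
         W *m u nu w = ordered_eigenvalue W q *: u nu w) /\
    cvg_in_probability Pr (sample_sizes a j) u (col q P).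
Proof.
move=> _ ofbmB rkA ImA PP h01 hmono HP wpsi sc q.
pose W nu w := sample_wavelet_variance psi B a j nu w.
have psi1 := wavelet_L1_psi wpsi.
have mW nu i k : measurable_fun setT (fun w => W nu w i k).
  pose D (l : nat) w : 'cV[R]_n := wavelet_transform psi B (a nu * 2 ^ j) l%:Z w.
  rewrite (_ : (fun w => _) = fun w => (nu %/ (a nu * 2 ^ j))%N%:R^-1 *
    \sum_(1 <= l < (nu %/ (a nu * 2 ^ j)).+1) (D l w i 0 * D l w k 0)).
    apply: measurable_funM => //; apply: measurable_sum => l.
    by apply: measurable_funM; apply: (measurable_wavelet_transform ofbmB psi1).
  apply/funext => w; rewrite /W mxE summxE; congr (_ * _); apply: eq_bigr => l _.
  by rewrite -/(D l w); move: (D l w) => X; rewrite mxE big_ord1 mxE.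
have WW nu w : (W nu w)^T = W nu w.
  apply/matrixP => i k; rewrite !mxE !summxE; congr (_ * _); apply: eq_bigr => l _.
  by rewrite !mxE !big_ord1 !mxE mulrC.
have /choice[u hu] := fun nu => measurable_eigenvector (mW nu) (WW nu) q (col q P).
exists u; split.
  move=> nu _; have [mu pu] := hu nu; split => // w /=; have [u1 Wu _] := pu w; split => //.
  by rewrite /enorm -/(sqn (u nu w)) u1 sqrtr1.
move=> e e0.
have me nu : measurable [set w | e < enorm (u nu w - col q P)].
  have [mu _] := hu nu; apply: measurable_gt.
  apply: (measurableT_comp (measurable_cont (@sqrt_continuous R))).
  apply: measurable_sum => i; apply: measurable_funX.
  rewrite (_ : (fun w => _) = fun w => u nu w i 0 + (- col q P) i 0).
    by apply: measurable_funD.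
  by apply/funext => w; rewrite mxE.
have FF : Filter (within (sample_sizes a j) \oo) by apply: within_filter.
have fin nu : Pr [set w | e < enorm (u nu w - col q P)] \is a fin_num by exact: fin_num_measure.
apply/fine_cvgP; split; first by apply: nearW => nu; exact: fin.
apply/cvgrPdist_le => dl dl0.
(* The deterministic estimate sets the precision [eV] and the least scale [S0]; concentration at
   that precision and level [dl] then sets the number [K0] of locations. *)
have [eV [S0 [eV0 est]]] := eigenvector_estimate PP rkA h01 B wpsi hmono q e0.
have [K0 hK0] := normalized_variance_cvg PP HP ImA h01 ofbmB wpsi eV0 dl0.
apply: filterS (scaling_near sc K0 S0) => nu [s0 KK K1 sS].
have [bad [mbad Pbad good]] := hK0 _ _ KK K1 s0.
rewrite sub0r normrN ger0_norm ?fine_ge0//= -lee_fin fineK//.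
apply: le_trans Pbad; apply: (@le_measure _ _ _ Pr); [rewrite inE; exact: me|by rewrite inE|].
move=> w /= ew; apply: contrapT => /good hw.
have [_ pu] := hu nu; have [u1 Wu usel] := pu w.
move: ew; apply/negP; rewrite -leNgt.
have WE : W nu w = _ := sample_wavelet_varianceE h PP B psi w s0.
by rewrite WE in Wu usel; exact: est hw u1 Wu usel.
Qed.
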